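(* Let $\tilde X(\alpha,t)$, $\tilde v(x,t)$, $\tilde\rho$ be the approximate particle trajectories, velocity field and density of the blob method off the grid (defined in the context), on a time interval $[0,T_0]$ on which they exist. Then the blob method conserves mass: for $\Omega\subseteq\mathbb R^d$ (measurable), $$\frac{d}{dt}\int_{\tilde X(\Omega,t)}\tilde\rho(x,t)\,dx=0,\qquad t\in[0,T_0],$$ where $\tilde X(\Omega,t)=\{\tilde X(\alpha,t):\alpha\in\Omega\}$.
   Context: $d\ge1$, $K:\mathbb R^d\to\mathbb R$ is a kernel, $\psi$ is a smooth, radial, rapidly decreasing mollifier, $\delta>0$, $\psi_\delta(x)=\delta^{-d}\psi(x/\delta)$, $K_\delta=K*\psi_\delta$. It is a standing fact in the setting that $\nabla K_\delta$ is continuously differentiable and that $\nabla K_\delta$ and $\Delta K_\delta$ are locally Lipschitz. The initial density $\rho_0\ge0$ is a compactly supported integrable function. For $h>0$ and $i,j\in\mathbb Z^d$, $\rho_{0j}=\rho_0(jh)$ and $\tilde X_i(t)$ solves $\frac{d}{dt}\tilde X_i(t)=-\sum_j\nabla K_\delta(\tilde X_i(t)-\tilde X_j(t))\rho_{0j}h^d$, $\tilde X_i(0)=ih$. Blob method off the grid: for $\alpha\in\mathbb R^d$, $$\frac{d}{dt}\tilde X(\alpha,t)=-\sum_j\nabla K_\delta(\tilde X(\alpha,t)-\tilde X_j(t))\rho_{0j}h^d,\qquad \tilde X(\alpha,0)=\alpha;$$ $$\tilde v(x,t)=-\sum_j\nabla K_\delta(x-\tilde X_j(t))\rho_{0j}h^d;$$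 $$\frac{d}{dt}\tilde\rho(\tilde X(\alpha,t),t)=-(\nabla\cdot\tilde v)(\tilde X(\alpha,t),t)\,\tilde\rho(\tilde X(\alpha,t),t),\qquad \tilde\rho(\alpha,0)=\rho_0(\alpha).$$ *)

(* Defs.v *)
From HB Require Import structures.
From mathcomp Require Import all_boot all_order all_algebra.
From mathcomp Require Import all_classical all_reals all_analysis.

Set Implicit Arguments.
Unset Strict Implicit.
Unset Printing Implicit Defensive.
Import Order.TTheory GRing.Theory Num.Theory.
Import numFieldNormedType.Exports.

Local Open Scope classical_set_scope.
Local Open Scope ring_scope.

(* Lebesgue measure on 'rV[R]_n: the n-fold product of lebesgue_measure on the
   sigma-algebra generated by the coordinates, then its completion, whose
   measurable sets are the Lebesgue measurable ones. *)

Section rV_measurable.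
Context {R : realType} (n : nat).

Let coord (i : 'I_n) (x : 'rV[R]_n) : R := x ord0 i.

Let rV_set0 : g_sigma_preimage coord set0.
Proof. exact: sigma_algebra0. Qed.

Let rV_setC A : g_sigma_preimage coord A -> g_sigma_preimage coord (~` A).
Proof. exact: sigma_algebraC. Qed.

Let rV_bigcup (F : _^nat) : (forall i, g_sigma_preimage coord (F i)) ->
  g_sigma_preimage coord (\bigcup_i (F i)).
Proof. exact: sigma_algebra_bigcup. Qed.

HB.instance Definition _ := @isMeasurable.Build default_measure_display
  'rV[R]_n (g_sigma_preimage coord) rV_set0 rV_setC rV_bigcup.

Lemma measurable_rV_coord i :
  measurable_fun [set: 'rV[R]_n] (fun x : 'rV[R]_n => x ord0 i).
Proof.
move=> _ Y mY; rewrite setTI; apply: sub_sigma_algebra => /=.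
rewrite -bigcup_seq/=; exists i => /=; first by rewrite mem_index_enum.
by exists Y => //; rewrite setTI.
Qed.

Lemma measurable_fun_rV d (T : measurableType d) (f : T -> 'rV[R]_n) :
  (forall i, measurable_fun [set: T] (fun t => f t ord0 i)) ->
  measurable_fun [set: T] f.
Proof.
move=> mf _ A mA; rewrite setTI.
have : (g_sigma_preimage (fun i => coord i \o f)) (f @^-1` A).
  by rewrite g_sigma_preimage_comp; exists A => //; rewrite setTI.
apply: smallest_sub; first exact: sigma_algebra_measurable.
rewrite -bigcup_seq; apply: bigcup_sub => i _ B [C mC <-].
by apply: mf.
Qed.

End rV_measurable.

Section rV_cons_measure.
Context {R : realType} (n : nat).

Definition rV_cons (p : measurableTypeR R * 'rV[R]_n) : 'rV[R]_n.+1 :=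
  row_mx (const_mx p.1 : 'rV_1) p.2.

Definition rV_uncons (x : 'rV[R]_n.+1) : measurableTypeR R * 'rV[R]_n :=
  (x ord0 ord0, \row_j x ord0 (lift ord0 j)).

Lemma rV_cons0 p : rV_cons p ord0 ord0 = p.1.
Proof. by rewrite mxE; case: splitP => // j _; rewrite mxE. Qed.

Lemma rV_consS p (i : 'I_n) : rV_cons p ord0 (lift ord0 i) = p.2 ord0 i.
Proof.
rewrite mxE; case: splitP => [j|j].
  by rewrite ord1 /= /bump leq0n.
by rewrite /= /bump leq0n => -[ij]; congr (p.2 _ _); apply/val_inj.
Qed.

Lemma rV_consK : cancel rV_cons rV_uncons.
Proof.
case=> a x; rewrite /rV_uncons rV_cons0; congr pair.
by apply/rowP => j; rewrite mxE rV_consS.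
Qed.

Lemma measurable_rV_cons : measurable_fun [set: measurableTypeR R * 'rV[R]_n] rV_cons.
Proof.
apply: measurable_fun_rV => i.
have [j ->|->] := unliftP ord0 i.
  under eq_fun do rewrite rV_consS.
  by apply: (measurableT_comp (measurable_rV_coord j)).
under eq_fun do rewrite rV_cons0.
exact: measurable_fst.
Qed.

Lemma measurable_rV_uncons : measurable_fun [set: 'rV[R]_n.+1] rV_uncons.
Proof.
apply: measurable_fun_pair; first exact: measurable_rV_coord.
apply: measurable_fun_rV => i; under eq_fun do rewrite mxE.
exact: measurable_rV_coord.
Qed.

Definition rV_cons_measure (mu : {sigma_finite_measure set 'rV[R]_n -> \bar R})
    : set 'rV[R]_n.+1 -> \bar R :=
  pushforward (lebesgue_measure \x mu)%E rV_cons.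

Variable mu : {sigma_finite_measure set 'rV[R]_n -> \bar R}.

Let measurable_preimage (A : set 'rV[R]_n.+1) :
  measurable A -> measurable (rV_cons @^-1` A).
Proof. by move=> mA; rewrite -[X in measurable X]setTI; exact: measurable_rV_cons. Qed.

Let rV_cons_measure0 : rV_cons_measure mu set0 = 0%E.
Proof. by rewrite /rV_cons_measure /pushforward preimage_set0 measure0. Qed.

Let rV_cons_measure_ge0 A : (0 <= rV_cons_measure mu A)%E.
Proof. exact: (measure_ge0 (lebesgue_measure \x mu)%E). Qed.

Let rV_cons_measure_sigma_additive : semi_sigma_additive (rV_cons_measure mu).
Proof.
move=> F mF tF mUF; rewrite /rV_cons_measure /pushforward preimage_bigcup.
apply: measure_semi_sigma_additive.
- by move=> n'; exact: measurable_preimage.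
- apply/trivIsetP => /= i j _ _ ij; rewrite -preimage_setI.
  by move/trivIsetP : tF => /(_ _ _ _ _ ij) ->//; rewrite preimage_set0.
- by rewrite -preimage_bigcup; exact: measurable_preimage.
Qed.

HB.instance Definition _ := isMeasure.Build _ _ _ (rV_cons_measure mu)
  rV_cons_measure0 rV_cons_measure_ge0 rV_cons_measure_sigma_additive.

Let rV_cons_measure_sigma_finite :
  sigma_finite [set: 'rV[R]_n.+1] (rV_cons_measure mu).
Proof.
have /sigma_finiteP[F [TF ndF Foo]] := sigma_finiteT (@lebesgue_measure R).
have /sigma_finiteP[G [TG ndG Goo]] := sigma_finiteT mu.
exists (fun k => rV_uncons @^-1` (F k `*` G k)).
  apply/esym; rewrite -subTset => x _.
  have [i _ Fi] : (\bigcup_i F i) (rV_uncons x).1 by rewrite -TF.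
  have [j _ Gj] : (\bigcup_j G j) (rV_uncons x).2 by rewrite -TG.
  exists (maxn i j) => //; split.
    by move: Fi; exact/subsetPset/ndF/leq_maxl.
  by move: Gj; exact/subsetPset/ndG/leq_maxr.
move=> k; have [mFk Fkoo] := Foo k; have [mGk Gkoo] := Goo k; split.
  rewrite -[X in measurable X]setTI; apply: measurable_rV_uncons => //.
  exact: measurableX.
rewrite /rV_cons_measure /pushforward -comp_preimage.
rewrite (_ : rV_uncons \o rV_cons = id); last first.
  by apply/funext => p /=; rewrite rV_consK.
by rewrite preimage_id product_measure1E// lte_mul_pinfty// ge0_fin_numE.
Qed.

HB.instance Definition _ := Measure_isSigmaFinite.Build _ _ _
  (rV_cons_measure mu) rV_cons_measure_sigma_finite.

End rV_cons_measure.

Fixpoint product_lebesgue {R : realType} (n : nat) :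
    {sigma_finite_measure set 'rV[R]_n -> \bar R} :=
  match n with
  | 0 => \d_ (0 : 'rV[R]_0)
  | n'.+1 => rV_cons_measure (product_lebesgue n')
  end.

Definition lebesgue_rV {R : realType} (n : nat) :=
  @completed_measure_extension _ _ _ (@product_lebesgue R n).
Arguments lebesgue_rV {R} n.
HB.instance Definition _ (R : realType) (n : nat) :=
  Measure.on (@lebesgue_rV R n).

Definition lebesgue_measurable {R : realType} (n : nat) (A : set 'rV[R]_n) :=
  (product_lebesgue n)^*%mu.-cara.-measurable A.

Section blob_method.
Context {R : realType} {d : nat}.
Implicit Types (f g K psi : 'rV[R]_d -> R) (x alpha : 'rV[R]_d).

Definition partial (i : 'I_d) f : 'rV[R]_d -> R := 'D_(delta_mx 0 i) f.

Definition gradient f x : 'rV[R]_d := \row_i partial i f x.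

Definition divergence (v : 'rV[R]_d -> 'rV[R]_d) x : R :=
  \sum_i partial i (fun y => v y 0 i) x.

Definition laplacian f : 'rV[R]_d -> R := divergence (gradient f).

(* The library norm on 'rV[R]_d is the sup norm. *)
Definition euclidean_norm x : R := Num.sqrt (\sum_i x 0 i ^+ 2).

Definition smooth f :=
  forall (s : seq 'I_d) x, differentiable (foldr partial f s) x.

Definition radial f := exists g : R -> R, forall x, f x = g (euclidean_norm x).

Definition rapidly_decreasing f :=
  forall n : nat, exists C : R, forall x, euclidean_norm x ^+ n * `|f x| <= C.

(* No sign condition: high-order mollifiers take negative values. *)
Definition mollifier psi :=
  [/\ smooth psi, radial psi, rapidly_decreasing psi
    & \int[lebesgue_rV d]_x psi x = 1].

Definition rescale psi (delta : R) x : R := delta ^- d * psi (delta^-1 *: x).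

(* The integral has a junk value when the integrand is not integrable, hence
   the companion predicate convolvable. *)
Definition convolution f g x : R := \int[lebesgue_rV d]_y (f y * g (x - y)).

Definition convolvable f g := forall x,
  (lebesgue_rV d).-integrable setT (fun y => (f y * g (x - y))%:E).

Definition regular_kernel K :=
  [/\ forall x, differentiable K x,
      forall x, differentiable (gradient K) x,
      continuous (jacobian (gradient K)),
      [locally [lipschitz gradient K x | x in setT]]
    & [locally [lipschitz laplacian K x | x in setT]]].

Definition initial_density (rho0 : 'rV[R]_d -> R) :=
  [/\ forall x, 0 <= rho0 x,
      compact (closure [set x | rho0 x != 0])
    & (lebesgue_rV d).-integrable setT (EFin \o rho0)].

(* f has derivative l at t relative to A: one-sided at an endpoint of A. *)
Definition is_derive_within (V : normedModType R) (A : set R) (f : R -> V)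
    (t : R) (l : V) :=
  (s - t)^-1 *: (f s - f t) @[s --> within A t^'] --> l.

Definition grid (h : R) (j : 'rV[int]_d) : 'rV[R]_d :=
  h *: map_mx (fun k : int => k%:~R) j.

(* G stands for the gradient of the regularized kernel and Xp for the particles.
   The sum over all of Z^d is the library sum over a finite support: rho0 is
   compactly supported, so only finitely many grid points contribute. *)
Definition blob_velocity (G : 'rV[R]_d -> 'rV[R]_d)
    (rho0 : 'rV[R]_d -> R) (h : R)
    (Xp : 'rV[int]_d -> R -> 'rV[R]_d) x (t : R) : 'rV[R]_d :=
  - \sum_(j \in [set: 'rV[int]_d])
      (rho0 (grid h j) * h ^+ d) *: G (x - Xp j t).

Definition blob_particles G rho0 h (T0 : R) Xp :=
  forall i : 'rV[int]_d, Xp i 0 = grid h i /\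
    {in `[0, T0], forall t, is_derive_within `[0, T0] (Xp i) t
      (blob_velocity G rho0 h Xp (Xp i t) t)}.

Definition blob_trajectories G rho0 h (T0 : R) Xp (X : 'rV[R]_d -> R -> 'rV[R]_d) :=
  forall alpha, X alpha 0 = alpha /\
    {in `[0, T0], forall t, is_derive_within `[0, T0] (X alpha) t
      (blob_velocity G rho0 h Xp (X alpha t) t)}.

Definition blob_density G rho0 h (T0 : R) Xp X (rho : 'rV[R]_d -> R -> R) :=
  forall alpha, rho alpha 0 = rho0 alpha /\
    {in `[0, T0], forall t,
      is_derive_within `[0, T0] (fun s => rho (X alpha s) s) t
        (- divergence (blob_velocity G rho0 h Xp ^~ t) (X alpha t)
         * rho (X alpha t) t)}.

End blob_method.

(* Main.v *)
From HB Require Import structures.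
Require Import Defs.
From mathcomp Require Import all_boot all_order all_algebra.
From mathcomp Require Import all_classical all_reals all_analysis.
From mathcomp Require Import ring lra zify measurable_realfun.
Import Order.TTheory GRing.Theory Num.Theory.
Import numFieldNormedType.Exports.

(** The trajectories of the blob method form the flow X of a velocity field v that is
continuous in time and continuously differentiable in space. Let Lam a t be the
integral over [0, t] of the divergence of v along the trajectory of a. The equation
for the density says that rho (X a t) t * expR (Lam a t) is constant along
trajectories, hence equal to rho0 a (blob_density_jacobian). Liouville's formula says
that expR (Lam a t) is the Jacobian of a |-> X a t. Changing variables, the mass of
the density at time t over the image of Omega is the integral of rho0 over Omega
(flow_mass), which does not depend on t.

Most of the text proves Liouville's formula and the change of variables, without
determinants. In each time step of length h the coordinates are moved one after the
other, x_i := x_i + h * v_i x, with v frozen in time and evaluated at a point clamped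
to a large box. Each such shear moves a single coordinate, so Tonelli's theorem
(shear_transport) reduces its effect on volumes to that of an increasing function of
one variable (increasing_transport): the shear transports the measure with density
1 + h * d_i v_i to Lebesgue measure (shear_transports). The composite of all shears
converges to the flow uniformly on bounded sets (euler_error), its density, a product
of factors 1 + h * d_i v_i, converges to expR Lam (euler_jacobian_close), and it is
onto and expands distances at least by a factor that does not depend on h
(flow_approximation).

For a compact set A this gives both inequalities between the volume of the image of A
and the integral of expR Lam over A (jacobian_le_image, image_le_jacobian). The
equality extends to Borel sets by uniqueness of measures (flow_image_measure), to
Lebesgue measurable sets by enclosing them between Borel sets that differ by a null
set (flow_image_lebesgue), and to integrals (flow_change_of_variables). The flow is
injective, but it need not be onto: for v x = - x ^ 3 on the line the image at every
positive time is a bounded interval. The argument therefore works with images under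
the flow and never with an inverse flow on the whole space. *)

Set Implicit Arguments.
Unset Strict Implicit.
Unset Printing Implicit Defensive.

Local Open Scope classical_set_scope.
Local Open Scope ring_scope.

(** * Row vectors: the sup norm and Borel sets *)

Section RowVectorNorm.
Context {R : realType} {n : nat}.
Implicit Types x y : 'rV[R]_n.

Lemma ler_coord_norm x i : `|x ord0 i| <= `|x|.
Proof.
rewrite [leRHS]/Num.norm /= mx_normrE; apply/bigmax_geP; right => /=.
by exists (ord0, i).
Qed.

Lemma rV_norm_le x (e : R) : 0 <= e ->
  (forall i, `|x ord0 i| <= e) -> `|x| <= e.
Proof.
move=> e0 xe; rewrite [leLHS]/Num.norm /= mx_normrE; apply/bigmax_leP; split => //=.
by case=> i j _ /=; rewrite ord1.
Qed.

Lemma rV_norm_lt x (e : R) : 0 < e ->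
  (forall i, `|x ord0 i| < e) -> `|x| < e.
Proof.
move=> e0 xe; rewrite [ltLHS]/Num.norm /= mx_normrE; apply/bigmax_ltP; split => //=.
by case=> i j _ /=; rewrite ord1.
Qed.

End RowVectorNorm.

Section BorelRowVectors.
Context {R : realType}.

(** The measurable sets are generated by the coordinates. An open set is the
union of the boxes with rational centre and radius 1 / (k + 1) that it contains,
and there are countably many of these. *)
Lemma open_measurable_rV n (A : set 'rV[R]_n) : open A -> measurable A.
Proof.
move=> oA.
pose box (qk : 'rV[rat]_n * nat) : set 'rV[R]_n :=
  \bigcap_(i in [set: 'I_n])
   (fun x : 'rV[R]_n => x ord0 i) @^-1`
     (ball (ratr (qk.1 ord0 i) : R) (qk.2.+1%:R^-1)).
have mbox qk : measurable (box qk).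
  apply: fin_bigcap_measurable => // i _.
  rewrite -[X in measurable X]setTI; apply: measurable_rV_coord => //.
  by apply: open_measurable; apply: ball_open; rewrite invr_gt0.
pose D := [set qk | box qk `<=` A].
rewrite (_ : A = \bigcup_(qk in D) box qk); last first.
  apply/seteqP; split => [x Ax|x [qk /= + bx]]; last exact.
  have /nbhs_ballP[e /= e0 xeA] : nbhs x A by exact: open_nbhs_nbhs.
  have [k ke] : exists k : nat, k.+1%:R^-1 < e / 2.
    have e20 : 0 < e / 2 by rewrite divr_gt0.
    have [N _ /(_ N)/= h] := near_infty_natSinv_lt (PosNum e20).
    by exists N; exact: h.
  have hq (i : 'I_n) : exists q : rat, `|x ord0 i - ratr q| < k.+1%:R^-1.
    have [|q] := @rat_in_itvoo R (x ord0 i - k.+1%:R^-1) (x ord0 i + k.+1%:R^-1).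
      by rewrite ltrD2l -subr_gt0 opprK addr_gt0.
    rewrite in_itv/= => /andP[q1 q2]; exists q.
    by rewrite ltr_distlC q1 q2.
  pose q := \row_i projT1 (cid (hq i)).
  have hqq i : `|x ord0 i - ratr (q ord0 i)| < k.+1%:R^-1.
    by rewrite mxE; exact: (projT2 (cid (hq i))).
  exists (q, k).
    move=> y /= yq; apply: xeA; rewrite -ball_normE /=.
    apply: rV_norm_lt => // i; rewrite !mxE.
    rewrite (_ : _ - _ = (x ord0 i - ratr (q ord0 i)) +
       (ratr (q ord0 i) - y ord0 i)); last by ring.
    rewrite (le_lt_trans (ler_normD _ _))// [ltRHS]splitr ltrD//.
      exact: lt_trans (hqq i) ke.
    by have := yq i I; rewrite /= /ball/= => /lt_trans; apply.
  by move=> i _; rewrite /= /ball/= distrC; exact: hqq.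
rewrite bigcup_mkcond; apply: countable_bigcupT_measurable => // qk.
by case: ifPn.
Qed.

Lemma closed_measurable_rV n (A : set 'rV[R]_n) : closed A -> measurable A.
Proof.
move=> cA; rewrite -(setCK A); apply: measurableC; apply: open_measurable_rV.
exact: closed_openC.
Qed.

Lemma compact_measurable_rV n (A : set 'rV[R]_n) : compact A -> measurable A.
Proof.
by move=> cA; apply: closed_measurable_rV; apply: compact_closed => //.
Qed.

Lemma continuous_measurable_rV n (f : 'rV[R]_n -> R) :
  continuous f -> measurable_fun [set: 'rV[R]_n] f.
Proof.
move=> cf; apply: (measurability _ (@RGenOpens.measurableE R)).
move=> /= _ [_ [a [b ->]] <-]; rewrite setTI.
apply: open_measurable_rV; apply: open_comp => //.
Qed.

Lemma continuous_measurable_rV_rV n m (f : 'rV[R]_n -> 'rV[R]_m) :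
  continuous f -> measurable_fun [set: 'rV[R]_n] f.
Proof.
move=> cf; apply: measurable_fun_rV => i; apply: continuous_measurable_rV.
move=> x.
apply: (@continuous_comp _ _ _ f (fun y : 'rV[R]_m => y ord0 i)); first exact: cf.
exact: coord_continuous.
Qed.

Definition closed_box n (k : R) : set 'rV[R]_n := [set x | `|x| <= k].

Lemma closed_closed_box n k : closed (@closed_box n k).
Proof.
have -> : @closed_box n k = (fun x : 'rV[R]_n => `|x|) @^-1` [set r | r <= k].
  by [].
apply: preimage_closed; last exact: closed_le.
by move=> x _; exact: norm_continuous.
Qed.

Lemma bounded_closed_box n k (A : set 'rV[R]_n) : A `<=` @closed_box n k ->
  bounded_set A.
Proof.
move=> Ak; exists k; split; first exact: num_real.
by move=> M kM x /Ak xk; apply: le_trans (ltW kM).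
Qed.

Lemma compact_closed_box n k : compact (@closed_box n k).
Proof.
apply: bounded_closed_compact; last exact: closed_closed_box.
exact: (@bounded_closed_box n k).
Qed.

Lemma bigcup_closed_box n : \bigcup_k @closed_box n k%:R = setT.
Proof.
rewrite -subTset => x _; exists (Num.bound `|x|) => //.
rewrite /closed_box/=; apply/ltW.
by have := archi_boundP (normr_ge0 x).
Qed.

(** Makes the uniqueness theorem for measures applicable with compact sets as
the generating family, closed under intersection by setI_closed_compact. *)
Lemma measurable_rV_compacts n :
  @measurable _ 'rV[R]_n = <<s [set A | compact A] >>.
Proof.
apply/seteqP; split; last first.
  apply: smallest_sub; first exact: sigma_algebra_measurable.
  by move=> A; exact: compact_measurable_rV.
have closedS (C : set 'rV[R]_n) : closed C -> <<s [set A | compact A] >> C.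
  move=> cC; rewrite -(setIT C) -(bigcup_closed_box n) setI_bigcupr.
  apply: sigma_algebra_bigcup => k; apply: sub_sigma_algebra => /=.
  apply: bounded_closed_compact.
    by apply: (@bounded_closed_box n k%:R _) => x [].
  by apply: closedI => //; exact: closed_closed_box.
apply: smallest_sub; first exact: smallest_sigma_algebra.
rewrite -bigcup_seq; apply: bigcup_sub => i _ B [C mC <-]; rewrite setTI.
pose f (x : g_sigma_algebraType [set A : set 'rV[R]_n | compact A]) : R :=
  x ord0 i.
suff mf : measurable_fun setT f by rewrite -[X in <<s _ >> X]setTI; exact: mf.
apply: (measurability _ (@RGenCInfty.measurableE R)).
move=> /= _ [_ [a ->] <-]; rewrite setTI; apply: closedS.
apply: preimage_closed; last exact: interval_closed.
by move=> x _; exact: coord_continuous.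
Qed.

Lemma setI_closed_compact n : setI_closed [set A : set 'rV[R]_n | compact A].
Proof.
move=> A B /= cA cB; apply: (subclosed_compact _ cA) => //.
by apply: closedI; apply: compact_closed => //.
Qed.

End BorelRowVectors.

Lemma dist_le_continuous (R : realType) (V W : normedModType R) (f : V -> W) :
  (forall x y, `|f x - f y| <= `|x - y|) -> continuous f.
Proof.
move=> fL x; apply/cvgrPdist_lt => e e0; apply/nbhs_ballP; exists e => //= y.
by rewrite -ball_normE; apply: le_lt_trans; exact: fL.
Qed.

Lemma continuous_sumr (R : realType) (V : normedModType R) (S : topologicalType)
    (I : Type) (r : seq I) (f : I -> S -> V) :
  (forall i, continuous (f i)) -> continuous (fun x => \sum_(i <- r) f i x).
Proof.
move=> cf; elim: r => [|i r IH] x.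
  under eq_fun do rewrite big_nil.
  exact: cvg_cst.
under eq_fun do rewrite big_cons.
by apply: cvgD; [exact: cf|exact: IH].
Qed.

(** * Measures with a density; increasing maps of the line *)

Section Density.
Local Open Scope ereal_scope.
Context d (T : measurableType d) (R : realType).
Variables (mu : {measure set T -> \bar R}) (f : T -> R).

(** The two hypotheses on f are arguments of the constant so that its measure
structure can be found from the constant alone. *)
Definition density of measurable_fun setT f & (forall x, (0 <= f x)%R) :
  set T -> \bar R := fun A => \int[mu]_(x in A) (f x)%:E.

Hypotheses (mf : measurable_fun setT f) (f0 : forall x, (0 <= f x)%R).

Let density0 : density mf f0 set0 = 0.
Proof. by rewrite /density integral_set0. Qed.

Let density_ge0 A : 0 <= density mf f0 A.
Proof. by apply: integral_ge0 => x _; rewrite lee_fin. Qed.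

Let density_sigma_additive : semi_sigma_additive (density mf f0).
Proof.
apply: semi_sigma_additive_nng_induced; first exact/measurable_EFinP.
by move=> x; rewrite lee_fin.
Qed.

HB.instance Definition _ := isMeasure.Build _ _ _ (density mf f0)
  density0 density_ge0 density_sigma_additive.

Import HBNNSimple.

(** Both sides are linear in h, and for an indicator the equation is the
definition of the density. *)
Lemma integral_density_nnsfun (h : {nnsfun T >-> R}) :
  \int[density mf f0]_x (h x)%:E = \int[mu]_x ((h x)%:E * (f x)%:E).
Proof.
have mif r : measurable_fun setT (fun x => (\1_(h @^-1` [set r]) x)%:E * (f x)%:E).
  by apply: emeasurable_funM; apply/measurable_EFinP.
transitivity (\sum_(r \in range h)
    \int[density mf f0]_x (r * \1_(h @^-1` [set r]) x)%:E).
  under eq_integral do rewrite fimfunE -fsumEFin//.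
  rewrite ge0_integral_fsum// => [r|r x _].
    exact/measurable_EFinP/measurable_funM.
  by rewrite nnfun_muleindic_ge0.
transitivity (\sum_(r \in range h)
    \int[mu]_x ((r * \1_(h @^-1` [set r]) x)%:E * (f x)%:E)).
  apply: eq_fsbigr => r /[!inE] -[t _ <-].
  rewrite integralZl_indic_nnsfun// integral_indic// setIT.
  under [RHS]eq_integral do rewrite EFinM -muleA.
  rewrite ge0_integralZl//; last 2 first.
  - by move=> x _; rewrite mule_ge0 ?lee_fin.
  - by rewrite lee_fin.
  congr *%E; rewrite /= /density [LHS]integral_mkcond.
  by apply: eq_integral => x _; rewrite epatch_indic muleC.
rewrite -ge0_integral_fsum//=; last 2 first.
- move=> r; under eq_fun do rewrite EFinM -muleA.
  by apply: emeasurable_funM.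
- by move=> r x _; rewrite mule_ge0 ?lee_fin// -lee_fin nnfun_muleindic_ge0.
apply: eq_integral => x _; rewrite [in RHS]fimfunE -fsumEFin//.
by rewrite ge0_mule_fsuml// => r; rewrite nnfun_muleindic_ge0.
Qed.

(** Monotone convergence carries the formula from simple functions to all
non-negative measurable functions. *)
Lemma ge0_integral_density (g : T -> \bar R) :
  measurable_fun setT g -> (forall x, 0 <= g x) ->
  \int[density mf f0]_x g x = \int[mu]_x (g x * (f x)%:E).
Proof.
move=> mg g0; pose h := nnsfun_approx measurableT mg.
have hg x : EFin \o h^~ x @ \oo --> g x.
  by apply: cvg_nnsfun_approx.
transitivity (limn (fun n => \int[density mf f0]_x (h n x)%:E)).
  rewrite -monotone_convergence//.
  - by apply: eq_integral => x _; apply/esym/cvg_lim => //; exact: hg.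
  - by move=> n; exact/measurable_EFinP/measurable_funP.
  - by move=> n x _; rewrite lee_fin.
  - by move=> x _ m n mn; rewrite lee_fin; exact/lefP/nd_nnsfun_approx.
under eq_fun do rewrite integral_density_nnsfun.
rewrite -monotone_convergence//.
- apply: eq_integral => x _; apply/cvg_lim => //.
  by apply: cvgeZr => //; exact: hg.
- by move=> n; apply: emeasurable_funM; apply/measurable_EFinP.
- by move=> n x _; rewrite mule_ge0 ?lee_fin.
- move=> x _ m n mn; rewrite lee_wpmul2r ?lee_fin//.
  exact/lefP/nd_nnsfun_approx.
Qed.

Lemma ge0_integral_density_in (D : set T) (g : T -> \bar R) :
  measurable D -> measurable_fun D g -> (forall x, D x -> 0 <= g x) ->
  \int[density mf f0]_(x in D) g x = \int[mu]_(x in D) (g x * (f x)%:E).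
Proof.
move=> mD mg g0; rewrite [LHS]integral_mkcond (@ge0_integral_density (g \_ D)).
- rewrite [RHS]integral_mkcond; apply: eq_integral => x _.
  by rewrite /patch; case: ifPn => // _; rewrite mul0e.
- by apply/(measurable_restrictT _ mD).
- by move=> x; rewrite /patch; case: ifPn => // /set_mem/g0.
Qed.

End Density.

Section OneDimensional.
Context {R : realType}.
Local Notation leb := (@lebesgue_measure R).

(** The push-forward by F of the measure with density J gives the interval
]F a, F b] the mass F b - F a. As F is an increasing bijection these are all the
bounded intervals, so the push-forward is Lebesgue measure. *)
Lemma increasing_transport (F J : R -> R) (g : R -> \bar R) :
  measurable_fun setT F -> measurable_fun setT J -> (forall x, 0 <= J x) ->
  {homo F : x y / x < y} -> (forall y, exists x, F x = y) ->
  (forall a b : R, (a <= b)%R ->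
    \int[leb]_(x in `]a, b]) (J x)%:E = (F b - F a)%:E)%E ->
  measurable_fun setT g -> (forall y, (0 <= g y)%E) ->
  (\int[leb]_x (g (F x) * (J x)%:E) = \int[leb]_y g y)%E.
Proof.
move=> mF mJ J0 incF surF intJ mg g0.
have monoF : {mono F : x y / x < y} by exact: leW_mono (le_mono incF).
pose F' : measurableTypeR R -> measurableTypeR R := F.
have mF' : measurable_fun setT F' := mF.
have -> : (\int[leb]_y g y = \int[pushforward (density leb mJ J0) F']_y g y)%E.
  apply: eq_measure_integral => A mA _; apply: lebesgue_measure_unique => //.
  move=> _ [[c d] _ <-] /=.
  have [a Fa] := surF c; have [b Fb] := surF d.
  rewrite /pushforward (_ : F' @^-1` _ = `]a, b]%classic); last first.
    apply/seteqP; split => x /=;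
      by rewrite !in_itv/= -Fa -Fb monoF (le_mono incF).
  rewrite /density; have [ab|ba] := leP a b.
    rewrite intJ// Fa Fb lebesgue_measure_itv/= lte_fin.
    case: ltP => // dc; apply/esym; congr EFin; apply/eqP.
    by rewrite subr_eq0 eq_le dc/= -Fa -Fb (le_mono incF).
  rewrite (_ : `]a, b]%classic = set0); last first.
    by rewrite set_itv_ge// bnd_simp -leNgt ltW.
  rewrite integral_set0 (_ : `]c, d]%classic = set0) ?measure0//.
  by rewrite set_itv_ge// bnd_simp -leNgt -Fa -Fb (le_mono incF) ltW.
rewrite ge0_integral_pushforward// preimage_setT.
rewrite ge0_integral_density//; first exact: (measurableT_comp mg mF).
by move=> x; exact: g0.
Qed.

End OneDimensional.

(** * Maps that move one coordinate *)

Section Shears.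
Context {R : realType}.
Local Notation leb := (@lebesgue_measure R).

Definition set_coord n (i : 'I_n) (x : 'rV[R]_n) (s : R) : 'rV[R]_n :=
  \row_k if k == i then s else x ord0 k.

Lemma set_coord_same n (i : 'I_n) x s : set_coord i x s ord0 i = s.
Proof. by rewrite mxE eqxx. Qed.

Lemma set_coord_other n (i k : 'I_n) x s : k != i ->
  set_coord i x s ord0 k = x ord0 k.
Proof. by rewrite mxE => /negbTE ->. Qed.

Lemma set_coord_id n (i : 'I_n) x : set_coord i x (x ord0 i) = x.
Proof. by apply/rowP => k; rewrite mxE; case: eqP => [->|//]; rewrite ord1. Qed.

Lemma set_coord_set n (i : 'I_n) x s r :
  set_coord i (set_coord i x s) r = set_coord i x r.
Proof. by apply/rowP => k; rewrite !mxE; case: eqP. Qed.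

Lemma set_coord_cons0 n (a s : R) (y : 'rV[R]_n) :
  set_coord ord0 (rV_cons (a, y)) s = rV_cons (s, y).
Proof.
apply/rowP => k; rewrite mxE.
have [j ->|->] := unliftP ord0 k; last by rewrite eqxx rV_cons0.
by rewrite !rV_consS.
Qed.

Lemma set_coord_consS n (k : 'I_n) (a s : R) (y : 'rV[R]_n) :
  set_coord (lift ord0 k) (rV_cons (a, y)) s = rV_cons (a, set_coord k y s).
Proof.
apply/rowP => l; rewrite mxE.
have [j ->|->] := unliftP ord0 l; last by rewrite !rV_cons0.
by rewrite (inj_eq lift_inj) !rV_consS mxE.
Qed.

Lemma measurable_set_coord n (i : 'I_n) (F : 'rV[R]_n -> R) :
  measurable_fun setT F ->
  measurable_fun setT (fun x => set_coord i x (F x)).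
Proof.
move=> mF; apply: measurable_fun_rV => k.
under eq_fun do rewrite mxE.
by case: eqP => // _; exact: measurable_rV_coord.
Qed.

Lemma measurable_rV_cons_left n (a : R) :
  measurable_fun setT (fun y : 'rV[R]_n => rV_cons (a, y)).
Proof.
by apply: (measurableT_comp (@measurable_rV_cons R n)); exact: measurable_fun_pair.
Qed.

Lemma measurable_rV_cons_right n (y : 'rV[R]_n) :
  measurable_fun setT (fun a : measurableTypeR R => rV_cons (a, y)).
Proof.
by apply: (measurableT_comp (@measurable_rV_cons R n)); exact: measurable_fun_pair.
Qed.

Lemma ge0_integral_rV_cons n (h : 'rV[R]_n.+1 -> \bar R) :
  measurable_fun setT h -> (forall x, 0 <= h x)%E ->
  (\int[product_lebesgue n.+1]_x h x =
   \int[leb \x product_lebesgue n]_p h (rV_cons p))%E.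
Proof.
move=> mh h0.
have <- := @ge0_integral_pushforward _ _ _ _ _ _ (@measurable_rV_cons R n)
  (leb \x product_lebesgue n)%E setT h measurableT mh (fun x _ => h0 x).
by [].
Qed.

(** On every line parallel to the i-th axis, the function F transports the
measure with density J to one-dimensional Lebesgue measure. *)
Definition line_transport n (i : 'I_n) (F J : 'rV[R]_n -> R) :=
  forall (x : 'rV[R]_n) (g : R -> \bar R), measurable_fun setT g ->
    (forall y, 0 <= g y)%E ->
    (\int[leb]_s (g (F (set_coord i x s)) * (J (set_coord i x s))%:E) =
     \int[leb]_y g y)%E.

(** By Tonelli's theorem a map that moves only the i-th coordinate can be
treated line by line. The product measure peels off the first coordinate, so the
proof inducts on the dimension until i becomes the first coordinate. *)
Lemma shear_transport n (i : 'I_n) (F J : 'rV[R]_n -> R) (g : 'rV[R]_n -> \bar R) :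
  measurable_fun setT F -> measurable_fun setT J -> (forall x, 0 <= J x) ->
  line_transport i F J -> measurable_fun setT g -> (forall x, 0 <= g x)%E ->
  (\int[product_lebesgue n]_x (g (set_coord i x (F x)) * (J x)%:E) =
   \int[product_lebesgue n]_y g y)%E.
Proof.
elim: n i F J g => [|n IHn] i F J g mF mJ J0 FJ mg g0.
  by have := ltn_ord i.
have mgF : measurable_fun setT (fun x => (g (set_coord i x (F x)) * (J x)%:E)%E).
  apply: emeasurable_funM; last exact/measurable_EFinP.
  by apply: (measurableT_comp mg); exact: measurable_set_coord.
have gF0 x : (0 <= g (set_coord i x (F x)) * (J x)%:E)%E.
  by rewrite mule_ge0 ?lee_fin.
rewrite !ge0_integral_rV_cons//.
have mcons := @measurable_rV_cons R n.
have mgFc := measurableT_comp mgF mcons.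
have mgc := measurableT_comp mg mcons.
have gc0 p : (0 <= (g \o @rV_cons R n) p)%E by exact: g0.
have gFc0 p : (0 <= ((fun x => g (set_coord i x (F x)) * (J x)%:E) \o
  @rV_cons R n) p)%E by exact: gF0.
have [k ik|i0] := unliftP ord0 i.
  (* the first coordinate is a parameter: integrate over the others first *)
  etransitivity; first exact: (fubini_tonelli1 _ mgFc gFc0).
  rewrite [RHS](fubini_tonelli1 _ mgc gc0).
  apply: eq_integral => a _; rewrite /fubini_F /=.
  have := IHn k (fun y => F (rV_cons (a, y))) (fun y => J (rV_cons (a, y)))
    (fun y => g (rV_cons (a, y))).
  have mca := @measurable_rV_cons_left n a.
  move=> <-//; [|exact: (measurableT_comp mF mca)|
    exact: (measurableT_comp mJ mca)| |exact: (measurableT_comp mg mca)].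
    by apply: eq_integral => y _; rewrite ik set_coord_consS.
  move=> x f mf f0; rewrite -(FJ (rV_cons (a, x)) f mf f0).
  by apply: eq_integral => s _; rewrite ik set_coord_consS.
(* the moved coordinate is the first one: integrate over it first *)
etransitivity; first exact: (fubini_tonelli2 _ mgFc gFc0).
rewrite [RHS](fubini_tonelli2 _ mgc gc0).
apply: eq_integral => y _; rewrite /fubini_G /=.
have mcy := measurable_rV_cons_right y.
rewrite -[RHS](FJ (rV_cons (0, y)) (fun a => g (rV_cons (a, y))))//; last first.
  exact: (measurableT_comp mg mcy).
by apply: eq_integral => s _; rewrite i0 !set_coord_cons0.
Qed.

End Shears.

(** * Truncation and the fundamental theorem of calculus *)

Section Clamp.
Context {R : realType}.
Implicit Types M s r : R.

Definition clamp M s : R := Num.max (- M) (Num.min M s).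

Lemma clampP M s : 0 <= M ->
  [\/ M < s /\ clamp M s = M, s < - M /\ clamp M s = - M |
      (- M <= s /\ s <= M) /\ clamp M s = s].
Proof.
move=> M0; rewrite /clamp; have [Ms|sM] := ltP M s.
  by apply: Or31; rewrite max_r//; lra.
by have [?|?] := ltP s (- M); [apply: Or32|apply: Or33].
Qed.

Lemma clamp_itv M s : 0 <= M -> - M <= clamp M s <= M.
Proof.
by move=> M0; have [[? ->]|[? ->]|[[? ?] ->]] := clampP s M0;
  apply/andP; split; lra.
Qed.

Lemma clamp_norm M s : 0 <= M -> `|clamp M s| <= M.
Proof. by move=> M0; rewrite ler_norml clamp_itv. Qed.

Lemma clamp_id M s : `|s| <= M -> clamp M s = s.
Proof. by rewrite ler_norml => /andP[Ms sM]; rewrite /clamp min_r// max_r. Qed.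

Lemma clamp_le M s r : 0 <= M -> s <= r -> clamp M s <= clamp M r.
Proof.
move=> M0 sr; have [[? ->]|[? ->]|[[? ?] ->]] := clampP s M0;
by have [[? ->]|[? ->]|[[? ?] ->]] := clampP r M0; lra.
Qed.

Lemma clamp_dist M s r : 0 <= M -> `|clamp M s - clamp M r| <= `|s - r|.
Proof.
move=> M0; wlog rs : s r / r <= s => [wl|].
  have [/wl//|/ltW/wl] := leP r s.
  by rewrite distrC [leRHS]distrC.
rewrite !ger0_norm ?subr_ge0 ?clamp_le//.
have [[? ->]|[? ->]|[[? ?] ->]] := clampP s M0;
by have [[? ->]|[? ->]|[[? ?] ->]] := clampP r M0; lra.
Qed.

(** The set on which the clamp is not locally constant, cut to an interval, is
the interval between the clamped end points: this turns the integral of a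
truncated derivative into a difference of values at clamped points. *)
Lemma clamp_preimage M a b : 0 <= M -> a <= b ->
  `]a, b] `&` `]- M, M] = `]clamp M a, clamp M b]%classic.
Proof.
move=> M0 ab.
apply/seteqP; split => x /=; rewrite !in_itv/=.
  move=> [/andP[? ?] /andP[? ?]]; apply/andP.
  have [[? ->]|[? ->]|[[? ?] ->]] := clampP a M0;
  by have [[? ->]|[? ->]|[[? ?] ->]] := clampP b M0; split; lra.
have [[? ->]|[? ->]|[[? ?] ->]] := clampP a M0;
have [[? ->]|[? ->]|[[? ?] ->]] := clampP b M0;
by move=> /andP[? ?]; split; apply/andP; split; lra.
Qed.

Lemma clamp_continuous M : 0 <= M -> continuous (clamp M).
Proof.
by move=> M0; apply: (@dist_le_continuous R R^o R^o) => s r; exact: clamp_dist.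
Qed.

End Clamp.

Section FundamentalTheorem.
Context {R : realType}.
Local Notation leb := (@lebesgue_measure R).
Variables (f f' : R -> R).
Hypotheses (df : forall s : R, is_derive s 1 f (f' s)) (cf' : continuous f').

Let continuous_f : continuous f.
Proof.
move=> s; apply: differentiable_continuous; apply/derivable1_diffP.
by have [] := df s.
Qed.

Lemma integral_derive_oc (a b : R) : a <= b ->
  (\int[leb]_(x in `]a, b]) (f' x)%:E = (f b - f a)%:E)%E.
Proof.
rewrite le_eqVlt => /predU1P[->|ab].
  by rewrite set_itvoc0 integral_set0 subrr.
rewrite integral_itv_obnd_cbnd; last first.
  by apply/measurable_EFinP; apply: measurable_funTS; exact: continuous_measurable_fun.
rewrite (continuous_FTC2 (F := f) ab)//.
- exact: continuous_subspaceT.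
- split.
  + by move=> x _; by have [] := df x.
  + by apply: cvg_at_right_filter; exact: continuous_f.
  + by apply: cvg_at_left_filter; exact: continuous_f.
- by move=> x _; rewrite derive1E; by have [] := df x.
Qed.

(** The fundamental theorem of calculus for s + h * f (clamp M s), which is only
piecewise differentiable. The half-open indicator fixes the derivative at the
two corners so that all intervals stay half-open. *)
Lemma integral_derive_clamp (M h a b : R) : 0 <= M -> a <= b ->
  (\int[leb]_(x in `]a, b])
     (1 + h * (f' (clamp M x) * \1_(`]- M, M]) x))%:E =
   (b + h * f (clamp M b) - (a + h * f (clamp M a)))%:E)%E.
Proof.
move=> M0 ab.
have ccb := clamp_le M0 ab.
have mab : measurable (`]a, b]%classic : set (measurableTypeR R)) by [].
have fin : (leb `]a, b]%classic < +oo)%E.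
  by rewrite lebesgue_measure_itv/=; case: ifP => // _; rewrite -EFinB ltry.
have [C Cf'] : exists C, forall x, `|f' (clamp M x)| <= C.
  have [C [_ HC]] := compact_bounded (continuous_compact
     (continuous_subspaceT cf') (@segment_compact R (- M) M)).
  exists (C + 1) => x; apply: HC; first by rewrite ltrDl.
  by exists (clamp M x) => //=; rewrite in_itv/= clamp_itv.
have mg : measurable_fun setT (fun x => h * (f' (clamp M x) * \1_(`]- M, M]) x)).
  apply: measurable_funM => //; apply: measurable_funM.
    apply: continuous_measurable_fun => x.
    by apply: continuous_comp; [exact: clamp_continuous|exact: cf'].
  exact: measurable_indic.
under eq_integral do rewrite EFinD.
rewrite integralD//=; last 2 first.
- apply: measurable_bounded_integrable => //.
  by exists 1; split => // r r1 x _ /=; rewrite normr1 ltW.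
- apply: measurable_bounded_integrable => //.
    exact: measurable_funTS.
  exists (`|h| * C); split; first exact: num_real.
  move=> r hr x _ /=; apply: le_trans (ltW hr); rewrite !normrM.
  rewrite ler_wpM2l// -[leRHS]mulr1 ler_pM// indicE.
  by case: (_ \in _); rewrite ?normr1 ?normr0.
rewrite integral_cst//= mul1e lebesgue_measure_itv/= lte_fin.
under [X in (_ + X)%E]eq_integral do rewrite EFinM.
rewrite integralZl//; last first.
  apply: measurable_bounded_integrable => //.
    apply: measurable_funTS; apply: measurable_funM.
      apply: continuous_measurable_fun => x.
      by apply: continuous_comp; [exact: clamp_continuous|exact: cf'].
    exact: measurable_indic.
  exists C; split; first exact: num_real.
  move=> r hr x _ /=; apply: le_trans (ltW hr); rewrite !normrM.
  rewrite -[leRHS]mulr1 ler_pM// indicE.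
  by case: (_ \in _); rewrite ?normr1 ?normr0.
rewrite (_ : \int[leb]_(x in `]a, b]) _ = (f (clamp M b) - f (clamp M a))%:E)%E.
  move: ab; rewrite le_eqVlt => /predU1P[->|->].
    by rewrite ltxx add0e -EFinM; congr EFin; ring.
  by rewrite -EFinB -EFinM -EFinD; congr EFin; ring.
transitivity (\int[leb]_(x in (`]a, b]%classic `&` `](- M)%R, M]%classic : set R)) (f' x)%:E)%E.
  rewrite integral_mkcondr; apply: eq_integral => x _.
  rewrite patchE indicE; case: ifPn => xM; last by rewrite mulr0.
  rewrite mulr1 clamp_id//; move: xM; rewrite inE/= in_itv/= => /andP[? ?].
  by rewrite ler_norml; apply/andP; split => //; apply/ltW.
by rewrite clamp_preimage// integral_derive_oc.
Qed.

End FundamentalTheorem.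

(** * Transports of Lebesgue measure and shears *)

Section Transport.
Context {R : realType} {n : nat}.
Implicit Types (Phi : 'rV[R]_n -> 'rV[R]_n) (P : 'rV[R]_n -> R).

(** Phi sends the measure with density P to Lebesgue measure: P is the Jacobian
of Phi, in the integrated form that needs no derivative of Phi and passes to
composites. *)
Record transports Phi P : Prop := Transports {
  transports_map : measurable_fun setT Phi ;
  transports_weight : measurable_fun setT P ;
  transports_ge0 : forall x, 0 <= P x ;
  transports_integral : forall g : 'rV[R]_n -> \bar R,
    measurable_fun setT g -> (forall x, 0 <= g x)%E ->
    (\int[product_lebesgue n]_x (g (Phi x) * (P x)%:E) =
     \int[product_lebesgue n]_y g y)%E }.

Lemma transports_id : transports id (cst 1).
Proof.
split => //.
by move=> g mg g0; under eq_integral do rewrite mule1.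
Qed.

Lemma transports_comp Phi P Psi Q : transports Phi P -> transports Psi Q ->
  transports (Psi \o Phi) (fun x => Q (Phi x) * P x).
Proof.
move=> [mPhi mP P0 iP] [mPsi mQ Q0 iQ]; split.
- exact: measurableT_comp mPsi mPhi.
- by apply: measurable_funM => //; exact: (measurableT_comp mQ mPhi).
- by move=> x; rewrite mulr_ge0.
- move=> g mg g0; rewrite -(iQ g mg g0).
  rewrite -(iP (fun x => (g (Psi x) * (Q x)%:E)%E)).
  + by apply: eq_integral => x _ /=; rewrite EFinM muleA.
  + apply: emeasurable_funM; first exact: measurableT_comp mg mPsi.
    exact/measurable_EFinP.
  + by move=> x; rewrite mule_ge0 ?lee_fin.
Qed.

Lemma transports_measure Phi P (A : set 'rV[R]_n) : transports Phi P ->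
  injective Phi -> measurable A -> measurable (Phi @` A) ->
  product_lebesgue n (Phi @` A) = (\int[product_lebesgue n]_(x in A) (P x)%:E)%E.
Proof.
move=> [mPhi mP P0 iP] injPhi mA mPA.
have := iP (EFin \o \1_(Phi @` A)).
rewrite integral_indic// setIT => <-//.
- rewrite [RHS]integral_mkcond; apply: eq_integral => x _ /=.
  rewrite patchE indicE; case: ifPn => [/set_mem xA|/negP xA].
    by rewrite mem_set ?mul1e//; exists x.
  rewrite memNset ?mul0e// => -[y Ay /injPhi yx]; apply: xA.
  by rewrite -yx inE.
- exact/measurable_EFinP.
- by move=> x; rewrite lee_fin.
Qed.

End Transport.

Section ClampedShear.
Context {R : realType} {n : nat}.
Implicit Types (x y : 'rV[R]_n) (M h L : R) (i : 'I_n) (w : 'rV[R]_n -> R).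

Definition clampv M x : 'rV[R]_n := \row_k clamp M (x ord0 k).

Lemma clampv_norm M x : 0 <= M -> `|clampv M x| <= M.
Proof. by move=> M0; apply: rV_norm_le => // k; rewrite mxE clamp_norm. Qed.

Lemma clampv_id M x : `|x| <= M -> clampv M x = x.
Proof.
move=> xM; apply/rowP => k; rewrite mxE clamp_id//.
exact: le_trans (ler_coord_norm _ _) xM.
Qed.

Lemma clampv_dist M x y : 0 <= M -> `|clampv M x - clampv M y| <= `|x - y|.
Proof.
move=> M0; apply: rV_norm_le => // k; rewrite !mxE.
apply: le_trans (clamp_dist _ _ M0) _.
by have := ler_coord_norm (x - y) k; rewrite !mxE.
Qed.

Lemma clampv_continuous M : 0 <= M -> continuous (clampv M).
Proof.
by move=> M0; apply: dist_le_continuous => x y; exact: clampv_dist.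
Qed.

Lemma clampv_set_coord M i x (s : R) :
  clampv M (set_coord i x s) = set_coord i (clampv M x) (clamp M s).
Proof. by apply/rowP => k; rewrite !mxE; case: ifP. Qed.

Lemma set_coord_shift i x (s r : R) :
  set_coord i x (r + s) = r *: delta_mx 0 i + set_coord i x s.
Proof.
apply/rowP => k; rewrite !mxE eqxx/=; case: eqP => _.
  by rewrite mulr1.
by rewrite mulr0 add0r.
Qed.

Lemma set_coord_dist i x (s r : R) :
  `|set_coord i x s - set_coord i x r| <= `|s - r|.
Proof.
by apply: rV_norm_le => // k; rewrite !mxE; case: ifP => _ //; rewrite subrr normr0.
Qed.

Lemma measurable_set_coord_right i x : measurable_fun setT (set_coord i x).
Proof.
apply: measurable_fun_rV => k; under eq_fun do rewrite mxE.
by case: (k == i); [exact: measurable_id|exact: measurable_cst].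
Qed.

Lemma set_coord_continuous i x : continuous (set_coord i x).
Proof.
by apply: dist_le_continuous => s r; exact: set_coord_dist.
Qed.

Lemma is_derive_set_coord i x (w w' : 'rV[R]_n -> R) (s : R) :
  (forall y, is_derive y (delta_mx 0 i) w (w' y)) ->
  is_derive s 1 (fun r => w (set_coord i x r)) (w' (set_coord i x s)).
Proof.
move=> /(_ (set_coord i x s)) [dw w'E].
have E : (fun h : R => h^-1 *: (((fun r => w (set_coord i x r)) \o shift s)
    (h *: 1) - w (set_coord i x s))) =
  (fun h : R => h^-1 *: ((w \o shift (set_coord i x s)) (h *: delta_mx 0 i) -
    w (set_coord i x s))).
  by apply/funext => h; rewrite /= /shift/= -set_coord_shift /GRing.scale/= mulr1.
by split; [rewrite /derivable E|rewrite /derive E].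
Qed.

(** The i-th component w of a velocity field, frozen in time, together with its
derivative w' along the i-th axis. The two smallness conditions on h make the shear
x_i := x_i + h * w x strictly increasing in x_i with Jacobian between 1/2 and 3/2
on the box of radius M. *)
Record shearable M h L i w w' : Prop := Shearable {
  shearable_M : 0 <= M ;
  shearable_h : 0 <= h ;
  shearable_L : 0 <= L ;
  shearable_continuous : continuous w ;
  shearable_continuous' : continuous w' ;
  shearable_derive : forall x, is_derive x (delta_mx 0 i) w (w' x) ;
  shearable_lipschitz : forall x y, `|x| <= M -> `|y| <= M ->
    `|w x - w y| <= L * `|x - y| ;
  shearable_small : h * L <= 2^-1 ;
  shearable_small' : forall x, `|x| <= M -> `|h * w' x| <= 2^-1 }.

(** The field is evaluated at the clamped point, so that the shear is defined and
injective on the whole space although w is only locally Lipschitz. *)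
Definition sheared_coord M h i w x : R := x ord0 i + h * w (clampv M x).

Definition shear M h i w x : 'rV[R]_n := set_coord i x (sheared_coord M h i w x).

Definition shear_jacobian M h i (w' : 'rV[R]_n -> R) x : R :=
  1 + h * (w' (clampv M x) * \1_(`]- M, M]) (x ord0 i)).

Section Facts.
Variables (M h L : R) (i : 'I_n) (w w' : 'rV[R]_n -> R).
Hypothesis H : shearable M h L i w w'.

Let M0 := shearable_M H.
Let h0 := shearable_h H.

Lemma shearE x : shear M h i w x = x + (h * w (clampv M x)) *: delta_mx 0 i.
Proof.
by rewrite /shear /sheared_coord addrC set_coord_shift set_coord_id addrC.
Qed.

Lemma norm_scale_delta (a : R) : `|a *: (delta_mx 0 i : 'rV[R]_n)| <= `|a|.
Proof.
apply: rV_norm_le => // k; rewrite !mxE eqxx/=.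
by case: eqP => _; rewrite ?mulr1// mulr0 normr0.
Qed.

Lemma shear_dist x B : (forall y, `|y| <= M -> `|w y| <= B) ->
  `|shear M h i w x - x| <= h * B.
Proof.
move=> wB; rewrite shearE addrC addKr.
apply: le_trans (norm_scale_delta _) _; rewrite normrM ger0_norm//.
by rewrite ler_wpM2l// wB// clampv_norm.
Qed.

(** The perturbation x |-> h * w (clampv M x) is h * L-Lipschitz. The factor
1 - h * L controls the inverse of the shear. *)
Lemma shear_lower x y :
  (1 - h * L) * `|x - y| <= `|shear M h i w x - shear M h i w y|.
Proof.
rewrite !shearE opprD addrACA -scalerBl -mulrBr.
have le1 : `|(h * (w (clampv M x) - w (clampv M y))) *: (delta_mx 0 i : 'rV[R]_n)|
    <= h * L * `|x - y|.
  apply: le_trans (norm_scale_delta _) _; rewrite normrM (ger0_norm h0) -mulrA.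
  rewrite ler_wpM2l//.
  apply: le_trans (shearable_lipschitz H (clampv_norm _ M0) (clampv_norm _ M0)) _.
  by rewrite ler_wpM2l ?(shearable_L H)// clampv_dist.
apply: le_trans (lerB_normD _ _).
by rewrite mulrBl mul1r lerB.
Qed.

Let wc_continuous : continuous (fun x => w (clampv M x)).
Proof.
move=> x; apply: continuous_comp; first exact: clampv_continuous.
exact: (shearable_continuous H).
Qed.

Lemma sheared_coord_continuous : continuous (sheared_coord M h i w).
Proof.
move=> x; apply: (@cvgD _ _ _ (nbhs x) _ (fun y : 'rV[R]_n => y ord0 i)
  (fun y => h * w (clampv M y))); first exact: coord_continuous.
by apply: cvgMr; exact: wc_continuous.
Qed.

Lemma shear_continuous : continuous (shear M h i w).
Proof.
move=> x; rewrite (_ : shear M h i w =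
  (fun x => x + (h * w (clampv M x)) *: delta_mx 0 i)); last first.
  by apply/funext => y; rewrite shearE.
apply: (@cvgD _ _ _ (nbhs x) _ id
  (fun y => (h * w (clampv M y)) *: (delta_mx 0 i : 'rV[R]_n))); first exact: cvg_id.
by apply: cvgZl; apply: cvgMr; exact: wc_continuous.
Qed.

Lemma box_bounded (u : 'rV[R]_n -> R) : continuous u ->
  exists B, forall x, `|x| <= M -> `|u x| <= B.
Proof.
move=> cu.
have [C [_ HC]] := compact_bounded (continuous_compact
   (continuous_subspaceT cu) (@compact_closed_box R n M)).
by exists (C + 1) => x xM; apply: HC; [rewrite ltrDl|exists x].
Qed.

(** Intermediate value theorem: the shear moves points by a bounded amount. *)
Lemma sheared_coord_surjective x (y : R) :
  exists s, sheared_coord M h i w (set_coord i x s) = y.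
Proof.
have [B wB] := box_bounded (shearable_continuous H).
have hw s : `|h * w (clampv M (set_coord i x s))| <= h * B.
  by rewrite normrM ger0_norm// ler_wpM2l// wB// clampv_norm.
have hB : 0 <= h * B by apply: le_trans (hw 0).
have := @IVT R (fun s => sheared_coord M h i w (set_coord i x s))
  (y - h * B) (y + h * B) y.
case.
- lra.
- apply: continuous_subspaceT => s.
  apply: (@continuous_comp _ _ _ (set_coord i x) (sheared_coord M h i w)).
    exact: set_coord_continuous.
  exact: sheared_coord_continuous.
- rewrite /sheared_coord !set_coord_same.
  have := hw (y - h * B); have := hw (y + h * B); rewrite !ler_norml.
  move=> /andP[h1 h2] /andP[h3 h4].
  apply/andP; split; last by rewrite le_max; apply/orP; right; lra.
  by rewrite ge_min; apply/orP; left; lra.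
- by move=> s _ <-; exists s.
Qed.

Lemma shear_surjective y : exists x, shear M h i w x = y.
Proof.
have [s sy] := sheared_coord_surjective y (y ord0 i).
by exists (set_coord i y s); rewrite /shear sy set_coord_set set_coord_id.
Qed.

Lemma shear_jacobian_ge0 x : 0 <= shear_jacobian M h i w' x.
Proof.
rewrite /shear_jacobian indicE; case: (_ \in _); last by rewrite !mulr0 addr0.
rewrite mulr1; have := shearable_small' H (clampv_norm x M0).
by rewrite ler_norml => /andP[+ _]; lra.
Qed.

Lemma measurable_shear_jacobian : measurable_fun setT (shear_jacobian M h i w').
Proof.
apply: measurable_funD => //; apply: measurable_funM => //.
apply: measurable_funM.
  apply: continuous_measurable_rV => x.
  apply: continuous_comp; first exact: clampv_continuous.
  exact: (shearable_continuous' H).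
have mI : measurable_fun setT (\1_(`]- M, M]%classic) : R -> R).
  exact: measurable_indic.
exact: (measurableT_comp mI (measurable_rV_coord i)).
Qed.

(** On a line the shear is s + h * f (clamp M s), strictly increasing because
h * L <= 1/2, and onto; integral_derive_clamp computes its increments. *)
Lemma shear_line_transport :
  line_transport i (sheared_coord M h i w) (shear_jacobian M h i w').
Proof.
move=> x g mg g0.
pose f r := w (set_coord i (clampv M x) r).
pose f' r := w' (set_coord i (clampv M x) r).
have cset : continuous (set_coord i (clampv M x)) by exact: set_coord_continuous.
have cf' : continuous f'.
  move=> s; apply: (@continuous_comp _ _ _ (set_coord i (clampv M x)) w').
    exact: cset.
  exact: (shearable_continuous' H).
have df (s : R) : is_derive s 1 f (f' s).
  exact: (is_derive_set_coord _ _ (shearable_derive H)).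
have FE s : sheared_coord M h i w (set_coord i x s) = s + h * f (clamp M s).
  by rewrite /sheared_coord set_coord_same clampv_set_coord.
have JE s : shear_jacobian M h i w' (set_coord i x s) =
    1 + h * (f' (clamp M s) * \1_(`]- M, M]) s).
  by rewrite /shear_jacobian set_coord_same clampv_set_coord.
have scont : continuous (fun s => sheared_coord M h i w (set_coord i x s)).
  move=> s; apply: (@continuous_comp _ _ _ (set_coord i x) (sheared_coord M h i w)).
    exact: set_coord_continuous.
  exact: sheared_coord_continuous.
apply: increasing_transport => //.
- exact: continuous_measurable_fun.
- exact: (measurableT_comp measurable_shear_jacobian
    (@measurable_set_coord_right i x)).
- by move=> s; exact: shear_jacobian_ge0.
- move=> s r sr.
  rewrite !FE -subr_gt0.
  have : `|f (clamp M r) - f (clamp M s)| <= L * (r - s).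
    rewrite /f -!clampv_set_coord.
    apply: le_trans (shearable_lipschitz H (clampv_norm _ M0) (clampv_norm _ M0)) _.
    rewrite ler_wpM2l ?(shearable_L H)//.
    apply: le_trans (clampv_dist _ _ M0) _.
    by apply: le_trans (set_coord_dist _ _ _ _) _; rewrite gtr0_norm ?subr_gt0.
  rewrite ler_norml => /andP[/(ler_wpM2l h0) + _].
  have : h * L * (r - s) <= 2^-1 * (r - s).
    by rewrite ler_wpM2r ?subr_ge0 ?(ltW sr)// (shearable_small H).
  lra.
- move=> y; exact: sheared_coord_surjective.
- move=> a b ab.
  under eq_integral do rewrite JE.
  by rewrite !FE; apply: integral_derive_clamp.
Qed.

Lemma shear_transports : transports (shear M h i w) (shear_jacobian M h i w').
Proof.
have mF : measurable_fun setT (sheared_coord M h i w).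
  exact: continuous_measurable_rV sheared_coord_continuous.
split.
- exact: measurable_set_coord.
- exact: measurable_shear_jacobian.
- exact: shear_jacobian_ge0.
- move=> g mg g0; apply: shear_transport => //.
  + exact: measurable_shear_jacobian.
  + exact: shear_jacobian_ge0.
  + exact: shear_line_transport.
Qed.

End Facts.
End ClampedShear.

(** * Gronwall's inequality and uniform continuity *)

Section Gronwall.
Context {R : realType}.
Implicit Types K t : R.

Lemma is_derive_expRM K (s : R) :
  is_derive s 1 (fun r => expR (K * r)) (K * expR (K * s)).
Proof.
have dK : is_derive s 1 (fun r => K * r) K.
  by have := is_deriveZ K (is_derive_id s 1); rewrite /GRing.scale/= mulr1.
have := @is_derive1_comp _ expR (fun r => K * r) s _ _ (is_derive_expR _) dK.
by rewrite mulrC.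
Qed.

(** f s * expR (- K * s) has a non-positive derivative. *)
Lemma gronwall (f f' : R -> R) K t : 0 <= t -> {within `[0, t], continuous f} ->
  (forall s, s \in `]0, t[ -> is_derive s 1 f (f' s)) ->
  (forall s, s \in `[0, t] -> f' s <= K * f s) ->
  f t <= f 0 * expR (K * t).
Proof.
move=> t0 cf df f'K.
pose g s := f s * expR (- K * s).
have dexp := is_derive_expRM (- K).
have dg s : s \in `]0, t[ ->
    is_derive s 1 g ((f' s - K * f s) * expR (- K * s)).
  move=> /df dfs.
  have dg : is_derive s 1 g _ := is_deriveM dfs (dexp s).
  by apply: is_derive_eq dg _; rewrite /GRing.scale/=; ring.
have cexp : continuous (fun s => expR (- K * s)).
  move=> s; apply: differentiable_continuous; apply/derivable1_diffP.
  by have [] := dexp s.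
have cg : {within `[0, t], continuous g}.
  move=> s; apply: cvgM; first exact: cf.
  exact: (continuous_subspaceT cexp).
have [c ct] := MVT_segment t0 dg cg.
rewrite subr0 /g mulr0 expR0 mulr1 => gE.
have : f t * expR (- K * t) <= f 0.
  rewrite -subr_le0 gE mulr_le0_ge0//.
  by rewrite mulr_le0_ge0 ?expR_ge0// subr_le0 f'K.
by rewrite mulNr expRN ler_pdivrMr ?expR_gt0.
Qed.

Lemma gronwall_ge (f f' : R -> R) K t : 0 <= t -> {within `[0, t], continuous f} ->
  (forall s, s \in `]0, t[ -> is_derive s 1 f (f' s)) ->
  (forall s, s \in `[0, t] -> - (K * f s) <= f' s) ->
  f 0 <= f t * expR (K * t).
Proof.
move=> t0 cf df f'K.
have := @gronwall (\- f) (\- f') (- K) t t0.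
have cNf : {within `[0, t], continuous (\- f)}.
  by move=> s; apply: cvgN; exact: cf.
have dNf s : s \in `]0, t[ -> is_derive s 1 (\- f) ((\- f') s).
  by move=> /df dfs; exact: is_deriveN.
move=> /(_ cNf dNf) /=.
have le s : s \in `[0, t] -> - f' s <= - K * - f s.
  by move=> /f'K; rewrite mulrNN lerNl.
move=> /(_ le); rewrite mulNr lerNl opprK mulNr.
by rewrite expRN ler_pdivrMr ?expR_gt0.
Qed.

End Gronwall.

Section UniformContinuity.
Context {R : realType}.

(** Uniform continuity in the form used for the velocity field: only the first of
the two points has to lie in the compact set, so the second may be an
approximation that leaves it. *)
Lemma modulus_on_compact (U V W : normedModType R) (f : U * V -> W)
    (A : set U) (B : set V) (e : R) :
  continuous f -> compact A -> compact B -> 0 < e ->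
  exists2 eta, 0 < eta & forall a a' b b', A a -> B b ->
    `|a - a'| <= eta -> `|b - b'| <= eta -> `|f (a, b) - f (a', b')| <= e.
Proof.
move=> cf cA cB e0.
have /compact_near_coveringP cAB := compact_setX cA cB.
have [] := cAB R (0^'+) (fun eta p => forall q : U * V,
  `|p.1 - q.1| <= eta -> `|p.2 - q.2| <= eta -> `|f p - f q| <= e) _.
- move=> [a b] _.
  have /cvgrPdist_le/(_ (e / 2)) : f p @[p --> (a, b)] --> f (a, b) by exact: cf.
  rewrite divr_gt0// => /(_ isT)/nbhs_ballP[r /= r0 rf].
  have r20 : 0 < r / 2 by rewrite divr_gt0.
  exists (ball (a, b) (r / 2), [set x | x < r / 2]) => /=.
    by split; [exact: nbhsx_ballx|exact: nbhs_right_lt].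
  move=> [[a1 b1] eta] /= [[/= a1r b1r] etar] [a2 b2] /= a2r b2r.
  have h1 : `|f (a, b) - f (a1, b1)| <= e / 2.
    by apply: rf; split => /=; apply: le_ball; try exact: a1r; try exact: b1r; lra.
  have h2 : `|f (a, b) - f (a2, b2)| <= e / 2.
    apply: rf; split => /=; rewrite -ball_normE/=.
      rewrite -ball_normE/= in a1r.
      by apply: le_lt_trans (ler_distD a1 _ _) _; lra.
    rewrite -ball_normE/= in b1r.
    by apply: le_lt_trans (ler_distD b1 _ _) _; lra.
  apply: le_trans (ler_distD (f (a, b)) _ _) _.
  by rewrite (distrC (f (a1, b1))); lra.
- move=> eta /= eta0 H; exists (eta / 2); first by rewrite divr_gt0.
  move=> a a' b b' Aa Bb aa bb.
  have := H (eta / 2) _ _ (a, b) _ (a', b'); apply => //=.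
  + by rewrite sub0r normrN gtr0_norm; lra.
  + by rewrite divr_gt0.
Qed.

End UniformContinuity.

(** * Velocity fields and their flows *)

Section SumOfSquares.
Context {R : realType} {n : nat}.
Implicit Types x : 'rV[R]_n.

(** The norm of row vectors is the sup norm, which is not differentiable along a
trajectory; this equivalent quantity is. *)
Definition sumsq x : R := \sum_i x ord0 i ^+ 2.

Lemma sumsq_ge0 x : 0 <= sumsq x.
Proof. by apply: sumr_ge0 => i _; exact: sqr_ge0. Qed.

Lemma sqr_norm_le_sumsq x : `|x| ^+ 2 <= sumsq x.
Proof.
have xs i : `|x ord0 i| <= Num.sqrt (sumsq x).
  rewrite -sqrtr_sqr ler_wsqrtr// /sumsq (bigD1 i)//= lerDl.
  by apply: sumr_ge0 => j _; exact: sqr_ge0.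
rewrite -[leRHS]sqr_sqrtr ?sumsq_ge0// ler_sqr ?nnegrE ?sqrtr_ge0//.
by apply: rV_norm_le; rewrite ?sqrtr_ge0.
Qed.

Lemma sumsq_le_sqr_norm x : sumsq x <= n%:R * `|x| ^+ 2.
Proof.
have -> : n%:R * `|x| ^+ 2 = \sum_(i < n) `|x| ^+ 2.
  by rewrite sumr_const card_ord mulr_natl.
apply: ler_sum => i _; rewrite -real_normK ?num_real//.
by rewrite ler_sqr ?nnegrE// ler_coord_norm.
Qed.

End SumOfSquares.

Section ClampTime.
Context {R : realType}.

Lemma continuous_within_comp (W : topologicalType) (A : set R) (f : R -> W)
    (c : R -> R) :
  {within A, continuous f} -> continuous c -> (forall x, A (c x)) ->
  continuous (f \o c).
Proof.
move=> /subspace_continuousP cf cc Ac x.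
apply: (@cvg_comp _ _ _ c f (nbhs x) (within A (nbhs (c x)))); last exact: cf.
move=> P /= wP; have := cc x _ wP.
by apply: (@filterS _ _ (nbhs_filter x)) => y /=; apply; exact: Ac.
Qed.

(** Constant continuation of time outside [0, T]: trajectories are continuous only
within [0, T], and composing them with this map gives functions that are continuous
on the whole line. *)
Definition clampI (T s : R) : R := T / 2 + clamp (T / 2) (s - T / 2).

Lemma clampI_in T s : 0 <= T -> clampI T s \in `[0, T].
Proof.
move=> T0; have T20 : 0 <= T / 2 by rewrite divr_ge0.
have := clamp_itv (s - T / 2) T20; rewrite in_itv/= /clampI => /andP[? ?].
by apply/andP; split; lra.
Qed.

Lemma clampI_id T s : s \in `[0, T] -> clampI T s = s.
Proof.
rewrite in_itv/= => /andP[s0 sT]; rewrite /clampI clamp_id; first lra.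
by rewrite ler_norml; apply/andP; split; lra.
Qed.

Lemma clampI_continuous T : 0 <= T -> continuous (clampI T).
Proof.
move=> T0; apply: (@dist_le_continuous R R^o R^o) => s r.
rewrite /clampI opprD addrACA subrr add0r.
apply: le_trans (clamp_dist _ _ _) _; first by rewrite divr_ge0.
by rewrite opprD addrACA subrr addr0.
Qed.

End ClampTime.

Section Flow.
Context {R : realType} {n : nat}.
Implicit Types (a b x y : 'rV[R]_n) (s t T M : R).

(** D i s is the partial derivative of the i-th component of v s along the i-th
axis, so that the sum of the D i s is the divergence of v s.
The Lipschitz constant may grow with the radius M. *)
Record velocity_field (v : R -> 'rV[R]_n -> 'rV[R]_n)
    (D : 'I_n -> R -> 'rV[R]_n -> R) : Prop := VelocityField {
  velocity_continuous : continuous (fun p : R * 'rV[R]_n => v p.1 p.2) ;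
  velocity_continuous' : forall i, continuous (fun p : R * 'rV[R]_n => D i p.1 p.2) ;
  velocity_derive : forall i s x,
    is_derive x (delta_mx 0 i) (fun y => v s y ord0 i) (D i s x) ;
  velocity_lipschitz : forall M, exists2 L, 0 <= L & forall s x y,
    `|x| <= M -> `|y| <= M -> `|v s x - v s y| <= L * `|x - y| }.

(** The equation holds in the open interval only; with continuity up to the end
points this determines the trajectories and avoids one-sided derivatives. *)
Record flow T (v : R -> 'rV[R]_n -> 'rV[R]_n) (X : 'rV[R]_n -> R -> 'rV[R]_n) :
    Prop := Flow {
  flow0 : forall a, X a 0 = a ;
  flow_continuous : forall a, {within `[0, T], continuous (X a)} ;
  flow_derive : forall a i s, s \in `]0, T[ ->
    is_derive s 1 (fun r => X a r ord0 i) (v s (X a s) ord0 i) }.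

Lemma flowW T t v X : t <= T -> flow T v X -> flow t v X.
Proof.
move=> tT [X0 cX dX]; split => //.
- move=> a; apply: continuous_subspaceW (cX a) => s /=.
  by rewrite !in_itv/= => /andP[-> /le_trans]; apply.
- move=> a i s; rewrite in_itv/= => /andP[s0 st]; apply: dX.
  by rewrite in_itv/= s0 (lt_le_trans st).
Qed.

Variables (v : R -> 'rV[R]_n -> 'rV[R]_n) (D : 'I_n -> R -> 'rV[R]_n -> R).
Hypothesis vD : velocity_field v D.
Variables (T : R) (X : 'rV[R]_n -> R -> 'rV[R]_n).
Hypothesis T0 : 0 <= T.
Hypothesis vX : flow T v X.

Lemma flow_coord_continuous a i : {within `[0, T], continuous (fun s => X a s ord0 i)}.
Proof.
move=> s.
apply: (@continuous_comp (subspace `[0, T]) _ _ (X a) (fun x : 'rV[R]_n => x ord0 i)).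
  exact: (flow_continuous vX).
exact: coord_continuous.
Qed.

Let sumsq_diff a b s := sumsq (X a s - X b s).

Let sumsq_diff_derive a b s : s \in `]0, T[ ->
  is_derive s 1 (sumsq_diff a b)
    (\sum_i 2 * (X a s ord0 i - X b s ord0 i) *
       (v s (X a s) ord0 i - v s (X b s) ord0 i)).
Proof.
move=> sT.
have d i : is_derive s 1 (fun r => (X a r ord0 i - X b r ord0 i) ^+ 2)
   (2 * (X a s ord0 i - X b s ord0 i) * (v s (X a s) ord0 i - v s (X b s) ord0 i)).
  have d1 := is_deriveB (flow_derive vX a i sT) (flow_derive vX b i sT).
  have d2 : is_derive s 1 (fun r => (X a r ord0 i - X b r ord0 i) ^+ 2) _ :=
    is_deriveX 2 d1.
  by apply: is_derive_eq d2 _; rewrite /GRing.scale/= expr1.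
have -> : sumsq_diff a b =
    \sum_(i < n) (fun r => (X a r ord0 i - X b r ord0 i) ^+ 2).
  apply/funext => r; rewrite fct_sumE /sumsq_diff /sumsq.
  by apply: eq_bigr => i _; rewrite !mxE.
exact: is_derive_sum.
Qed.

Let sumsq_diff_continuous a b : {within `[0, T], continuous (sumsq_diff a b)}.
Proof.
have -> : sumsq_diff a b = (fun r => \sum_(i < n)
    (X a r ord0 i - X b r ord0 i) * (X a r ord0 i - X b r ord0 i)).
  apply/funext => r; rewrite /sumsq_diff /sumsq.
  by apply: eq_bigr => i _; rewrite !mxE expr2.
apply: (@continuous_sumr R R^o (subspace `[0, T])) => i s.
by apply: cvgM; apply: cvgB; exact: flow_coord_continuous.
Qed.

Let sumsq_diff_bound a b M L s : 0 <= L ->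
  (forall x y, `|x| <= M -> `|y| <= M -> `|v s x - v s y| <= L * `|x - y|) ->
  `|X a s| <= M -> `|X b s| <= M ->
  `|\sum_i 2 * (X a s ord0 i - X b s ord0 i) *
       (v s (X a s) ord0 i - v s (X b s) ord0 i)| <=
  2 * n%:R * L * sumsq_diff a b s.
Proof.
move=> L0 vL aM bM; apply: le_trans (ler_norm_sum _ _ _) _.
have -> : 2 * n%:R * L * sumsq_diff a b s =
    \sum_(i < n) (2 * L * sumsq_diff a b s).
  by rewrite sumr_const card_ord -[RHS]mulr_natl; ring.
apply: ler_sum => i _.
have h1 : `|X a s ord0 i - X b s ord0 i| <= `|X a s - X b s|.
  by have := ler_coord_norm (X a s - X b s) i; rewrite !mxE.
have h2 : `|v s (X a s) ord0 i - v s (X b s) ord0 i| <= L * `|X a s - X b s|.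
  apply: le_trans (vL _ _ aM bM).
  by have := ler_coord_norm (v s (X a s) - v s (X b s)) i; rewrite !mxE.
rewrite !normrM normr_nat -!mulrA ler_pM2l//.
apply: le_trans (ler_pM _ _ h1 h2) _ => //.
rewrite mulrCA ler_wpM2l// -expr2; exact: sqr_norm_le_sumsq.
Qed.

(** Gronwall's inequality, forwards and backwards, for the squared distance of two
trajectories that stay in a region with Lipschitz constant L. *)
Lemma flow_sumsq_le a b M L t : 0 <= t -> t <= T -> 0 <= L ->
  (forall s x y, `|x| <= M -> `|y| <= M -> `|v s x - v s y| <= L * `|x - y|) ->
  (forall s, s \in `[0, t] -> `|X a s| <= M /\ `|X b s| <= M) ->
  sumsq (X a t - X b t) <= sumsq (a - b) * expR (2 * n%:R * L * t) /\
  sumsq (a - b) <= sumsq (X a t - X b t) * expR (2 * n%:R * L * t).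
Proof.
move=> t0 tT L0 vL abM.
have cont : {within `[0, t], continuous (sumsq_diff a b)}.
  apply: continuous_subspaceW (@sumsq_diff_continuous a b) => s /=.
  by rewrite !in_itv/= => /andP[-> /le_trans]; apply.
pose dd s := \sum_i 2 * (X a s ord0 i - X b s ord0 i) *
  (v s (X a s) ord0 i - v s (X b s) ord0 i).
have der s : s \in `]0, t[ -> is_derive s 1 (sumsq_diff a b) (dd s).
  rewrite in_itv/= => /andP[s0 st]; apply: sumsq_diff_derive.
  by rewrite in_itv/= s0 (lt_le_trans st).
have bound s (h : s \in `[0, t]) :=
  @sumsq_diff_bound a b M L s L0 (vL s) (abM s h).1 (abM s h).2.
have := gronwall t0 cont der; have := gronwall_ge t0 cont der.
rewrite /sumsq_diff !(flow0 vX) => ge le; split.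
  by apply: le => s /bound; rewrite ler_norml => /andP[].
by apply: ge => s /bound; rewrite ler_norml => /andP[].
Qed.

Lemma flow_trajectory_bounded a : exists M, forall s, s \in `[0, T] -> `|X a s| <= M.
Proof.
have [C [_ HC]] := compact_bounded (continuous_compact
   (@flow_continuous _ _ _ vX a) (@segment_compact R 0 T)).
by exists (C + 1) => s sT; apply: HC; [rewrite ltrDl|exists s].
Qed.

(** The backward inequality of flow_sumsq_le: distinct trajectories do not meet. *)
Lemma flow_injective t : 0 <= t -> t <= T -> injective (X ^~ t).
Proof.
move=> t0 tT a b Xab.
have [Ma aM] := flow_trajectory_bounded a.
have [Mb bM] := flow_trajectory_bounded b.
have [L L0 vL] := velocity_lipschitz vD (Num.max Ma Mb).
have [|_] := @flow_sumsq_le a b (Num.max Ma Mb) L t t0 tT L0 vL.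
  move=> s st; have sT : s \in `[0, T].
    by move: st; rewrite !in_itv/= => /andP[-> /le_trans]; apply.
  by rewrite !le_max aM// bM// orbT.
rewrite Xab subrr.
have -> : sumsq (0 : 'rV[R]_n) = 0.
  by rewrite /sumsq big1// => i _; rewrite mxE expr0n.
rewrite mul0r => ab0; apply/eqP; rewrite -subr_eq0 -normr_eq0 -sqrf_eq0.
by rewrite eq_le sqr_ge0 andbT (le_trans (sqr_norm_le_sumsq _) ab0).
Qed.

(** The Lipschitz constant is local, so a bound on nearby trajectories has to be
bootstrapped. Up to the first time at which the squared Euclidean distance to
the trajectory of a reaches 1, both trajectories lie in the box of radius M + 1,
where Gronwall's inequality keeps the distance below 1: there is no such time. *)
Lemma flow_bounded_near a : exists r M, 0 < r /\
  forall b, `|a - b| < r -> forall s, s \in `[0, T] -> `|X b s| <= M.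
Proof.
have [M aM] := flow_trajectory_bounded a.
have [L L0 vL] := velocity_lipschitz vD (M + 1).
(* the radius C^-1 keeps the squared distance below n * C^-2 * expR (2 * n * L * T),
   which is less than 1 *)
pose C := (n%:R + 1) * expR (2 * n%:R * L * T).
have C0 : 0 < C by rewrite mulr_gt0 ?expR_gt0// ltr_wpDl.
have C1 : 1 <= C.
  rewrite /C -[leLHS]mulr1 ler_pM ?lerDr//.
  by apply: le_trans (expR_ge1Dx _); rewrite lerDl !mulr_ge0.
exists C^-1, (M + 1); split; first by rewrite invr_gt0.
move=> b ab s sT.
have close t : t \in `[0, T] -> `|X a t - X b t| <= 1 -> `|X b t| <= M + 1.
  move=> tT h; rewrite -(subrK (X a t) (X b t)) addrC.
  by apply: le_trans (ler_normD _ _) _; rewrite lerD ?aM// distrC.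
apply: (close s sT); rewrite leNgt; apply/negP => far.
(* the times at which the squared distance is at least 1; t is the first of them *)
pose S := [set t | t \in `[0, T] /\ 1 <= sumsq (X a t - X b t)].
have cS : compact S.
  pose g := sumsq_diff a b \o clampI T.
  have cg : continuous g.
    apply: (continuous_within_comp (A := `[0, T]%classic)) => //.
    - exact: clampI_continuous.
    - by move=> x; exact: clampI_in.
  have -> : S = `[0, T]%classic `&` (g @^-1` [set r | 1 <= r]).
    apply/seteqP; split => t [tT]; rewrite /g /= clampI_id//;
      by split => //; rewrite clampI_id.
  apply: subclosed_compact (@segment_compact R 0 T) _ => //.
  apply: closedI; first exact: interval_closed.
  by apply: preimage_closed; [move=> x _; exact: cg|exact: closed_ge].
have S_neq0 : S !=set0.
  exists s; split => //; apply: le_trans (sqr_norm_le_sumsq _).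
  by rewrite -[leLHS](expr1n _ 2) ler_sqr ?nnegrE ?(ltW far).
have [|t tS tmin] := @compact_EVT_min R R id S S_neq0 cS.
  by apply: continuous_subspaceT => x; exact: cvg_id.
move: tS; rewrite inE /S/= => -[]; rewrite in_itv/= => /andP[t0 tT] t1.
have ab1 : sumsq (a - b) * expR (2 * n%:R * L * T) < 1.
  have : sumsq (a - b) <= n%:R * C^-1 ^+ 2.
    apply: le_trans (sumsq_le_sqr_norm _) _; rewrite ler_wpM2l//.
    by rewrite ler_sqr ?nnegrE ?(ltW ab)// invr_ge0 ltW.
  move=> h; apply: le_lt_trans (ler_wpM2r (expR_ge0 _) h) _.
  apply: (@le_lt_trans _ _ (n%:R * C^-1 * expR (2 * n%:R * L * T))).
    rewrite ler_wpM2r ?expR_ge0// ler_wpM2l// expr2 ler_piMl ?invr_ge0 ?(ltW C0)//.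
    by rewrite invf_le1.
  rewrite mulrAC ltr_pdivrMr// mul1r /C ltr_pM2r ?expR_gt0//.
  by rewrite ltrDl.
have f01 : sumsq_diff a b 0 < 1.
  rewrite /sumsq_diff !(flow0 vX); apply: le_lt_trans ab1.
  rewrite ler_peMr ?sumsq_ge0// (le_trans _ (expR_ge1Dx _))// lerDl.
  by rewrite !mulr_ge0.
have [| |c] := @IVT R (sumsq_diff a b) 0 t 1 t0.
- apply: continuous_subspaceW (@sumsq_diff_continuous a b) => r /=.
  by rewrite !in_itv/= => /andP[-> /le_trans]; apply.
- by rewrite ge_min le_max (ltW f01) t1 orbT.
rewrite in_itv/= => /andP[c0 ct] c1.
have tc : t <= c.
  by apply: tmin; rewrite inE /S/= in_itv/= c0 (le_trans ct)// -/(sumsq_diff _ _ _) c1.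
have ct' : c = t by apply/eqP; rewrite eq_le ct tc.
subst c.
have [|le _] := @flow_sumsq_le a b (M + 1) L t t0 tT L0 vL.
  move=> r; rewrite in_itv/= => /andP[r0 rt].
  have rT : r \in `[0, T] by rewrite in_itv/= r0 (le_trans rt).
  split; first by rewrite (le_trans (aM r rT))// lerDl.
  apply: close => //.
  have : sumsq_diff a b r <= 1.
    have [<-|rt'] := eqVneq t r; first by rewrite c1.
    rewrite leNgt; apply/negP => r1.
    have : t <= r by apply: tmin; rewrite inE /S/=; split => //; exact: ltW.
    by rewrite leNgt lt_neqAle eq_sym rt' rt.
  move=> /(le_trans (sqr_norm_le_sumsq _)).
  by rewrite -[in leRHS](expr1n _ 2) ler_sqr ?nnegrE.
have : sumsq_diff a b t < 1.
  apply: le_lt_trans le _; apply: le_lt_trans ab1.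
  rewrite ler_wpM2l ?sumsq_ge0// ler_expR ler_wpM2l// !mulr_ge0//.
by rewrite ltNge t1.
Qed.

End Flow.

(** * Bounds on the flow and the logarithm of its Jacobian *)

Section FlowBounds.
Context {R : realType} {n : nat}.
Implicit Types (a b x y : 'rV[R]_n) (s t k M : R).
Variables (v : R -> 'rV[R]_n -> 'rV[R]_n) (D : 'I_n -> R -> 'rV[R]_n -> R).
Hypothesis vD : velocity_field v D.
Variables (T : R) (X : 'rV[R]_n -> R -> 'rV[R]_n).
Hypothesis T0 : 0 <= T.
Hypothesis vX : flow T v X.

(** flow_bounded_near and a covering argument on the closed box of radius k. *)
Lemma flow_bounded k : exists M, forall a s, `|a| <= k -> s \in `[0, T] ->
  `|X a s| <= M.
Proof.
have /compact_near_coveringP cK := @compact_closed_box R n k.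
have [] := cK R +oo (fun M a => forall s, s \in `[0, T] -> `|X a s| <= M) _.
- move=> a _; have [r [M [r0 HM]]] := flow_bounded_near vD T0 vX a.
  exists (ball a r, [set x | M <= x]) => /=.
    by split; [exact: nbhsx_ballx|apply: nbhs_pinfty_ge; exact: num_real].
  move=> [b m] /= [ab Mm] s sT; apply: le_trans Mm; apply: HM => //.
  by rewrite -ball_normE in ab.
- move=> M [_ H]; exists (M + 1) => a s ak sT.
  by apply: (H (M + 1)); rewrite ?ltrDl.
Qed.

Lemma flow_lipschitz k : exists2 C, 0 < C & forall a b s,
  `|a| <= k -> `|b| <= k -> s \in `[0, T] -> `|X a s - X b s| <= C * `|a - b|.
Proof.
have [M HM] := flow_bounded k.
have [L L0 vL] := velocity_lipschitz vD M.
pose C := (n%:R + 1) * expR (2 * n%:R * L * T).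
have C1 : 1 <= C.
  rewrite /C -[leLHS]mulr1 ler_pM ?lerDr//.
  by apply: le_trans (expR_ge1Dx _); rewrite lerDl !mulr_ge0.
have C0 : 0 < C by apply: lt_le_trans C1.
exists C => //.
move=> a b s ak bk; rewrite in_itv/= => /andP[s0 sT].
have [|le _] := @flow_sumsq_le _ _ v T X vX a b M L s s0 sT L0 vL.
  move=> r; rewrite in_itv/= => /andP[r0 rs].
  by rewrite !HM// in_itv/= r0 (le_trans rs).
rewrite -ler_sqr ?nnegrE// ?mulr_ge0// ?(ltW C0)//.
apply: le_trans (sqr_norm_le_sumsq _) _; apply: le_trans le _.
rewrite exprMn; apply: (@le_trans _ _ (C * `|a - b| ^+ 2)); last first.
  by rewrite ler_wpM2r ?sqr_ge0// expr2 ler_peMr// ltW.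
rewrite /C [leRHS]mulrAC; apply: ler_pM; rewrite ?expR_ge0 ?sumsq_ge0//.
  apply: le_trans (sumsq_le_sqr_norm _) _.
  by rewrite ler_wpM2r ?sqr_ge0// lerDl.
by rewrite ler_expR ler_wpM2l// !mulr_ge0.
Qed.

Lemma flow_at_continuous t : t \in `[0, T] -> continuous (X ^~ t).
Proof.
move=> tT a; have [C C0 HC] := flow_lipschitz (`|a| + 1).
apply/(@cvgrPdist_lt _ 'rV[R]_n _ (nbhs a)) => e e0.
apply/nbhs_ballP; exists (Num.min 1 (e / C)).
  by rewrite /= lt_min ltr01 divr_gt0.
move=> b; rewrite -ball_normE /= lt_min => /andP[ab1 abe].
have bk : `|b| <= `|a| + 1.
  rewrite -(subrK a b); apply: le_trans (ler_normD _ _) _.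
  by rewrite addrC lerD2l distrC ltW.
apply: le_lt_trans (HC _ _ _ _ bk tT) _; first by rewrite lerDl.
by rewrite mulrC -ltr_pdivlMr.
Qed.

(** Lam a t is the integral of the divergence of v along the trajectory of a over
[0, t], and its exponential is the Jacobian determinant of the flow by Liouville's
formula. *)
Record log_jacobian (Lam : 'rV[R]_n -> R -> R) : Prop := LogJacobian {
  log_jacobian0 : forall a, Lam a 0 = 0 ;
  log_jacobian_continuous : forall a, {within `[0, T], continuous (Lam a)} ;
  log_jacobian_derive : forall a s, s \in `]0, T[ ->
    is_derive s 1 (Lam a) (\sum_i D i s (X a s)) }.

(** The integral starts at -1 to make 0 an interior point of the domain. *)
Lemma antiderivative (f : R -> R) : continuous f ->
  exists F : R -> R, forall s, s \in `[0, T] -> is_derive s 1 F (f s).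
Proof.
move=> cf; exists (fun s => \int[lebesgue_measure]_(r in `[- 1, s]) f r).
move=> s; rewrite in_itv/= => /andP[s0 sT].
have sT1 : s < T + 1 by lra.
have iT : lebesgue_measure.-integrable `[- 1, T + 1] (EFin \o f).
  apply: continuous_compact_integrable; first exact: segment_compact.
  exact: continuous_subspaceT.
have [] := @continuous_FTC1_closed R f (- 1) s (T + 1) sT1 iT.
- lra.
- exact: cf.
- by move=> dF F'; split => //; rewrite -derive1E.
Qed.

Lemma trajectory_field_continuous a : continuous (fun s => \sum_i D i s (X a (clampI T s))).
Proof.
apply: (@continuous_sumr R R^o R) => i s.
apply: (@continuous_comp _ _ _ (fun s => (s, X a (clampI T s)))
  (fun p : R * 'rV[R]_n => D i p.1 p.2)); last exact: (velocity_continuous' vD).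
have cXc : continuous (X a \o clampI T).
  apply: (@continuous_within_comp R 'rV[R]_n `[0, T]%classic (X a) (clampI T)).
  - exact: (flow_continuous vX).
  - exact: clampI_continuous.
  - by move=> r; exact: clampI_in.
apply: (@cvg_pair _ _ _ (nbhs s) (nbhs s) (nbhs (X a (clampI T s)))
  _ _ _ id (X a \o clampI T)); [exact: cvg_id|exact: cXc].
Qed.

Lemma log_jacobian_exists : exists Lam, log_jacobian Lam.
Proof.
have /choice[F HF] a := antiderivative (@trajectory_field_continuous a).
exists (fun a s => F a s - F a 0).
have dF a s : s \in `[0, T] ->
    is_derive s 1 (fun r => F a r - F a 0) (\sum_i D i s (X a s)).
  move=> sT; have := HF a s sT; rewrite clampI_id// => dF.
  have := is_deriveB dF (is_derive_cst (F a 0) s 1); rewrite subr0; exact.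
split.
- by move=> a; rewrite subrr.
- move=> a; apply: derivable_within_continuous => s sT.
  by have [] := dF a s sT.
- move=> a s sT; apply: dF; move: sT; rewrite !in_itv/= => /andP[s0 sT].
  by rewrite !ltW.
Qed.

End FlowBounds.

(** * Splitting one time step into shears *)

Section ExpBounds.
Context {R : realType}.

(** The lower counterpart of expR_ge1Dx. The two together compare a product of
factors 1 + x_j with the exponential of the sum of the x_j up to an error of second
order. *)
Lemma expR_sub_sqr_le (x : R) : `|x| <= 2^-1 -> expR (x - 2 * x ^+ 2) <= 1 + x.
Proof.
rewrite ler_norml => /andP[x1 x2].
have x10 : 0 < 1 + x by lra.
have : 1 <= (1 + x) * (1 - (x - 2 * x ^+ 2)).
  have -> : (1 + x) * (1 - (x - 2 * x ^+ 2)) = 1 + x ^+ 2 * (1 + 2 * x) by ring.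
  by rewrite lerDl mulr_ge0 ?sqr_ge0//; lra.
move=> h; rewrite -[expR _]invrK -expRN invf_ple ?posrE ?expR_gt0//.
apply: le_trans (expR_ge1Dx _).
by rewrite -[leLHS]mul1r ler_pdivrMr// mulrC.
Qed.

Lemma bernoulli_expR (x : R) : 0 <= x -> x <= 2^-1 -> expR (- (2 * x)) <= 1 - x.
Proof.
move=> x0 x1; rewrite expRN invf_ple ?posrE ?expR_gt0//; last lra.
apply: le_trans (expR_ge1Dx _).
rewrite -[leLHS]mul1r ler_pdivrMr; last lra.
have -> : (1 + 2 * x) * (1 - x) = 1 + x * (1 - 2 * x) by ring.
by rewrite lerDl mulr_ge0//; lra.
Qed.

End ExpBounds.

Section BilipschitzTransport.
Context {R : realType} {n : nat}.
Implicit Types (Phi Psi : 'rV[R]_n -> 'rV[R]_n) (P Q : 'rV[R]_n -> R) (kappa : R).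

(** The lower bound kappa on the expansion of distances makes Phi injective, and
with surjectivity it makes the inverse Lipschitz with constant 1 / kappa. The
latter locates the preimage of a point that Phi nearly reaches. *)
Record expanding_transport kappa Phi P : Prop := ExpandingTransport {
  expanding_transports : transports Phi P ;
  expanding_continuous : continuous Phi ;
  expanding_surjective : forall y, exists x, Phi x = y ;
  expanding_lower : forall x y, kappa * `|x - y| <= `|Phi x - Phi y| }.

Lemma expanding_id : expanding_transport 1 id (cst 1).
Proof.
split; first exact: transports_id.
- by move=> x; exact: cvg_id.
- by move=> y; exists y.
- by move=> x y; rewrite mul1r.
Qed.

Lemma expanding_comp kappa lambda Phi P Psi Q : 0 <= lambda ->
  expanding_transport kappa Phi P -> expanding_transport lambda Psi Q ->
  expanding_transport (lambda * kappa) (Psi \o Phi) (fun x => Q (Phi x) * P x).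
Proof.
move=> l0 [tP cP sP lP] [tQ cQ sQ lQ]; split.
- exact: transports_comp.
- by move=> x; apply: continuous_comp; [exact: cP|exact: cQ].
- by move=> z; have [y <-] := sQ z; have [x <-] := sP y; exists x.
- move=> x y; apply: le_trans (lQ _ _).
  by rewrite -mulrA ler_wpM2l.
Qed.

Lemma expanding_injective kappa Phi P : 0 < kappa ->
  expanding_transport kappa Phi P -> injective Phi.
Proof.
move=> k0 [_ _ _ lP] x y xy; apply/eqP; rewrite -subr_eq0 -normr_le0.
by have := lP x y; rewrite xy subrr normr0 pmulr_rle0.
Qed.

End BilipschitzTransport.

Section Splitting.
Context {R : realType} {n : nat}.
Implicit Types (x y : 'rV[R]_n) (l : seq 'I_n).
Variables (M h L B : R) (w : 'rV[R]_n -> 'rV[R]_n) (w' : 'I_n -> 'rV[R]_n -> R).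
Hypothesis H : forall i, shearable M h L i (fun x => w x ord0 i) (w' i).
Hypothesis M0 : 0 <= M.
Hypothesis h0 : 0 <= h.
Hypothesis L0 : 0 <= L.
Hypothesis hL : h * L <= 2^-1.
Hypothesis B0 : 0 <= B.
Hypothesis wB : forall x, `|x| <= M -> `|w x| <= B.

Let sh i := shear M h i (fun x => w x ord0 i).

(** Lie splitting of an Euler step: every shear uses the field at the point reached
by the previous ones. *)
Fixpoint splitting l x : 'rV[R]_n :=
  if l is i :: l' then splitting l' (shear M h i (fun y => w y ord0 i) x) else x.

Fixpoint splitting_jacobian l x : R :=
  if l is i :: l' then
    splitting_jacobian l' (shear M h i (fun y => w y ord0 i) x) *
      shear_jacobian M h i (w' i) x
  else 1.

Lemma splitting_expanding l : expanding_transport ((1 - h * L) ^+ size l)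
  (splitting l) (splitting_jacobian l).
Proof.
elim: l => [|i l IH] /=; first by rewrite expr0; exact: expanding_id.
rewrite exprSr.
have sE : expanding_transport (1 - h * L) (sh i) (shear_jacobian M h i (w' i)).
  split.
  - exact: shear_transports (H i).
  - exact: shear_continuous (H i).
  - exact: shear_surjective (H i).
  - exact: shear_lower (H i).
apply: expanding_comp sE IH.
apply: exprn_ge0; have := hL; lra.
Qed.

Lemma coord_wB x i : `|x| <= M -> `|w x ord0 i| <= B.
Proof. by move=> xM; apply: le_trans (ler_coord_norm _ _) (wB xM). Qed.

Lemma shear_step_dist i x : `|sh i x - x| <= h * B.
Proof. by apply: (shear_dist (H i)) => y; exact: coord_wB. Qed.

Lemma clamped_lipschitz i x y :
  `|w (clampv M x) ord0 i - w (clampv M y) ord0 i| <= L * `|x - y|.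
Proof.
apply: le_trans (shearable_lipschitz (H i) (clampv_norm _ M0) (clampv_norm _ M0)) _.
by rewrite ler_wpM2l// clampv_dist.
Qed.

(** A step of the splitting is an Euler step up to an error of order h ^ 2: the
i-th coordinate is moved at most once, by h times the field at a point that is
within size l * h * B of x. *)
Lemma splitting_coord l x i : uniq l ->
  `|splitting l x ord0 i - x ord0 i - (i \in l)%:R * (h * w (clampv M x) ord0 i)|
  <= h * L * ((size l)%:R * (h * B)).
Proof.
elim: l x => [|p l IH] x /=.
  by move=> _; rewrite !mul0r subrr subr0 normr0 mulr0.
move=> /andP[pl ul]; have := IH (sh p x) ul.
have -> : h * L * ((size l).+1%:R * (h * B)) =
  h * L * ((size l)%:R * (h * B)) + h * L * (h * B) by rewrite -natr1; ring.
rewrite in_cons.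
have hLB : 0 <= h * L * (h * B) by rewrite !mulr_ge0.
have [->|ip] := eqVneq i p.
  rewrite (negbTE pl) mul0r subr0 mul1r /=.
  rewrite [in X in X -> _]/sh /shear set_coord_same /sheared_coord opprD addrA.
  by move=> /le_trans; apply; rewrite lerDl.
have -> : sh p x ord0 i = x ord0 i by rewrite /sh /shear set_coord_other.
rewrite /= -/(sh p x) => hi.
set m : R := (i \in l)%:R in hi *.
have m1 : `|m| <= 1 by rewrite /m; case: (_ \in _); rewrite ?normr1 ?normr0.
have := clamped_lipschitz i (sh p x) x.
have := shear_step_dist p x.
set z := splitting l _ ord0 i in hi *.
move=> d1 d2.
have d3 : `|m * (h * w (clampv M (sh p x)) ord0 i) -
    m * (h * w (clampv M x) ord0 i)| <= h * L * (h * B).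
  rewrite -mulrBr -mulrBr normrM -[leRHS]mul1r ler_pM// normrM ger0_norm//.
  rewrite -mulrA ler_wpM2l//; apply: le_trans d2 _.
  by rewrite ler_wpM2l.
apply: le_trans (ler_distD (m * (h * w (clampv M (sh p x)) ord0 i)) _ _) _.
by rewrite lerD.
Qed.

(** Each factor 1 + h * w' i y is taken at a point y within rho of x0, where w' i
differs from delta i by at most eps, and comparing it with an exponential costs
2 * (h * BD) ^ 2 <= h * eps more. *)
Lemma splitting_jacobian_bounds l x x0 rho (delta : 'I_n -> R) eps BD :
  (forall y i, `|y - x0| <= rho -> `|y| < M /\ `|w' i y - delta i| <= eps) ->
  (forall y i, `|y| <= M -> `|w' i y| <= BD) ->
  0 <= eps -> h * BD <= 2^-1 -> 2 * h * BD ^+ 2 <= eps ->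
  `|x - x0| + (size l)%:R * (h * B) <= rho ->
  expR (\sum_(i <- l) h * delta i - (size l)%:R * (2 * h * eps)) <=
    splitting_jacobian l x <=
  expR (\sum_(i <- l) h * delta i + (size l)%:R * (2 * h * eps)).
Proof.
move=> near bd eps0 hBD hBD2.
elim: l x => [|i l IH] x /=.
  by move=> _; rewrite big_nil !mul0r subrr addr0 expR0 lexx.
rewrite -natr1 !mulrDl !mul1r big_cons => xr.
have hB0 : 0 <= h * B by rewrite mulr_ge0.
have lhB : 0 <= (size l)%:R * (h * B) by rewrite mulr_ge0.
have xx0 : `|x - x0| <= rho by lra.
have /IH/andP[IH1 IH2] : `|sh i x - x0| + (size l)%:R * (h * B) <= rho.
  by have := ler_distD x (sh i x) x0; have := shear_step_dist i x; lra.
have [xM wd] := near x i xx0.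
have JE : shear_jacobian M h i (w' i) x = 1 + h * w' i x.
  rewrite /shear_jacobian clampv_id ?ltW// indicE mem_set ?mulr1//=.
  rewrite in_itv/=.
  have := le_lt_trans (ler_coord_norm x i) xM.
  by rewrite ltr_norml => /andP[-> /ltW ->].
have hw : `|h * w' i x| <= h * BD.
  by rewrite normrM ger0_norm// ler_wpM2l// bd// ltW.
have hwd : `|h * w' i x - h * delta i| <= h * eps.
  by rewrite -mulrBr normrM ger0_norm// ler_wpM2l.
have sq : 2 * (h * w' i x) ^+ 2 <= h * eps.
  apply: (@le_trans _ _ (2 * (h * BD) ^+ 2)).
    rewrite ler_wpM2l// -real_normK ?num_real// ler_sqr// ?nnegrE//.
    by apply: le_trans hw.
  have -> : 2 * (h * BD) ^+ 2 = h * (2 * h * BD ^+ 2) by ring.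
  by rewrite ler_wpM2l.
have J1 : expR (h * delta i - 2 * h * eps) <= shear_jacobian M h i (w' i) x.
  rewrite JE; apply: le_trans (expR_sub_sqr_le _); last exact: le_trans hw _.
  by rewrite ler_expR; move: hwd; rewrite ler_norml => /andP[? ?]; lra.
have J2 : shear_jacobian M h i (w' i) x <= expR (h * delta i + 2 * h * eps).
  rewrite JE; apply: le_trans (expR_ge1Dx _) _.
  rewrite ler_expR; move: hwd; rewrite ler_norml => /andP[? ?].
  have : 0 <= h * eps by rewrite mulr_ge0.
  lra.
apply/andP; split.
  rewrite [leLHS](_ : _ = expR (\sum_(j <- l) h * delta j -
    (size l)%:R * (2 * h * eps)) * expR (h * delta i - 2 * h * eps)).
    by rewrite ler_pM ?expR_ge0.
  by rewrite -expRD; congr expR; ring.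
rewrite [leRHS](_ : _ = expR (\sum_(j <- l) h * delta j +
  (size l)%:R * (2 * h * eps)) * expR (h * delta i + 2 * h * eps)); last first.
  by rewrite -expRD; congr expR; ring.
rewrite ler_pM//; first by apply: le_trans IH1; exact: expR_ge0.
exact: shear_jacobian_ge0 (H i) _.
Qed.

End Splitting.

(** * The splitting scheme along a trajectory *)

Section EulerScheme.
Context {R : realType} {n : nat}.
Implicit Types (a x y : 'rV[R]_n) (s r : R) (m : nat).
Variables (v : R -> 'rV[R]_n -> 'rV[R]_n) (D : 'I_n -> R -> 'rV[R]_n -> R).
Hypothesis vD : velocity_field v D.
Variables (T : R) (X : 'rV[R]_n -> R -> 'rV[R]_n) (Lam : 'rV[R]_n -> R -> R).
Hypothesis T0 : 0 <= T.
Hypothesis vX : flow T v X.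
Hypothesis LamP : log_jacobian D T X Lam.

Variables (k M B L BD ev eD e : R) (N : nat).
Let M1 := M + 1.
Let h := T / N%:R.
Hypothesis N0 : (0 < N)%N.
Hypothesis M0 : 0 <= M.
Hypothesis B0 : 0 <= B.
Hypothesis L0 : 0 <= L.
Hypothesis HM : forall a s, `|a| <= k -> s \in `[0, T] -> `|X a s| <= M.
Hypothesis HB : forall s x, s \in `[0, T] -> `|x| <= M1 -> `|v s x| <= B.
Hypothesis HL : forall s x y, `|x| <= M1 -> `|y| <= M1 ->
  `|v s x - v s y| <= L * `|x - y|.
Hypothesis HBD : forall i s x, s \in `[0, T] -> `|x| <= M1 -> `|D i s x| <= BD.
Hypothesis hL : h * L <= 2^-1.
Hypothesis hBD : h * BD <= 2^-1.
Hypothesis ev0 : 0 <= ev.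
Hypothesis eD0 : 0 <= eD.
Hypothesis Hev : forall s r x y, s \in `[0, T] -> `|x| <= M ->
  `|s - r| <= h -> `|x - y| <= B * h -> `|v s x - v r y| <= ev.
Let loc := ev + L * (n%:R * (h * B)).
Hypothesis He : T * loc * expR (L * T) <= e.
Let rho := e + n%:R * (h * B).
Hypothesis rho1 : rho < 1.
Hypothesis HeD : forall i s r x y, s \in `[0, T] -> `|x| <= M ->
  `|s - r| <= h -> `|x - y| <= rho + B * h -> `|D i s x - D i r y| <= eD.
Hypothesis hBD2 : 2 * h * BD ^+ 2 <= eD.

Let h0 : 0 <= h. Proof. by rewrite divr_ge0. Qed.

Let M10 : 0 <= M1. Proof. by rewrite addr_ge0. Qed.

Let Nh : N%:R * h = T.
Proof. by rewrite /h mulrC divfK// pnatr_eq0 -lt0n. Qed.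

Let mh m : (m <= N)%N -> m%:R * h \in `[0, T].
Proof.
move=> mN; rewrite in_itv/= mulr_ge0//= -Nh.
by rewrite ler_wpM2r// ler_nat.
Qed.

Let field_shearable s : s \in `[0, T] -> forall i,
  shearable M1 h L i (fun x => v s x ord0 i) (D i s).
Proof.
move=> sT i.
have cpair : continuous (fun x : 'rV[R]_n => (s, x)).
  move=> x; apply: (@cvg_pair _ _ _ (nbhs x) (nbhs s) (nbhs x)
    _ _ _ (cst s) id); [exact: cvg_cst|exact: cvg_id].
split => //.
- move=> x; apply: (@continuous_comp _ _ _ (v s) (fun y : 'rV[R]_n => y ord0 i)).
    apply: (@continuous_comp _ _ _ (fun x => (s, x))
      (fun p : R * 'rV[R]_n => v p.1 p.2)); first exact: cpair.
    exact: (velocity_continuous vD).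
  exact: coord_continuous.
- move=> x; apply: (@continuous_comp _ _ _ (fun x => (s, x))
    (fun p : R * 'rV[R]_n => D i p.1 p.2)); first exact: cpair.
  exact: (velocity_continuous' vD).
- by move=> x; exact: (velocity_derive vD).
- move=> x y xM yM; apply: le_trans (HL s xM yM).
  by have := ler_coord_norm (v s x - v s y) i; rewrite !mxE.
- move=> x xM; rewrite normrM ger0_norm//; apply: le_trans hBD.
  by rewrite ler_wpM2l// HBD.
Qed.

Fixpoint euler m x : 'rV[R]_n :=
  if m is m'.+1 then
    splitting M1 h (v (m'%:R * h)) (enum 'I_n) (euler m' x)
  else x.

Fixpoint euler_jacobian m x : R :=
  if m is m'.+1 then
    splitting_jacobian M1 h (v (m'%:R * h)) (fun i => D i (m'%:R * h))
      (enum 'I_n) (euler m' x) * euler_jacobian m' x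
  else 1.

Lemma euler_expanding m : (m <= N)%N ->
  expanding_transport ((1 - h * L) ^+ (m * n)) (euler m) (euler_jacobian m).
Proof.
elim: m => [|m IH] mN /=; first by rewrite mul0n expr0; exact: expanding_id.
have mN' := ltnW mN.
have sE := splitting_expanding (field_shearable (mh mN')) hL (enum 'I_n).
rewrite size_enum_ord in sE.
rewrite mulSn exprD; apply: expanding_comp (IH mN') sE.
by apply: exprn_ge0; have := hL; lra.
Qed.

Let in_sub m s : (m < N)%N -> s \in `[m%:R * h, m.+1%:R * h] -> s \in `[0, T].
Proof.
move=> mN; rewrite !in_itv/= => /andP[ms sm].
have := mh (ltnW mN); have := mh mN; rewrite !in_itv/= => /andP[_ h1] /andP[h2 _].
by rewrite (le_trans h2 ms) (le_trans sm h1).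
Qed.

Let step_le m : m%:R * h <= m.+1%:R * h.
Proof. by rewrite ler_wpM2r// ler_nat. Qed.

Let step_diff m : m.+1%:R * h - m%:R * h = h.
Proof. by rewrite -natr1 mulrDl mul1r addrAC subrr add0r. Qed.

Let sub_within (W : topologicalType) (f : R -> W) m : (m < N)%N ->
  {within `[0, T], continuous f} ->
  {within `[m%:R * h, m.+1%:R * h], continuous f}.
Proof.
by move=> mN; apply: continuous_subspaceW => s /= ; exact: in_sub.
Qed.

Let sub_open m s : (m < N)%N -> s \in `]m%:R * h, m.+1%:R * h[ -> s \in `]0, T[.
Proof.
move=> mN; rewrite !in_itv/= => /andP[ms sm].
have := mh (ltnW mN); have := mh mN; rewrite !in_itv/= => /andP[_ h1] /andP[h2 _].
by rewrite (le_lt_trans h2 ms) (lt_le_trans sm h1).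
Qed.

(** The mean value theorem for one coordinate: the intermediate time s depends
on the coordinate. *)
Lemma flow_step_coord a m i : (m < N)%N -> exists2 s,
  s \in `[m%:R * h, m.+1%:R * h] &
  X a (m.+1%:R * h) ord0 i - X a (m%:R * h) ord0 i = h * v s (X a s) ord0 i.
Proof.
move=> mN; have [s sI E] := @MVT_segment R (fun s => X a s ord0 i)
  (fun s => v s (X a s) ord0 i) _ _ (step_le m)
  (fun s h => flow_derive vX a i (sub_open mN h))
  (sub_within mN (flow_coord_continuous vX (a:=a) (i:=i))).
by exists s => //; rewrite E step_diff mulrC.
Qed.

Lemma flow_step_dist a m s : `|a| <= k -> (m < N)%N ->
  s \in `[m%:R * h, m.+1%:R * h] -> `|X a (m%:R * h) - X a s| <= B * h.
Proof.
move=> ak mN sI; have := sI; rewrite in_itv/= => /andP[ms sm].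
apply: rV_norm_le => [|i]; first by rewrite mulr_ge0.
rewrite !mxE distrC.
have [||r rI ->] := @MVT_segment R (fun s => X a s ord0 i)
  (fun s => v s (X a s) ord0 i) _ _ ms.
- move=> r; rewrite in_itv/= => /andP[mr rs]; apply: (flow_derive vX).
  by apply: (sub_open mN); rewrite in_itv/= mr (lt_le_trans rs).
- apply: continuous_subspaceW (sub_within mN (flow_coord_continuous vX (a:=a) (i:=i))).
  by move=> r /=; rewrite !in_itv/= => /andP[-> /le_trans]; apply.
have rT : r \in `[0, T].
  apply: (in_sub mN); move: rI; rewrite !in_itv/= => /andP[-> /le_trans]; exact.
rewrite normrM ler_pM//.
  apply: le_trans (ler_coord_norm _ _) (HB rT _).
  by apply: le_trans (HM ak rT) _; rewrite lerDl.
rewrite ger0_norm ?subr_ge0//.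
by have := step_diff m; lra.
Qed.

(** The discrete Gronwall inequality: loc * h bounds the error made in one step,
from the variation ev of the field during the step and from the splitting, and the
errors of earlier steps grow by the factor 1 + h * L. *)
Lemma euler_error a m : `|a| <= k -> (m <= N)%N ->
  `|euler m a - X a (m%:R * h)| <= m%:R * h * loc * expR (L * (m%:R * h)).
Proof.
move=> ak; elim: m => [|m IH] mN /=.
  by rewrite !mul0r (flow0 vX) subrr normr0.
have mN' := ltnW mN.
have mT := mh mN'.
have loc0 : 0 <= loc by rewrite addr_ge0// !mulr_ge0.
set x := euler m a in IH *; set t := m%:R * h in IH mT *.
set err := t * loc * expR (L * t) in IH.
have XM : `|X a t| <= M by apply: HM.
have step : `|splitting M1 h (v t) (enum 'I_n) x - X a (m.+1%:R * h)| <=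
    (1 + h * L) * `|x - X a t| + h * loc.
  apply: rV_norm_le => [|i]; first by rewrite addr_ge0// !mulr_ge0// addr_ge0// mulr_ge0.
  rewrite !mxE.
  have [s sI XE] := flow_step_coord a i mN.
  have sc := splitting_coord (field_shearable mT) M10 h0 L0 B0
    (fun x => HB mT (x:=x)) x i (enum_uniq 'I_n).
  rewrite mem_enum inE mul1r size_enum_ord in sc.
  have cl := clamped_lipschitz (field_shearable mT) M10 L0 i x (X a t).
  rewrite [clampv M1 (X a t)]clampv_id in cl; last by rewrite (le_trans XM)// lerDl.
  have vv : `|v t (X a t) ord0 i - v s (X a s) ord0 i| <= ev.
    have := Hev mT XM (r := s) (y := X a s).
    have ts : `|t - s| <= h.
      move: sI; rewrite in_itv/= -/t => /andP[ts st].
      by rewrite distrC ger0_norm ?subr_ge0//; have := step_diff m; rewrite -/t; lra.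
    move=> /(_ ts (flow_step_dist ak mN sI)); apply: le_trans.
    by have := ler_coord_norm (v t (X a t) - v s (X a s)) i; rewrite !mxE.
  have xX : `|x ord0 i - X a t ord0 i| <= `|x - X a t|.
    by have := ler_coord_norm (x - X a t) i; rewrite !mxE.
  have -> : X a (m.+1%:R * h) ord0 i = X a t ord0 i + h * v s (X a s) ord0 i.
    by rewrite -XE addrC subrK.
  set z := splitting _ _ _ _ _ ord0 i in sc *.
  set u1 := v t (clampv M1 x) ord0 i in sc cl *.
  set u2 := v t (X a t) ord0 i in cl vv *.
  set u3 := v s (X a s) ord0 i in vv *.
  have e1 : `|h * (u1 - u2)| <= h * (L * `|x - X a t|).
    by rewrite normrM ger0_norm// ler_wpM2l.
  have e2 : `|h * (u2 - u3)| <= h * ev by rewrite normrM ger0_norm// ler_wpM2l.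
  rewrite (_ : z - _ = (z - x ord0 i - h * u1) + (x ord0 i - X a t ord0 i) +
    h * (u1 - u2) + h * (u2 - u3)); last by ring.
  apply: le_trans (ler_normD _ _) _; apply: le_trans (lerD (ler_normD _ _) e2) _.
  apply: le_trans (lerD (lerD (ler_normD _ _) e1) (lexx _)) _.
  apply: le_trans (lerD (lerD (lerD sc xX) (lexx _)) (lexx _)) _.
  by rewrite /loc; set q := `|x - X a t|; lra.
apply: le_trans step _.
have hL0 : 0 <= h * L by rewrite mulr_ge0.
have t0 : 0 <= t by rewrite mulr_ge0.
apply: (@le_trans _ _ ((1 + h * L) * err + h * loc)).
  by rewrite lerD2r ler_wpM2l ?addr_ge0// IH.
have -> : m.+1%:R * h = t + h by rewrite -natr1 mulrDl mul1r.
have -> : (t + h) * loc * expR (L * (t + h)) =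
    expR (L * h) * err + h * loc * expR (L * (t + h)).
  by rewrite /err [L * _]mulrDr expRD; ring.
apply: lerD.
  rewrite ler_wpM2r ?mulr_ge0 ?expR_ge0//.
  by rewrite mulrC expR_ge1Dx.
rewrite ler_peMr ?mulr_ge0// (le_trans _ (expR_ge1Dx _))// lerDl.
by rewrite mulr_ge0// addr_ge0.
Qed.

Lemma euler_close a m : `|a| <= k -> (m <= N)%N -> `|euler m a - X a (m%:R * h)| <= e.
Proof.
move=> ak mN; apply: le_trans (euler_error ak mN) _; apply: le_trans He.
have := mh mN; rewrite in_itv/= => /andP[m0 mT].
have loc0 : 0 <= loc by rewrite addr_ge0// !mulr_ge0.
rewrite ler_pM ?mulr_ge0 ?expR_ge0//; first by rewrite ler_wpM2r.
by rewrite ler_expR ler_wpM2l.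
Qed.

(** In each step the logarithm of the Jacobian of the scheme differs from the
increment of Lam by at most n * 2 * h * eD; splitting_jacobian_bounds is applied
around the point of the trajectory at which the mean value theorem expresses that
increment. *)
Lemma euler_jacobian_close a m : `|a| <= k -> (m <= N)%N ->
  expR (Lam a (m%:R * h) - m%:R * (n%:R * (2 * h * eD))) <= euler_jacobian m a <=
  expR (Lam a (m%:R * h) + m%:R * (n%:R * (2 * h * eD))).
Proof.
move=> ak; elim: m => [|m IH] mN /=.
  by rewrite !mul0r (log_jacobian0 LamP) subr0 addr0 expR0 lexx.
have mN' := ltnW mN.
have mT := mh mN'.
have /andP[IH1 IH2] := IH mN'.
have XM : `|X a (m%:R * h)| <= M by apply: HM.
have [s sI LE] := @MVT_segment R (Lam a) (fun s => \sum_i D i s (X a s)) _ _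
  (step_le m) (fun s h => log_jacobian_derive LamP a (sub_open mN h))
  (sub_within mN (log_jacobian_continuous LamP (a:=a))).
rewrite step_diff in LE.
have hB0 : 0 <= h * B by rewrite mulr_ge0.
have near y i : `|y - X a (m%:R * h)| <= rho ->
    `|y| < M1 /\ `|D i (m%:R * h) y - D i s (X a s)| <= eD.
  move=> yr; split.
    rewrite -(subrK (X a (m%:R * h)) y); apply: le_lt_trans (ler_normD _ _) _.
    by have := rho1; rewrite /M1; lra.
  rewrite distrC; apply: HeD.
  - exact: in_sub mN sI.
  - by apply: HM => //; exact: in_sub mN sI.
  - move: sI; rewrite in_itv/= => /andP[ms sm].
    by rewrite ger0_norm ?subr_ge0//; have := step_diff m; lra.
  - apply: le_trans (ler_distD (X a (m%:R * h)) _ _) _.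
    have := flow_step_dist ak mN sI; rewrite (distrC (X a s)) (distrC _ y); lra.
have := @splitting_jacobian_bounds _ _ M1 h L B (v (m%:R * h)) (fun i => D i (m%:R * h))
  (field_shearable mT) h0 B0 (fun x => HB mT (x:=x)) (enum 'I_n) (euler m a)
  (X a (m%:R * h)) rho (fun i => D i s (X a s)) eD BD near
  (fun y i yM => HBD i mT yM) eD0 hBD hBD2.
rewrite size_enum_ord => /(_ _)/andP[].
  by rewrite /rho lerD2r euler_close.
rewrite big_enum/= -mulr_sumr mulrC -LE => J1 J2.
set S := Lam a (m.+1%:R * h) in J1 J2 *; set S0 := Lam a (m%:R * h) in J1 J2 IH1 IH2.
apply/andP; split.
  rewrite [leLHS](_ : _ = expR (S - S0 - n%:R * (2 * h * eD)) *
    expR (S0 - m%:R * (n%:R * (2 * h * eD)))).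
    by rewrite ler_pM ?expR_ge0.
  by rewrite -expRD -natr1; congr expR; ring.
rewrite [leRHS](_ : _ = expR (S - S0 + n%:R * (2 * h * eD)) *
    expR (S0 + m%:R * (n%:R * (2 * h * eD)))).
  rewrite ler_pM//; first by apply: le_trans J1; exact: expR_ge0.
  by apply: le_trans IH1; exact: expR_ge0.
by rewrite -expRD -natr1; congr expR; ring.
Qed.

End EulerScheme.

(** * Approximation of the flow by measure transports *)

Section FlowApproximation.
Context {R : realType} {n : nat}.
Implicit Types (a x y : 'rV[R]_n) (s r : R) (m : nat).
Variables (v : R -> 'rV[R]_n -> 'rV[R]_n) (D : 'I_n -> R -> 'rV[R]_n -> R).
Hypothesis vD : velocity_field v D.
Variables (T : R) (X : 'rV[R]_n -> R -> 'rV[R]_n) (Lam : 'rV[R]_n -> R -> R).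
Hypothesis T0 : 0 <= T.
Hypothesis vX : flow T v X.
Hypothesis LamP : log_jacobian D T X Lam.

(** The step size T / (N + 1) times any constant is eventually below any positive
bound; each smallness condition of the scheme has this form. *)
Lemma small_step (c d : R) : 0 < d -> \forall N \near \oo, c * (T / N.+1%:R) <= d.
Proof.
move=> d0.
have e0 : 0 < d / (`|c| * T + 1).
  by rewrite divr_gt0// ltr_wpDl// mulr_ge0.
near=> N.
apply: (@le_trans _ _ ((`|c| * T + 1) * N.+1%:R^-1)).
  rewrite mulrA ler_wpM2r//.
  by apply: le_trans (ler_wpM2r T0 (ler_norm c)) _; rewrite lerDl.
rewrite mulrC -ler_pdivlMr; last by rewrite ltr_wpDl// mulr_ge0.
apply: ltW; near: N; exact: (near_infty_natSinv_lt (PosNum e0)).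
Unshelve. all: by end_near. Qed.

Lemma common_threshold (P : 'I_n -> R -> Prop) :
  (forall i r r', r' <= r -> P i r -> P i r') ->
  (forall i, exists2 r, 0 < r & P i r) -> exists2 r, 0 < r & forall i, P i r.
Proof.
move=> Pmono H; pose f i := projT1 (cid2 (H i)).
have f0 i : 0 < f i by rewrite /f; case: cid2.
have Pf i : P i (f i) by rewrite /f; case: cid2.
exists (\big[Order.min/1]_i f i); first by apply/bigmin_gtP; split.
by move=> i; apply: Pmono (Pf i); exact: bigmin_le_cond.
Qed.

Lemma bounded_on_compact (U V : normedModType R) (f : R * U -> V) (A : set U) :
  continuous f -> compact A ->
  exists2 C, 0 <= C & forall s (z : U), s \in `[0, T] -> A z -> `|f (s, z)| <= C.
Proof.
move=> cf cA.
have [C [_ HC]] := compact_bounded (continuous_compact (continuous_subspaceT cf)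
  (compact_setX (@segment_compact R 0 T) cA)).
exists (`|C| + 1); first by rewrite addr_ge0.
move=> s x sT Ax; apply: HC; last by exists (s, x).
by rewrite (le_lt_trans (ler_norm C))// ltrDl.
Qed.

(** The scheme with N + 1 steps, N large. That kappa does not depend on eps is
essential: each shear contracts distances at most by 1 - h * L, and (N + 1) * n of them
are composed with (N + 1) * h = T; so the product stays above expR (- 2 * L * T * n). *)
Lemma flow_approximation (k : R) : exists2 kappa, 0 < kappa &
  forall eps, 0 < eps -> exists Phi P, expanding_transport kappa Phi P /\
    forall a, `|a| <= k -> `|Phi a - X a T| <= eps /\
      expR (Lam a T - eps) <= P a <= expR (Lam a T + eps).
Proof.
have [M' HM'] := flow_bounded vD T0 vX k.
pose M := Num.max 0 M'.
have M0 : 0 <= M by rewrite le_max lexx.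
have HM a s : `|a| <= k -> s \in `[0, T] -> `|X a s| <= M.
  by move=> ak sT; rewrite le_max HM' ?orbT.
have [L L0 HL] := velocity_lipschitz vD (M + 1).
have cbox := @compact_closed_box R n (M + 1).
have [B B0 HB] := bounded_on_compact (velocity_continuous vD) cbox.
have [BD BD0 HBD] : exists2 BD, 0 <= BD & forall i s x, s \in `[0, T] ->
    `|x| <= M + 1 -> `|D i s x| <= BD.
  have H i : exists C, 0 <= C /\ forall s x, s \in `[0, T] ->
      `|x| <= M + 1 -> `|D i s x| <= C.
    have [C C0 HC] := @bounded_on_compact 'rV[R]_n R^o _ _ (@velocity_continuous' _ _ _ _ vD i) cbox.
    by exists C; split => // s x sT xM; apply: HC.
  have /choice[C HC] := H.
  exists (\sum_i C i); first by apply: sumr_ge0 => i _; have [] := HC i.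
  move=> i s x sT xM; apply: le_trans ((HC i).2 s x sT xM) _.
  rewrite (bigD1 i)//= lerDl; apply: sumr_ge0 => j _; by have [] := HC j.
exists (expR (- (2 * L * T * n%:R))); first exact: expR_gt0.
move=> eps eps0.
(* eD: accuracy of the derivatives, so that the N + 1 steps together contribute at
   most eps to the logarithm of the Jacobian *)
pose eD := eps / (2 * n%:R * T + 1).
have nT0 : 0 <= 2 * n%:R * T by rewrite !mulr_ge0.
have eD0 : 0 < eD by rewrite divr_gt0// ltr_wpDl.
have nTeD : 2 * n%:R * T * eD <= eps.
  rewrite /eD mulrA ler_pdivrMr ?ltr_wpDl// mulrC ler_wpM2l ?(ltW eps0)//.
  by rewrite lerDl.
have segT := @segment_compact R 0 T.
have [etaD etaD0 HetaD] : exists2 eta, 0 < eta & forall i s r x y,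
    s \in `[0, T] -> `|x| <= M -> `|s - r| <= eta -> `|x - y| <= eta ->
    `|D i s x - D i r y| <= eD.
  have [||eta eta0 Heta] := @common_threshold (fun i eta => forall s r x y,
    s \in `[0, T] -> `|x| <= M -> `|s - r| <= eta -> `|x - y| <= eta ->
    `|D i s x - D i r y| <= eD); last by exists eta.
    move=> i r r' rr H s s' x y sT xM ss xy.
    by apply: H => //; apply: le_trans rr.
  move=> i; have [eta eta0 H] := @modulus_on_compact R R^o 'rV[R]_n R^o _ _ _ _
    (@velocity_continuous' _ _ _ _ vD i) segT (@compact_closed_box R n M) eD0.
  by exists eta => // s r x y sT xM; apply: H.
(* e: accuracy of the positions. With h small, the points visited in a step are
   within e + n * h * B + B * h <= etaD of the trajectory, and in the box M + 1 *)
pose e := Num.min eps (Num.min (etaD / 3) 4^-1).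
have e0 : 0 < e by rewrite !lt_min eps0 divr_gt0//= invr_gt0 ltr0n.
have [e_eps e_eta e_4] : [/\ e <= eps, e <= etaD / 3 & e <= 4^-1].
  by rewrite /e; split; rewrite !ge_min lexx ?orbT.
pose E := T * expR (L * T).
have E0 : 0 <= E by rewrite mulr_ge0// expR_ge0.
(* ev: accuracy of the velocities; by euler_error the positions are then accurate
   up to 2 * ev * E <= e *)
pose ev := e / (2 * E + 1).
have E20 : 0 < 2 * E + 1 by rewrite ltr_wpDl// mulr_ge0.
have ev0 : 0 < ev by rewrite divr_gt0.
have [etav etav0 Hetav] := @modulus_on_compact R R^o 'rV[R]_n 'rV[R]_n _ _ _ _
  (velocity_continuous vD) segT (@compact_closed_box R n M) ev0.
have etaD3 : 0 < etaD / 3 by rewrite divr_gt0.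
have half0 : 0 < 2^-1 :> R by rewrite invr_gt0.
have quart0 : 0 < 4^-1 :> R by rewrite invr_gt0.
near \oo => N.
have h_etav : 1 * (T / N.+1%:R) <= etav by near: N; exact: small_step.
have Bh_etav : B * (T / N.+1%:R) <= etav by near: N; exact: small_step.
have LnBh : L * n%:R * B * (T / N.+1%:R) <= ev by near: N; exact: small_step.
have nBh4 : n%:R * B * (T / N.+1%:R) <= 4^-1 by near: N; exact: small_step.
have nBhD : n%:R * B * (T / N.+1%:R) <= etaD / 3 by near: N; exact: small_step.
have BhD : B * (T / N.+1%:R) <= etaD / 3 by near: N; exact: small_step.
have h_etaD : 1 * (T / N.+1%:R) <= etaD by near: N; exact: small_step.
have Lh : L * (T / N.+1%:R) <= 2^-1 by near: N; exact: small_step.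
have BDh : BD * (T / N.+1%:R) <= 2^-1 by near: N; exact: small_step.
have BD2h : 2 * BD ^+ 2 * (T / N.+1%:R) <= eD by near: N; exact: small_step.
set h := T / N.+1%:R in h_etav Bh_etav LnBh nBh4 nBhD BhD h_etaD Lh BDh BD2h.
rewrite !mul1r in h_etav h_etaD.
have h0 : 0 <= h by rewrite divr_ge0.
have hL : h * L <= 2^-1 by rewrite mulrC.
have hBD : h * BD <= 2^-1 by rewrite mulrC.
have Hev s r x y : s \in `[0, T] -> `|x| <= M -> `|s - r| <= h ->
    `|x - y| <= B * h -> `|v s x - v r y| <= ev.
  move=> sT xM sr xy; apply: (Hetav s r x y) => //.
  - exact: le_trans sr h_etav.
  - exact: le_trans xy Bh_etav.
have He : T * (ev + L * (n%:R * (h * B))) * expR (L * T) <= e.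
  apply: (@le_trans _ _ (E * (2 * ev))).
    have -> : T * (ev + L * (n%:R * (h * B))) * expR (L * T) =
      E * (ev + L * n%:R * B * h) by rewrite /E; ring.
    rewrite ler_wpM2l//; lra.
  by rewrite /ev mulrA mulrA ler_pdivrMr//; lra.
have rho1 : e + n%:R * (h * B) < 1.
  have : n%:R * (h * B) <= 4^-1 by rewrite (mulrC h) mulrA.
  lra.
have HeD i s r x y : s \in `[0, T] -> `|x| <= M -> `|s - r| <= h ->
    `|x - y| <= e + n%:R * (h * B) + B * h -> `|D i s x - D i r y| <= eD.
  move=> sT xM sr xy; apply: HetaD => //; first exact: le_trans sr h_etaD.
  apply: le_trans xy _.
  have : n%:R * (h * B) <= etaD / 3 by rewrite (mulrC h) mulrA.
  lra.
have hBD2 : 2 * h * BD ^+ 2 <= eD by rewrite mulrAC.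
exists (euler v T M N.+1 N.+1), (euler_jacobian v D T M N.+1 N.+1).
have NT : N.+1%:R * h = T by rewrite /h mulrC divfK// pnatr_eq0.
split.
  have [t c s l] := euler_expanding vD T0 (ltn0Sn N) M0 L0 HL HBD hL hBD (leqnn _).
  split => // x y; apply: le_trans (l x y); rewrite ler_wpM2r// -/h.
  have -> : - (2 * L * T * n%:R) = - (2 * (h * L)) * (N.+1 * n)%:R.
    by rewrite natrM -NT; ring.
  rewrite expRM_natr; apply: lerXn2r; rewrite ?nnegrE ?expR_ge0//.
    by have := hL; lra.
  by apply: bernoulli_expR => //; rewrite mulr_ge0.
move=> a ak.
have := euler_close vD T0 vX (ltn0Sn N) M0 B0 L0 HM HB HL HBD hL hBD (ltW ev0)
  Hev He ak (leqnn _).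
have := euler_jacobian_close vD T0 vX LamP (ltn0Sn N) M0 B0 L0 HM HB HL HBD hL hBD
  (ltW ev0) (ltW eD0) Hev He rho1 HeD hBD2 ak (leqnn _).
rewrite -/h NT => /andP[J1 J2] close; split; first exact: le_trans close e_eps.
have nT : N.+1%:R * (n%:R * (2 * h * eD)) <= eps.
  by apply: le_trans nTeD; rewrite -NT le_eqVlt; apply/orP; left; apply/eqP; ring.
apply/andP; split.
  by apply: le_trans J1; rewrite ler_expR lerD2l lerN2.
by apply: le_trans J2 _; rewrite ler_expR lerD2l.
Unshelve. all: by end_near. Qed.

End FlowApproximation.

(** * Neighbourhoods of compact sets *)

Section Neighbourhoods.
Context {R : realType} {n : nat}.
Implicit Types A B : set 'rV[R]_n.

Definition neighbourhood (e : R) A : set 'rV[R]_n :=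
  [set x | exists2 a, A a & `|x - a| <= e].

Lemma sub_neighbourhood e A : 0 <= e -> A `<=` neighbourhood e A.
Proof. by move=> e0 a Aa; exists a => //; rewrite subrr normr0. Qed.

Lemma neighbourhoodS e e' A : e <= e' -> neighbourhood e A `<=` neighbourhood e' A.
Proof. by move=> ee x [a Aa xa]; exists a => //; exact: le_trans ee. Qed.

Lemma compact_neighbourhood e A : compact A -> compact (neighbourhood e A).
Proof.
move=> cA.
have -> : neighbourhood e A = (fun p => p.1 + p.2) @` (A `*` closed_box e).
  apply/seteqP; split => x.
    by move=> [a Aa xa]; exists (a, x - a) => //=; rewrite addrC subrK.
  by move=> [[a b] /= [Aa be] <-]; exists a => //; rewrite addrAC subrr add0r.
have cp := compact_setX cA (@compact_closed_box R n e).
apply: continuous_compact; last exact: cp.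
by apply: continuous_subspaceT => p; exact: add_continuous.
Qed.

Lemma bigcap_neighbourhood A : compact A ->
  \bigcap_k neighbourhood k.+1%:R^-1 A = A.
Proof.
move=> cA; apply/seteqP; split; last first.
  by move=> a Aa k _; apply: sub_neighbourhood.
move=> x Nx.
have clA : closed A by exact: compact_closed.
rewrite ((closure_id A).1 clA).
move=> U /nbhs_ballP[e /= e0 eU].
have [k _ /(_ k (leqnn k))/= ke] := near_infty_natSinv_lt (PosNum e0).
have [a Aa xa] := Nx k I; exists a; split => //; apply: eU.
by rewrite -ball_normE /=; exact: le_lt_trans xa ke.
Qed.

(** Continuity from above along the neighbourhoods of radius 1 / (k + 1), which
decrease to A because A is closed. *)
Lemma measure_neighbourhood (m : {measure set 'rV[R]_n -> \bar R}) A :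
  (forall k, m (closed_box k) < +oo)%E -> compact A ->
  forall delta : R, 0 < delta -> exists2 e, 0 < e <= 1 &
    (m (neighbourhood e A) <= m A + delta%:E)%E.
Proof.
move=> moo cA delta d0.
have mN k : measurable (neighbourhood k.+1%:R^-1 A).
  by apply: compact_measurable_rV; exact: compact_neighbourhood.
have mA := compact_measurable_rV cA.
have Noo : (m (neighbourhood 1 A) < +oo)%E.
  have [C [_ HC]] := compact_bounded (compact_neighbourhood (e := 1) cA).
  apply: le_lt_trans (moo (C + 1)); apply: le_measure; rewrite ?inE.
  - by apply: compact_measurable_rV; exact: compact_neighbourhood.
  - by apply: closed_measurable_rV; exact: closed_closed_box.
  - by move=> x Nx; apply: HC => //; rewrite ltrDl.
have := @nonincreasing_cvg_mu _ _ _ m (fun k => neighbourhood k.+1%:R^-1 A).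
move=> /(_ _ mN _ _); rewrite bigcap_neighbourhood// invr1 => /(_ Noo mA).
have mono : {homo (fun k : nat => neighbourhood k.+1%:R^-1 A) : i j / (i <= j)%N >-> (j <= i)%O}.
  move=> i j ij; apply/subsetPset; apply: neighbourhoodS.
  by rewrite lef_pV2 ?posrE// ler_nat.
move=> /(_ mono) cvgm.
have fA : m A \is a fin_num.
  rewrite ge0_fin_numE//; apply: le_lt_trans Noo; apply: le_measure; rewrite ?inE//.
    by apply: compact_measurable_rV; exact: compact_neighbourhood.
  exact: sub_neighbourhood.
have lt : (m A < m A + delta%:E)%E by rewrite lteDl// lte_fin.
have [k _ /(_ k (leqnn k))/= Hk] := cvgm _ (open_ereal_lt_ereal lt).
exists k.+1%:R^-1; last exact: ltW.
by rewrite invr_gt0 ltr0n/= invf_le1// ler1n.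
Qed.

End Neighbourhoods.

Lemma product_lebesgue_box_finite (R : realType) n (k : R) :
  (product_lebesgue n (closed_box k) < +oo)%E.
Proof.
elim: n => [|n IH].
  by rewrite /= diracE; case: (_ \in _); rewrite ltry.
have mbox := closed_measurable_rV (@closed_closed_box R n k).
have mB := closed_measurable_rV (@closed_closed_box R n.+1 k).
have mP : measurable (`[- k, k]%classic `*` closed_box k :
    set (measurableTypeR R * 'rV[R]_n)) by exact: measurableX.
apply: (@le_lt_trans _ _ ((lebesgue_measure \x product_lebesgue n)%E
  (`[- k, k]%classic `*` closed_box k))).
  apply: (@le_measure _ _ _ (lebesgue_measure \x product_lebesgue n)%E); rewrite ?inE//.
    by rewrite -[X in measurable X]setTI; exact: measurable_rV_cons.
  move=> [a y] /= ayk; split => /=.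
    rewrite in_itv/= -ler_norml; apply: le_trans ayk.
    by have := ler_coord_norm (rV_cons (a, y)) ord0; rewrite rV_cons0.
  apply: rV_norm_le => [|i]; first exact: le_trans ayk.
  apply: le_trans ayk.
  by have := ler_coord_norm (rV_cons (a, y)) (lift ord0 i); rewrite rV_consS.
rewrite product_measure1E// lte_mul_pinfty//.
  rewrite ge0_fin_numE//= lebesgue_measure_itv/=; case: ifP => // _.
  by rewrite -EFinB ltry.
Qed.

(** * The volume of images of compact sets *)

Section FlowChangeOfVariables.
Context {R : realType} {n : nat}.
Implicit Types (a b x y : 'rV[R]_n) (s : R) (A B : set 'rV[R]_n).
Variables (v : R -> 'rV[R]_n -> 'rV[R]_n) (D : 'I_n -> R -> 'rV[R]_n -> R).
Hypothesis vD : velocity_field v D.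
Variables (T : R) (X : 'rV[R]_n -> R -> 'rV[R]_n) (Lam : 'rV[R]_n -> R -> R).
Hypothesis T0 : 0 <= T.
Hypothesis vX : flow T v X.
Hypothesis LamP : log_jacobian D T X Lam.

Local Notation leb := (@product_lebesgue R n).

Let TT : T \in `[0, T]. Proof. by rewrite in_itv/= T0 lexx. Qed.

Lemma log_jacobian_at_continuous : continuous (Lam ^~ T).
Proof.
move=> a; apply/(@cvgrPdist_le _ R^o _ (nbhs a)) => e e0.
have [M HM] := flow_bounded vD T0 vX (`|a| + 1).
have [C C0 HC] := flow_lipschitz vD T0 vX (`|a| + 1).
pose g (p : R * 'rV[R]_n) := \sum_i D i p.1 p.2.
have cg : continuous g.
  by apply: (@continuous_sumr R R^o) => i; exact: (velocity_continuous' vD).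
have e1 : 0 < e / (T + 1) by rewrite divr_gt0// ltr_wpDl.
have [eta eta0 Heta] := @modulus_on_compact R R^o 'rV[R]_n R^o g _ _ _ cg
  (@segment_compact R 0 T) (@compact_closed_box R n M) e1.
apply/nbhs_ballP; exists (Num.min 1 (eta / C)).
  by rewrite /= lt_min ltr01 divr_gt0.
move=> b; rewrite -ball_normE /= lt_min => /andP[ab1 abe].
have ak : `|a| <= `|a| + 1 by rewrite lerDl.
have bk : `|b| <= `|a| + 1.
  rewrite -(subrK a b); apply: le_trans (ler_normD _ _) _.
  by rewrite addrC lerD2l distrC ltW.
have [||c cI] := @MVT_segment R (fun s => Lam a s - Lam b s)
  (fun s => \sum_i D i s (X a s) - \sum_i D i s (X b s)) 0 T T0.
- move=> s sT; exact: is_deriveB (log_jacobian_derive LamP a sT)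
    (log_jacobian_derive LamP b sT).
- by move=> s; apply: cvgB; exact: (log_jacobian_continuous LamP).
rewrite !(log_jacobian0 LamP) !subr0 => ->.
rewrite normrM (ger0_norm T0).
apply: (@le_trans _ _ (e / (T + 1) * T)).
  rewrite ler_wpM2r//; apply: (Heta c c (X a c) (X b c)) => //.
  - exact: HM.
  - by rewrite subrr normr0 ltW.
  - apply: le_trans (HC _ _ _ ak bk cI) _.
    by rewrite mulrC -ler_pdivlMr// ltW.
by rewrite mulrAC ler_pdivrMr ?ltr_wpDl// ler_wpM2l ?(ltW e0)// lerDl.
Qed.

Definition jacobian_at a : R := expR (Lam a T).

Lemma jacobian_at_continuous : continuous jacobian_at.
Proof.
move=> a; apply: (@continuous_comp _ _ _ (Lam ^~ T) expR).
  exact: log_jacobian_at_continuous.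
exact: continuous_expR.
Qed.

Lemma jacobian_at_gt0 a : 0 < jacobian_at a. Proof. exact: expR_gt0. Qed.

Lemma jacobian_at_ge0 a : 0 <= jacobian_at a. Proof. exact: expR_ge0. Qed.

Lemma measurable_jacobian_at : measurable_fun setT jacobian_at.
Proof. exact: continuous_measurable_rV jacobian_at_continuous. Qed.

Local Notation jac := (density leb measurable_jacobian_at jacobian_at_ge0).

Lemma jacobian_box_finite k : (jac (closed_box k) < +oo)%E.
Proof.
have [C [_ HC]] := compact_bounded (continuous_compact
  (continuous_subspaceT jacobian_at_continuous) (@compact_closed_box R n k)).
have mB := closed_measurable_rV (@closed_closed_box R n k).
apply: (@le_lt_trans _ _ (\int[leb]_(x in closed_box k) (cst (`|C| + 1)%:E x))%E).
  apply: ge0_le_integral => //.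
  - by move=> x _; rewrite lee_fin jacobian_at_ge0.
  - apply/measurable_EFinP; apply: measurable_funTS; exact: measurable_jacobian_at.
  - move=> x Bx; rewrite lee_fin; apply: le_trans (ler_norm _) _.
    by apply: HC; [rewrite (le_lt_trans (ler_norm C))// ltrDl|exists x].
rewrite integral_cst// lte_mul_pinfty// ?lee_fin ?addr_ge0//.
exact: product_lebesgue_box_finite.
Qed.

Let compact_box A : compact A -> exists k : R, A `<=` closed_box k.
Proof.
move=> cA; have [C [_ HC]] := compact_bounded cA.
by exists (C + 1) => x Ax; apply: HC; rewrite ?ltrDl.
Qed.

Let compact_image A : compact A -> compact (X ^~ T @` A).
Proof.
move=> cA; apply: continuous_compact => //.
by apply: continuous_subspaceT; exact: (flow_at_continuous vD T0 vX TT).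
Qed.

(** An approximation Phi of the flow maps A into a small neighbourhood of the
image of A, whose measure is close to that of the image; and Phi @` A has measure
the integral over A of P, which is at least expR (- delta) times the Jacobian. *)
Lemma jacobian_le_image A (delta : R) : compact A -> 0 < delta ->
  ((expR (- delta))%:E * jac A <= leb (X ^~ T @` A) + delta%:E)%E.
Proof.
move=> cA d0; have [k Ak] := compact_box cA.
have [e /andP[e0 _] He] := measure_neighbourhood (@product_lebesgue_box_finite R n)
  (compact_image cA) d0.
have [kappa kappa0 approx] := flow_approximation vD T0 vX LamP k.
have ed0 : 0 < Num.min e delta by rewrite lt_min e0.
have [Phi [P [tP HP]]] := approx _ ed0.
have mA := compact_measurable_rV cA.
have cPA : compact (Phi @` A).
  apply: continuous_compact => //; apply: continuous_subspaceT.
  exact: expanding_continuous tP.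
apply: le_trans He.
apply: (@le_trans _ _ (leb (Phi @` A))); last first.
  apply: le_measure; rewrite ?inE.
  - exact: compact_measurable_rV.
  - by apply: compact_measurable_rV; apply: compact_neighbourhood; exact: compact_image.
  - move=> _ [a Aa <-]; exists (X a T); first by exists a.
    by have [+ _] := HP a (Ak a Aa); rewrite le_min => /andP[].
rewrite (transports_measure (expanding_transports tP)
  (expanding_injective kappa0 tP) mA (compact_measurable_rV cPA)).
rewrite /= /density -ge0_integralZl//; last 2 first.
- by apply/measurable_EFinP; apply: measurable_funTS; exact: measurable_jacobian_at.
- by move=> x _; rewrite lee_fin jacobian_at_ge0.
apply: ge0_le_integral => //.
- by move=> x _; rewrite mule_ge0// lee_fin ?expR_ge0 ?jacobian_at_ge0.
- apply: emeasurable_funM => //; apply/measurable_EFinP; apply: measurable_funTS.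
  exact: measurable_jacobian_at.
- apply/measurable_EFinP; apply: measurable_funTS.
  exact: transports_weight (expanding_transports tP).
- move=> x Ax; have [_ /andP[+ _]] := HP x (Ak x Ax).
  rewrite -EFinM lee_fin; apply: le_trans.
  by rewrite -expRD ler_expR addrC lerD2l lerN2 ge_min lexx orbT.
Qed.

(** The converse comparison uses the inverse of Phi. A point X a T is Phi b for
some b, and kappa * |b - a| <= |X a T - Phi a| <= kappa * e, so the image of A lies
in the image by Phi of the e-neighbourhood of A. *)
Lemma image_le_jacobian A (delta : R) : compact A -> 0 < delta ->
  (leb (X ^~ T @` A) <= (expR delta)%:E * (jac A + delta%:E))%E.
Proof.
move=> cA d0; have [k Ak] := compact_box cA.
have [e /andP[e0 e1] He] := measure_neighbourhood jacobian_box_finite cA d0.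
have [kappa kappa0 approx] := flow_approximation vD T0 vX LamP (k + 1).
(* accuracy kappa * e in the image gives accuracy e in the domain *)
have ed0 : 0 < Num.min (kappa * e) delta by rewrite lt_min d0 mulr_gt0.
have [Phi [P [tP HP]]] := approx _ ed0.
have cN := compact_neighbourhood (e := e) cA.
have mN := compact_measurable_rV cN.
have Nk x : neighbourhood e A x -> `|x| <= k + 1.
  move=> [a Aa xa]; rewrite -(subrK a x) addrC.
  by apply: le_trans (ler_normD _ _) _; rewrite lerD ?Ak// (le_trans xa).
have cPN : compact (Phi @` (neighbourhood e A)).
  apply: continuous_compact => //; apply: continuous_subspaceT.
  exact: expanding_continuous tP.
apply: (@le_trans _ _ (leb (Phi @` (neighbourhood e A)))).
  apply: le_measure; rewrite ?inE.
  - by apply: compact_measurable_rV; exact: compact_image.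
  - exact: compact_measurable_rV.
  - move=> _ [a Aa <-].
    have [b bE] := expanding_surjective tP (X a T).
    exists b => //; exists a => //.
    rewrite -(ler_pM2l kappa0); apply: le_trans (expanding_lower tP _ _) _.
    have [|+ _] := HP a; first by rewrite (le_trans (Ak a Aa))// lerDl.
    by rewrite bE distrC le_min => /andP[].
rewrite (transports_measure (expanding_transports tP)
  (expanding_injective kappa0 tP) mN (compact_measurable_rV cPN)).
apply: (@le_trans _ _ ((expR delta)%:E * jac (neighbourhood e A))%E); last first.
  by rewrite lee_wpmul2l// lee_fin expR_ge0.
rewrite /= /density -ge0_integralZl//; last 2 first.
- by apply/measurable_EFinP; apply: measurable_funTS; exact: measurable_jacobian_at.
- by move=> x _; rewrite lee_fin jacobian_at_ge0.
apply: ge0_le_integral => //.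
- by move=> x _; rewrite lee_fin (transports_ge0 (expanding_transports tP)).
- apply/measurable_EFinP; apply: measurable_funTS.
  exact: transports_weight (expanding_transports tP).
- apply: emeasurable_funM => //; apply/measurable_EFinP; apply: measurable_funTS.
  exact: measurable_jacobian_at.
- move=> x Nx; have [_ /andP[_ +]] := HP x (Nk x Nx).
  rewrite -EFinM lee_fin => /le_trans; apply.
  by rewrite -expRD ler_expR addrC lerD2r ge_min lexx orbT.
Qed.

(** Let delta tend to 0 in the two inequalities; both measures are finite. *)
Lemma compact_image_measure A : compact A -> leb (X ^~ T @` A) = jac A.
Proof.
move=> cA.
have finbox (m : {measure set 'rV[R]_n -> \bar R}) B :
    (forall k, m (closed_box k) < +oo)%E -> compact B -> m B \is a fin_num.
  move=> moo cB; have [k Bk] := compact_box cB.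
  rewrite ge0_fin_numE//; apply: le_lt_trans (moo k); apply: le_measure; rewrite ?inE//.
    exact: compact_measurable_rV.
  by apply: closed_measurable_rV; exact: closed_closed_box.
have fj := finbox jac _ jacobian_box_finite cA.
have fl := finbox leb _ (@product_lebesgue_box_finite R n) (compact_image cA).
have le1 := fun d d0 => @jacobian_le_image A d cA d0.
have le2 := fun d d0 => @image_le_jacobian A d cA d0.
have m0 : (0 <= jac A)%E by [].
have l0 : (0 <= leb (X ^~ T @` A))%E by [].
move: le1 le2 m0 l0; rewrite -(fineK fj) -(fineK fl).
set m := fine (jac A); set l := fine (leb _) => le1 le2; rewrite !lee_fin => m0 l0.
have {}le1 d : 0 < d -> expR (- d) * m <= l + d.
  by move=> /le1; rewrite -EFinM -EFinD lee_fin.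
have {}le2 d : 0 < d -> l <= expR d * (m + d).
  by move=> /le2; rewrite -EFinD -EFinM lee_fin.
congr EFin; apply/eqP; rewrite eq_le; apply/andP; split; apply/ler_addgt0Pr => e e0.
  pose d := Num.min 2^-1 (e / (2 * m + 2)).
  have m2 : 0 < 2 * m + 2 by lra.
  have d0 : 0 < d by rewrite lt_min invr_gt0 ltr0n divr_gt0.
  have [d1 d2] : d <= 2^-1 /\ d <= e / (2 * m + 2).
    by rewrite /d !ge_min !lexx orbT.
  apply: le_trans (le2 d d0) _.
  (* expR d * (m + d) <= (1 + 2 * d) * (m + d) <= m + (2 * m + 2) * d *)
  have ed : expR d <= 1 + 2 * d.
    rewrite -[expR d]invrK -expRN invf_ple ?posrE ?expR_gt0//; last lra.
    apply: le_trans (expR_ge1Dx _).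
    rewrite -[leLHS]mul1r ler_pdivrMr; last lra.
    have : 0 <= d * (1 - 2 * d) by rewrite mulr_ge0 ?(ltW d0)//; lra.
    lra.
  apply: (@le_trans _ _ ((1 + 2 * d) * (m + d))).
    by rewrite ler_wpM2r// addr_ge0// ltW.
  move: d2; rewrite ler_pdivlMr// => d2.
  have : d * d <= d * 2^-1 by rewrite ler_wpM2l// ltW.
  lra.
pose d := e / (m + 1).
have m1 : 0 < m + 1 by lra.
have d0 : 0 < d by rewrite divr_gt0.
have dm : d * m + d = e.
  by rewrite -[X in _ + X]mulr1 -mulrDr /d divfK// gt_eqF.
have := le1 d d0.
have : (1 - d) * m <= expR (- d) * m by rewrite ler_wpM2r// expR_ge1Dx.
lra.
Qed.

End FlowChangeOfVariables.

(** * Images of Borel and Lebesgue measurable sets *)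

Section ImageMeasure.
Local Open Scope ereal_scope.
Context d1 d2 (T1 : measurableType d1) (T2 : measurableType d2) (R : realType).
Variables (mu : {measure set T2 -> \bar R}) (f : T1 -> T2).

(** A measure when f is injective and maps measurable sets to measurable sets. It
is used instead of the push-forward by an inverse since the flow need not be
onto. *)
Definition image_measure of injective f &
    (forall A, measurable A -> measurable (f @` A)) : set T1 -> \bar R :=
  fun A => mu (f @` A).

Hypotheses (injf : injective f) (mf : forall A, measurable A -> measurable (f @` A)).

Let image_measure0 : image_measure injf mf set0 = 0.
Proof. by rewrite /image_measure image_set0 measure0. Qed.

Let image_measure_ge0 A : 0 <= image_measure injf mf A.
Proof. exact: measure_ge0. Qed.

Let image_measure_sigma_additive : semi_sigma_additive (image_measure injf mf).
Proof.
move=> F mF tF mUF; rewrite /image_measure image_bigcup.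
apply: measure_semi_sigma_additive.
- by move=> k; exact: mf.
- apply/trivIsetP => i j _ _ ij; apply/seteqP; split => // y [[x Fx <-]].
  move=> [z Fz /injf zx]; rewrite zx in Fz.
  by move/trivIsetP : tF => /(_ _ _ I I ij) => /seteqP[/(_ x)/= + _]; apply.
- by rewrite -image_bigcup; exact: mf.
Qed.

HB.instance Definition _ := isMeasure.Build _ _ _ (image_measure injf mf)
  image_measure0 image_measure_ge0 image_measure_sigma_additive.

End ImageMeasure.

Section FlowBorel.
Context {R : realType} {n : nat}.
Implicit Types (A B : set 'rV[R]_n).
Variables (v : R -> 'rV[R]_n -> 'rV[R]_n) (D : 'I_n -> R -> 'rV[R]_n -> R).
Hypothesis vD : velocity_field v D.
Variables (T : R) (X : 'rV[R]_n -> R -> 'rV[R]_n) (Lam : 'rV[R]_n -> R -> R).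
Hypothesis T0 : 0 <= T.
Hypothesis vX : flow T v X.
Hypothesis LamP : log_jacobian D T X Lam.

Local Notation leb := (@product_lebesgue R n).
Local Notation XT := (X ^~ T).

Let mJ := measurable_jacobian_at vD T0 vX LamP.
Let J0 := @jacobian_at_ge0 R n T Lam.
Local Notation jac := (density leb mJ J0).

Lemma flow_at_injective : injective XT.
Proof. exact: (flow_injective vD vX T0 (lexx T)). Qed.

Let XT_continuous : continuous XT.
Proof. by apply: (flow_at_continuous vD T0 vX); rewrite in_itv/= T0 lexx. Qed.

Let compact_image A : compact A -> compact (XT @` A).
Proof.
by move=> cA; apply: continuous_compact => //; exact: continuous_subspaceT.
Qed.

(** The sets with a measurable image form a sigma-algebra because the flow is
injective and the image of the whole space is a countable union of compact sets;
it contains the compact sets. *)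
Lemma flow_image_measurable A : measurable A -> measurable (XT @` A).
Proof.
have mT : measurable (XT @` setT).
  rewrite -(bigcup_closed_box n) image_bigcup.
  apply: bigcupT_measurable => k; apply: compact_measurable_rV.
  by apply: compact_image; exact: compact_closed_box.
rewrite [X in X A -> _]measurable_rV_compacts.
apply: (@smallest_sub _ (@sigma_algebra _ setT) [set A | compact A]
  [set A | measurable (XT @` A)]).
  split => /=.
  - by rewrite image_set0.
  - move=> B mB.
    rewrite (_ : XT @` (setT `\` B) = XT @` setT `\` XT @` B).
      exact: measurableD.
    apply/seteqP; split => [_ [x [_ Bx] <-]|_ [[x _ <-] BXx]].
      by split; [exists x|move=> [y By /flow_at_injective yx]; apply: Bx; rewrite -yx].
    by exists x => //; split => // Bx; apply: BXx; exists x.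
  - by move=> F mF; rewrite image_bigcup; exact: bigcupT_measurable.
by move=> B cB /=; apply: compact_measurable_rV; exact: compact_image.
Qed.

(** Two measures that agree on the compact sets, finitely on the boxes, agree on
the Borel sets. *)
Lemma flow_image_measure A : measurable A -> leb (XT @` A) = jac A.
Proof.
move=> mA; pose nu := image_measure leb flow_at_injective flow_image_measurable.
rewrite -[LHS]/(nu A).
apply: (@measure_unique _ _ _ [set A : set 'rV[R]_n | compact A]
  (fun k => closed_box k%:R)) => //.
- exact: measurable_rV_compacts.
- exact: setI_closed_compact.
- by move=> k; exact: compact_closed_box.
- exact: bigcup_closed_box.
- by move=> B cB; exact: (compact_image_measure vD T0 vX LamP).
- move=> k; rewrite /= /image_measure.
  rewrite (compact_image_measure vD T0 vX LamP); last exact: compact_closed_box.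
  exact: jacobian_box_finite.
Qed.

End FlowBorel.

Section LebesgueSets.
Local Open Scope ereal_scope.
Context {R : realType} {n : nat}.
Implicit Types A B : set 'rV[R]_n.
Local Notation leb := (@product_lebesgue R n).
Local Notation outer := ((@product_lebesgue R n)^*)%mu.

Lemma borel_lebesgue_measurable A : measurable A -> lebesgue_measurable A.
Proof. exact: caratheodory_measurable_mu_ext. Qed.

Lemma lebesgue_rV_borel A : measurable A -> lebesgue_rV n A = leb A.
Proof. by move=> mA; rewrite /lebesgue_rV /completed_measure_extension/= (measurable_mu_extE leb). Qed.

(** The intersection of countable covers whose measures tend to the outer
measure. *)
Lemma outer_measurable_cover A : outer A < +oo ->
  exists F, [/\ measurable F, A `<=` F & leb F = outer A].
Proof.
move=> Aoo.
have fA : outer A \is a fin_num by rewrite ge0_fin_numE// outer_measure_ge0.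
have cover k : exists F, [/\ measurable F, A `<=` F &
    leb F <= outer A + k.+1%:R^-1%:E].
  have : (0 < k.+1%:R^-1 :> R)%R by rewrite invr_gt0.
  move: (fA) => /lb_ereal_inf_adherent/[apply] -[_ /= [G [mG AG] <-] GA].
  exists (\bigcup_i G i); split => //; first exact: bigcupT_measurable.
  apply: le_trans (ltW GA); rewrite -(measurable_mu_extE leb).
    apply: le_trans (outer_measure_sigma_subadditive outer G) _.
    apply: lee_nneseries => // i _.
    suff : outer (G i) <= leb (G i) by [].
    by rewrite (measurable_mu_extE leb).
  exact: bigcupT_measurable.
have /choice[F HF] := cover.
have mF : measurable (\bigcap_k F k).
  by apply: bigcapT_measurable => k; have [] := HF k.
have AF : A `<=` \bigcap_k F k by move=> x Ax k _; have [_ + _] := HF k; exact.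
exists (\bigcap_k F k); split => //.
apply/eqP; rewrite eq_le; apply/andP; split; last first.
  by rewrite -(measurable_mu_extE leb)//; exact: le_outer_measure.
apply/lee_addgt0Pr => e e0.
have [k _ /(_ k (leqnn k))/= ke] := near_infty_natSinv_lt (PosNum e0).
have [mFk _ Fk] := HF k.
apply: (@le_trans _ _ (leb (F k))).
  by apply: le_measure; rewrite ?inE//; exact: bigcap_inf.
by apply: le_trans Fk _; rewrite leeD2l// lee_fin ltW.
Qed.

(** For finite measure, cover the set by a Borel set F of the same measure and
remove from F a Borel null set that covers the excess; the boxes reduce the general
case to this one. *)
Lemma lebesgue_measurable_sandwich B : lebesgue_measurable B ->
  exists B1 B2, [/\ measurable B1, measurable B2, B1 `<=` B, B `<=` B2 &
    leb (B2 `\` B1) = 0].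
Proof.
have fin E : lebesgue_measurable E -> outer E < +oo ->
    exists B1 B2, [/\ measurable B1, measurable B2, B1 `<=` E, E `<=` B2 &
    leb (B2 `\` B1) = 0].
  move=> mE Eoo.
  have [F [mF EF FE]] := outer_measurable_cover Eoo.
  have mF' := borel_lebesgue_measurable mF.
  have FE0 : outer (F `\` E) = 0.
    have FF : outer F = leb F by exact: measurable_mu_extE.
    have Foo : lebesgue_rV n F < +oo by rewrite lebesgue_rV_borel// FE.
    have DE : outer (F `\` E) = outer F - outer (F `&` E) :=
      @measureD _ _ _ (lebesgue_rV n) F E mF' mE Foo.
    have FEE : F `&` E = E by apply/setIidPr.
    by rewrite DE FEE FF FE subee// ge0_fin_numE// outer_measure_ge0.
  have [|G [mG FEG G0]] := @outer_measurable_cover (F `\` E); first by rewrite FE0.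
  exists (F `\` G), F; split => //.
  - exact: measurableD.
  - by move=> x [Fx Gx]; apply: contrapT => Ex; apply: Gx; exact: FEG.
  - apply/eqP; rewrite eq_le measure_ge0 andbT -FE0 -G0.
    apply: le_measure; rewrite ?inE//.
      by apply: measurableD => //; exact: measurableD.
    by move=> x [Fx FGx]; apply: contrapT => Gx; apply: FGx.
move=> mB.
have mbox k : measurable (@closed_box R n k).
  by apply: closed_measurable_rV; exact: closed_closed_box.
have /choice[B1 /choice[B2 HB]] : forall k : nat, exists B1 B2,
    [/\ measurable B1, measurable B2, B1 `<=` B `&` closed_box k%:R,
      B `&` closed_box k%:R `<=` B2 & leb (B2 `\` B1) = 0].
  move=> k; apply: fin.
    by apply: measurableI => //; apply: borel_lebesgue_measurable.
  apply: (@le_lt_trans _ _ (outer (closed_box k%:R))).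
    exact: le_outer_measure.
  by rewrite (measurable_mu_extE leb)//; exact: product_lebesgue_box_finite.
exists (\bigcup_k B1 k), (\bigcup_k B2 k).
have mB1 k : measurable (B1 k) by have [] := HB k.
have mB2 k : measurable (B2 k) by have [] := HB k.
split.
- exact: bigcupT_measurable.
- exact: bigcupT_measurable.
- by move=> x [k _ B1x]; have [_ _ + _ _] := HB k; move=> /(_ x B1x)[].
- move=> x Bx; have : [set: 'rV[R]_n] x by [].
  rewrite -(bigcup_closed_box n) => -[k _ kx]; exists k => //.
  by have [_ _ _ + _] := HB k; apply.
- have mD k : measurable (B2 k `\` B1 k) by exact: measurableD.
  have : leb (\bigcup_k (B2 k `\` B1 k)) = 0.
    apply/eqP; rewrite eq_le measure_ge0 andbT -(measurable_mu_extE leb).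
      apply: le_trans (outer_measure_sigma_subadditive outer _) _.
      rewrite eseries0// => k _ _.
      suff : outer (B2 k `\` B1 k) = 0 by [].
      by rewrite (measurable_mu_extE leb)//; have [] := HB k.
    exact: bigcupT_measurable.
  move=> U0; apply/eqP; rewrite eq_le measure_ge0 andbT -U0.
  apply: le_measure; rewrite ?inE.
  + by apply: measurableD; exact: bigcupT_measurable.
  + exact: bigcupT_measurable.
  + by move=> x [[k _ B2x] B1x]; exists k => //; split => // B1k; apply: B1x; exists k.
Qed.

(** The converse of lebesgue_measurable_sandwich, by completeness. *)
Lemma lebesgue_measurable_squeeze B1 B2 B : measurable B1 -> measurable B2 ->
  B1 `<=` B -> B `<=` B2 -> leb (B2 `\` B1) = 0 ->
  lebesgue_measurable B /\ lebesgue_rV n B = leb B1.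
Proof.
move=> mB1 mB2 B1B BB2 B0.
have N0 : outer (B `\` B1) = 0.
  apply/eqP; rewrite eq_le outer_measure_ge0 andbT -B0.
  rewrite -(measurable_mu_extE leb); last exact: measurableD.
  by apply: le_outer_measure => x [Bx B1x]; split => //; exact: BB2.
have mN : lebesgue_measurable (B `\` B1).
  apply: (@measure_is_complete_caratheodory _ _ outer (B `\` B1)).
  exists (B2 `\` B1); split.
  - by apply: borel_lebesgue_measurable; exact: measurableD.
  - suff : outer (B2 `\` B1) = 0 by [].
    by rewrite (measurable_mu_extE leb)//; exact: measurableD.
  - by move=> x [Bx B1x]; split => //; exact: BB2.
have BE : B = B1 `|` (B `\` B1).
  by rewrite setUDr setDv setD0; apply/esym/setUidPr.
have mB1' := borel_lebesgue_measurable mB1.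
split; first by rewrite BE; exact: measurableU.
have disj : B1 `&` (B `\` B1) = set0.
  by apply/seteqP; split => // x [B1x [_]]; apply.
have UE : outer (B1 `|` (B `\` B1)) = outer B1 + outer (B `\` B1) :=
  @measureU _ _ _ (lebesgue_rV n) _ _ mB1' mN disj.
suff : outer B = leb B1 by [].
by rewrite [in LHS]BE UE N0 adde0 (measurable_mu_extE leb).
Qed.

End LebesgueSets.

(** * Change of variables along the flow *)

Section LebesgueIntegral.
Local Open Scope ereal_scope.
Context {R : realType} {n : nat}.
Local Notation leb := (@product_lebesgue R n).
Local Notation lebT := (caratheodory_type ((@product_lebesgue R n)^*)%mu).

Lemma borel_lebesgue_measurable_fun d' (U : measurableType d') (f : 'rV[R]_n -> U) :
  measurable_fun setT f -> measurable_fun [set: lebT] (f : lebT -> U).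
Proof.
move=> mf _ Y mY; rewrite setTI; apply: borel_lebesgue_measurable.
by rewrite -[f @^-1` _]setTI; exact: mf.
Qed.

(** The identity from the Lebesgue to the Borel sigma-algebra is measurable and
pushes the completed measure to the product measure. *)
Lemma integral_lebesgue_rV_borel (A : set 'rV[R]_n) (f : 'rV[R]_n -> \bar R) :
  measurable A -> measurable_fun setT f -> (forall x, 0 <= f x) ->
  \int[lebesgue_rV n]_(x in A) f x = \int[leb]_(x in A) f x.
Proof.
move=> mA mf f0.
have mid : measurable_fun [set: lebT] (id : lebT -> 'rV[R]_n).
  by apply: borel_lebesgue_measurable_fun; exact: measurable_id.
have := @ge0_integral_pushforward _ _ _ _ _ _ mid (lebesgue_rV n) A f mA
  (measurable_funTS mf) (fun x _ => f0 x).
rewrite preimage_id => <-.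
by apply: eq_measure_integral => B mB _; exact: lebesgue_rV_borel.
Qed.

End LebesgueIntegral.

Section FlowLebesgue.
Local Open Scope ereal_scope.
Context {R : realType} {n : nat}.
Implicit Types (A B : set 'rV[R]_n).
Variables (v : R -> 'rV[R]_n -> 'rV[R]_n) (D : 'I_n -> R -> 'rV[R]_n -> R).
Hypothesis vD : velocity_field v D.
Variables (T : R) (X : 'rV[R]_n -> R -> 'rV[R]_n) (Lam : 'rV[R]_n -> R -> R).
Hypothesis T0 : (0 <= T)%R.
Hypothesis vX : flow T v X.
Hypothesis LamP : log_jacobian D T X Lam.

Local Notation leb := (@product_lebesgue R n).
Local Notation lebT := (caratheodory_type ((@product_lebesgue R n)^*)%mu).
Local Notation XT := (X ^~ T).
Local Notation J := (jacobian_at T Lam).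

Let mJ := measurable_jacobian_at vD T0 vX LamP.
Let J0 := @jacobian_at_ge0 R n T Lam.
Let injX := flow_at_injective vD T0 vX.

Let mJL : measurable_fun [set: lebT] (J : lebT -> R).
Proof. exact: borel_lebesgue_measurable_fun mJ. Qed.

(** The flow maps a Borel null set to a null set by flow_image_measure, so it maps
a sandwich of A to a sandwich of the image. *)
Lemma flow_image_lebesgue A : lebesgue_measurable A ->
  lebesgue_measurable (XT @` A) /\
  lebesgue_rV n (XT @` A) = \int[lebesgue_rV n]_(x in A) (J x)%:E.
Proof.
move=> mA; have [B1 [B2 [mB1 mB2 B1A AB2 B0]]] := lebesgue_measurable_sandwich mA.
have mX B : measurable B -> measurable (XT @` B).
  exact: (flow_image_measurable vD T0 vX).
have mB21 : measurable (B2 `\` B1) by exact: measurableD.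
have X0 : leb (XT @` B2 `\` XT @` B1) = 0.
  have -> : XT @` B2 `\` XT @` B1 = XT @` (B2 `\` B1).
    apply/seteqP; split => [_ [[x B2x <-] B1x]|_ [x [B2x B1x] <-]].
      by exists x => //; split => // ?; apply: B1x; exists x.
    by split; [exists x|move=> [y B1y /injX yx]; apply: B1x; rewrite -yx].
  rewrite (flow_image_measure vD T0 vX LamP)//= /density.
  apply: null_set_integral => //.
  by apply/measurable_EFinP; exact: measurable_funTS.
have [||mXA XAE] := lebesgue_measurable_squeeze (mX _ mB1) (mX _ mB2) _ _ X0
  (B := XT @` A).
- exact: image_subset.
- exact: image_subset.
split => //; rewrite XAE (flow_image_measure vD T0 vX LamP)//= /density.
have mJE : measurable_fun setT (EFin \o J) by exact/measurable_EFinP.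
rewrite -(integral_lebesgue_rV_borel mB1 mJE (fun x => J0 x)).
have [mN N0] : lebesgue_measurable (A `\` B1) /\ lebesgue_rV n (A `\` B1) = 0.
  have [] := @lebesgue_measurable_squeeze R n set0 (B2 `\` B1) (A `\` B1) measurable0
    mB21 _ _ _ => //.
  - by move=> x [Ax B1x]; split => //; exact: AB2.
  - by rewrite setD0.
  - by move=> mN ->; rewrite measure0.
(* the integrals over A and over B1 differ by a null set *)
have -> : B1 = A `\` (A `\` B1) by rewrite setDD; apply/esym/setIidPr.
apply/esym; apply: ge0_negligible_integral => //.
- by apply/measurable_EFinP; exact: measurable_funTS.
- by move=> x _; rewrite lee_fin.
Qed.

(** As the Jacobian is positive, a Borel set with a null image is null, so the
preimage of a sandwich is a sandwich. *)
Lemma flow_preimage_lebesgue B : lebesgue_measurable B ->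
  lebesgue_measurable (XT @^-1` B).
Proof.
move=> mB; have [B1 [B2 [mB1 mB2 B1B BB2 B0]]] := lebesgue_measurable_sandwich mB.
have cX : continuous XT.
  by apply: (flow_at_continuous vD T0 vX); rewrite in_itv/= T0 lexx.
have mXp C : measurable C -> measurable (XT @^-1` C).
  by move=> mC; rewrite -[X in measurable X]setTI; exact: continuous_measurable_rV_rV.
have mB21 : measurable (B2 `\` B1) by exact: measurableD.
pose Z := XT @^-1` (B2 `\` B1).
have mZ : measurable Z by exact: mXp.
have Z0 : leb Z = 0.
  have intZ : \int[leb]_(x in Z) `|(J x)%:E| = 0.
    under eq_integral do rewrite gee0_abs ?lee_fin//.
    have := flow_image_measure vD T0 vX LamP mZ; rewrite /= /density => <-.
    apply/eqP; rewrite eq_le measure_ge0 andbT -B0; apply: le_measure; rewrite ?inE//.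
      exact: (flow_image_measurable vD T0 vX).
    by move=> _ [x Zx <-].
  have mJZ : measurable_fun Z (EFin \o J).
    by apply/measurable_EFinP; exact: measurable_funTS.
  have [N [mN N0 ZN]] := (ae_eq_integral_abs leb mZ mJZ).1 intZ.
  apply/eqP; rewrite eq_le measure_ge0 andbT -N0; apply: le_measure; rewrite ?inE//.
  move=> x Zx; apply: ZN => /= /(_ Zx) [Jx].
  by have := jacobian_at_gt0 T Lam x; rewrite Jx ltxx.
have [|||//] := lebesgue_measurable_squeeze (mXp _ mB1) (mXp _ mB2) _ _ _
  (B := XT @^-1` B).
- exact: preimage_subset.
- exact: preimage_subset.
- exact: Z0.
Qed.

(** By flow_image_lebesgue, Lebesgue measure on the image is the push-forward of
the measure with density J. *)
Lemma flow_change_of_variables A (g : 'rV[R]_n -> \bar R) :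
  lebesgue_measurable A ->
  measurable_fun (A : set lebT) (g \o XT : lebT -> \bar R) ->
  (forall x, A x -> 0 <= g (XT x)) ->
  measurable_fun (XT @` A : set lebT) (g : lebT -> \bar R) /\
  \int[lebesgue_rV n]_(x in XT @` A) g x =
  \int[lebesgue_rV n]_(x in A) (g (XT x) * (J x)%:E).
Proof.
move=> mA mgX g0.
have [mXA _] := flow_image_lebesgue mA.
have preK : XT @^-1` (XT @` A) = A.
  apply/seteqP; split => [x [y Ay /injX <-]//|x Ax]; by exists x.
have mg : measurable_fun (XT @` A : set lebT) (g : lebT -> \bar R).
  move=> _ Y mY.
  have -> : XT @` A `&` g @^-1` Y = XT @` (A `&` (g \o XT) @^-1` Y).
    apply/seteqP; split => [_ [[x Ax <-] gx]|_ [x [Ax gx] <-]].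
      by exists x.
    by split => //; exists x.
  apply: (flow_image_lebesgue _).1.
  exact: mgX.
split => //.
have mXL : measurable_fun [set: lebT] (XT : lebT -> lebT).
  by move=> _ Y mY; rewrite setTI; exact: flow_preimage_lebesgue.
transitivity (\int[pushforward (density (lebesgue_rV n) mJL J0) (XT : lebT -> lebT)]_(x in XT @` A) g x).
  apply: eq_measure_integral => B mB BA; rewrite /pushforward /= /density.
  have [_ XE] := flow_image_lebesgue (flow_preimage_lebesgue mB).
  suff : lebesgue_rV n B = \int[lebesgue_rV n]_(x in XT @^-1` B) (J x)%:E by [].
  rewrite -XE; congr (lebesgue_rV n _); apply/seteqP; split => [y By|_ [x Bx <-]//].
  by have [x _ xy] := BA y By; exists x; rewrite //= xy.
rewrite ge0_integral_pushforward//; last first.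
  by move=> y; rewrite inE => -[x Ax <-]; exact: g0.
by rewrite preK ge0_integral_density_in.
Qed.

(** The density r at X a T is rho0 a / J a, and the Jacobian of the change of
variables cancels the denominator. *)
Lemma flow_mass (rho0 r : 'rV[R]_n -> R) A :
  (forall x, (0 <= rho0 x)%R) ->
  (lebesgue_rV n).-integrable setT (EFin \o rho0) ->
  (forall x, (r (XT x) * J x = rho0 x)%R) ->
  lebesgue_measurable A ->
  [/\ lebesgue_measurable (XT @` A),
      (lebesgue_rV n).-integrable (XT @` A) (EFin \o r) &
      \int[lebesgue_rV n]_(x in XT @` A) (r x)%:E =
      \int[lebesgue_rV n]_(x in A) (rho0 x)%:E].
Proof.
move=> rho00 irho0 rE mA.
have rE' x : (r (XT x) = rho0 x * (J x)^-1)%R.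
  by rewrite -rE mulfK// gt_eqF// jacobian_at_gt0.
have r0 x : (0 <= r (XT x))%R by rewrite rE' mulr_ge0// invr_ge0.
have mrX : measurable_fun (A : set lebT) ((EFin \o r) \o XT : lebT -> \bar R).
  have -> : (EFin \o r) \o XT = EFin \o (fun x => rho0 x * (J x)^-1)%R.
    by apply/funext => x /=; rewrite rE'.
  apply/measurable_EFinP; apply: measurable_funTS; apply: measurable_funM.
    by apply/measurable_EFinP; exact: measurable_int irho0.
  apply: borel_lebesgue_measurable_fun; apply: continuous_measurable_rV => x.
  apply: (@cvgV _ _ (nbhs x) _ J (J x)).
    by rewrite gt_eqF// jacobian_at_gt0.
  exact: (jacobian_at_continuous vD T0 vX LamP).
have [mr intr] := @flow_change_of_variables A (EFin \o r) mA mrX (fun x _ => r0 x).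
have [mXA _] := flow_image_lebesgue mA.
have intE : \int[lebesgue_rV n]_(x in XT @` A) (r x)%:E =
    \int[lebesgue_rV n]_(x in A) (rho0 x)%:E.
  rewrite [LHS]intr; apply: eq_integral => x _.
  by rewrite /= -EFinM rE.
have iA : (lebesgue_rV n).-integrable A (EFin \o rho0).
  exact: integrableS irho0.
split => //; apply/integrableP; split => //.
have -> : \int[lebesgue_rV n]_(x in XT @` A) `|(EFin \o r) x| =
    \int[lebesgue_rV n]_(x in XT @` A) (r x)%:E.
  by apply: eq_integral => y; rewrite inE => -[x _ <-] /=; rewrite ger0_norm.
rewrite intE; have /integrableP[_] := iA; apply: le_lt_trans.
by rewrite le_eqVlt; apply/orP; left; apply/eqP; apply: eq_integral => x _ /=;
  rewrite ger0_norm.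
Qed.

End FlowLebesgue.

(** * Directional and one-sided derivatives *)

Section Derivatives.
Context {R : realType}.

Lemma is_derive_bigsum (V W : normedModType R) (I : Type) (r : seq I)
    (f : I -> V -> W) (df : I -> W) (x u : V) :
  (forall i, is_derive x u (f i) (df i)) ->
  is_derive x u (fun y => \sum_(i <- r) f i y) (\sum_(i <- r) df i).
Proof.
move=> fd; elim: r => [|i r IH].
  under eq_fun do rewrite big_nil.
  rewrite big_nil; exact: is_derive_cst.
under eq_fun do rewrite big_cons.
by rewrite big_cons; exact: is_deriveD (fd i) IH.
Qed.

Lemma is_derive_translate (V W : normedModType R) (f : V -> W) (c x u : V) (df : W) :
  is_derive (x - c) u f df -> is_derive x u (fun y => f (y - c)) df.
Proof.
move=> [fd fE].
have E : (fun h : R => h^-1 *: (((fun y => f (y - c)) \o shift x) (h *: u) - f (x - c))) =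
   (fun h : R => h^-1 *: ((f \o shift (x - c)) (h *: u) - f (x - c))).
  by apply/funext => h; rewrite /= /shift/= addrA.
by split; [rewrite /derivable E|rewrite /derive E].
Qed.

Lemma is_derive_line (V W : normedModType R) (f : V -> W) (x u : V) (s : R) (df : W) :
  is_derive (s *: u + x) u f df -> is_derive s 1 (fun r => f (r *: u + x)) df.
Proof.
move=> [fd fE].
have E : (fun h : R => h^-1 *: (((fun r => f (r *: u + x)) \o shift s) (h *: 1) - f (s *: u + x))) =
   (fun h : R => h^-1 *: ((f \o shift (s *: u + x)) (h *: u) - f (s *: u + x))).
  apply/funext => h; rewrite /= /shift/=.
  have -> : h *: (1 : R) = h by rewrite /GRing.scale/= mulr1.
  by rewrite scalerDl addrA.
by split; [rewrite /derivable E|rewrite /derive E].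
Qed.

Lemma cvg_coord n (T : Type) (F : set_system T) (g : T -> 'rV[R]_n)
    (l : 'rV[R]_n) (i : 'I_n) :
  Filter F -> g @ F --> l -> (fun t => g t ord0 i) @ F --> l ord0 i.
Proof.
move=> FF gl; apply: (@continuous_cvg _ _ _ F FF g (fun x : 'rV[R]_n => x ord0 i)) => //.
exact: coord_continuous.
Qed.

Lemma is_derive_coord n (V : normedModType R) (f : V -> 'rV[R]_n) (x u : V)
    (df : 'rV[R]_n) (i : 'I_n) :
  is_derive x u f df -> is_derive x u (fun y => f y ord0 i) (df ord0 i).
Proof.
move=> [fd fE].
have fl : (fun h : R => h^-1 *: ((f \o shift x) (h *: u) - f x)) @ 0^' --> df.
  by rewrite -fE; exact: fd.
have gl : (fun h : R => h^-1 *: (((fun y => f y ord0 i) \o shift x) (h *: u) -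
    f x ord0 i)) @ 0^' --> df ord0 i.
  rewrite (_ : (fun _ => _) = (fun h : R =>
      (h^-1 *: ((f \o shift x) (h *: u) - f x)) ord0 i)); last first.
    by apply/funext => h; rewrite !mxE.
  exact: (@cvg_coord n _ _ _ _ i _ fl).
by split; [apply/cvg_ex; exists (df ord0 i)|apply/cvg_lim].
Qed.

Lemma derive_coord_jacobian n (G : 'rV[R]_n -> 'rV[R]_n) x (i : 'I_n) :
  differentiable G x ->
  is_derive x (delta_mx 0 i) (fun y => G y ord0 i) (jacobian G x i i).
Proof.
move=> dG.
have dGi : is_derive x (delta_mx 0 i) G ('d G x (delta_mx 0 i)).
  by split; [exact: diff_derivable|rewrite deriveE].
have := is_derive_coord i dGi.
by rewrite -mul_rV_lin1 -rowE mxE.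
Qed.

(** The mean value theorem on the segment from y to x, which stays in the box;
the constant bounds the row sums of the Jacobian matrix. *)
Lemma lipschitz_on_box n (G : 'rV[R]_n -> 'rV[R]_n) (M : R) :
  (forall x, differentiable G x) -> continuous (jacobian G) ->
  exists2 L, 0 <= L & forall x y, `|x| <= M -> `|y| <= M ->
    `|G x - G y| <= L * `|x - y|.
Proof.
move=> dG cJ.
have [C [_ HC]] := compact_bounded (continuous_compact
  (continuous_subspaceT cJ) (@compact_closed_box R n M)).
have HC' x : `|x| <= M -> `|jacobian G x| <= `|C| + 1.
  by move=> xM; apply: HC; [rewrite (le_lt_trans (ler_norm C))// ltrDl|exists x].
exists (n%:R * (`|C| + 1)); first by rewrite mulr_ge0// addr_ge0.
move=> x y xM yM; apply: rV_norm_le => [|i].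
  by rewrite !mulr_ge0// addr_ge0.
pose u := x - y.
pose dg (s : R) : R := ('d G (s *: u + y) u) ord0 i.
have dgP (s : R) : is_derive s 1 (fun r : R => G (r *: u + y) ord0 i) (dg s).
  apply: (@is_derive_line _ _ (fun z => G z ord0 i)); apply: is_derive_coord.
  by split; [exact: diff_derivable|rewrite deriveE].
have [|c] := @MVT_segment R _ dg 0 1 ler01 (fun s _ => dgP s).
  apply: continuous_subspaceT => s; apply: differentiable_continuous.
  by apply/derivable1_diffP; have [] := dgP s.
rewrite in_itv/= => /andP[c0 c1].
rewrite scale1r scale0r add0r /u subrK subr0 mulr1 !mxE => ->.
rewrite /dg -mul_rV_lin1 mxE; apply: le_trans (ler_norm_sum _ _ _) _.
have -> : n%:R * (`|C| + 1) * `|x - y| = \sum_(k < n) (`|C| + 1) * `|x - y|.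
  by rewrite sumr_const card_ord -[RHS]mulr_natl mulrA.
apply: ler_sum => k _; rewrite normrM mulrC ler_pM//.
  apply: le_trans (HC' (c *: u + y) _).
    rewrite [leRHS]/Num.norm /= mx_normrE; apply/bigmax_geP; right => /=.
    by exists (k, i).
  have -> : c *: u + y = c *: x + (1 - c) *: y.
    by rewrite /u scalerBr scalerBl scale1r -addrA; congr +%R; rewrite addrC.
  apply: le_trans (ler_normD _ _) _; rewrite !normrZ.
  rewrite (ger0_norm c0) ger0_norm ?subr_ge0//.
  have := ler_wpM2l c0 xM; have := ler_wpM2l (_ : 0 <= 1 - c) yM.
  rewrite subr_ge0 => /(_ c1); lra.
exact: ler_coord_norm.
Qed.

End Derivatives.

Section DeriveWithin.
Context {R : realType} {V : normedModType R}.
Implicit Types (f : R -> V) (T t : R).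

(** Near t the difference quotients are bounded by |l t| + 1. *)
Lemma is_derive_within_continuous f T (l : R -> V) :
  {in `[0, T], forall t, is_derive_within `[0, T] f t (l t)} ->
  {within `[0, T], continuous f}.
Proof.
move=> fd; apply/subspace_continuousP => t tT.
have /cvgrPdist_lt/(_ 1 ltr01) := fd t tT.
move=> /nbhs_ballP[r /= r0 rq].
apply/cvgrPdist_lt => e e0.
apply/nbhs_ballP; exists (Num.min r (e / (`|l t| + 1))) => /=.
  by rewrite lt_min r0 divr_gt0// ltr_wpDl.
move=> s; rewrite /ball/= lt_min => /andP[sr se] sT.
have [->|st] := eqVneq s t; first by rewrite subrr normr0.
have := rq s sr st sT => q1.
have -> : f t - f s = (t - s) *: ((s - t)^-1 *: (f s - f t)).
  rewrite scalerA -[t - s]opprB mulNr divff ?subr_eq0// scaleN1r opprB.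
  by [].
rewrite normrZ.
have q2 : `|(s - t)^-1 *: (f s - f t)| <= `|l t| + 1.
  rewrite -[X in `|X|](subrK (l t)); apply: le_trans (ler_normD _ _) _.
  by rewrite addrC lerD2l distrC ltW.
apply: le_lt_trans (ler_wpM2l _ q2) _ => //.
by rewrite -ltr_pdivlMr// ltr_wpDl.
Qed.

Lemma is_derive_within_interior f T t l : t \in `]0, T[ ->
  is_derive_within `[0, T] f t l -> is_derive t 1 f l.
Proof.
rewrite in_itv/= => /andP[t0 tT] fd.
have fl : (fun h : R => h^-1 *: ((f \o shift t) (h *: 1) - f t)) @ 0^' --> l.
  apply/cvgrPdist_lt => e e0.
  have /cvgrPdist_lt/(_ e e0)/nbhs_ballP[r /= r0 rq] := fd.
  apply/nbhs_ballP; exists (Num.min r (Num.min t (T - t))) => /=.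
    by rewrite !lt_min r0 t0 subr_gt0.
  move=> h; rewrite /ball/= sub0r normrN !lt_min => /and3P[hr ht hT] h0.
  have := rq (h + t); rewrite /ball/= opprD addrCA subrr addr0 normrN => /(_ hr).
  have -> : (h *: (1 : R)) = h by rewrite /GRing.scale/= mulr1.
  rewrite /shift/=; move=> q; have := q; rewrite addrK; apply.
    by apply: contra h0; rewrite -subr_eq0 addrK.
  move: ht hT; rewrite !ltr_norml => /andP[? ?] /andP[? ?].
  by rewrite in_itv/=; apply/andP; split; lra.
by split; [apply/cvg_ex; exists l|apply/cvg_lim].
Qed.

Lemma is_derive_within_constant f T (c : V) t : t \in `[0, T] ->
  (forall s, s \in `[0, T] -> f s = c) -> is_derive_within `[0, T] f t 0.
Proof.
move=> tT fc; apply/cvgrPdist_lt => e e0.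
apply/nbhs_ballP; exists 1 => //= s _ _ sT.
by rewrite fc// fc// subrr scaler0 subrr normr0.
Qed.

End DeriveWithin.

(** * Conservation of mass for the blob method *)

Section Blob.
Context {R : realType} {d : nat}.
Implicit Types (x a : 'rV[R]_d) (s t : R) (j : 'rV[int]_d).
Variables (G : 'rV[R]_d -> 'rV[R]_d) (rho0 : 'rV[R]_d -> R) (h : R).
Hypothesis dG : forall x, differentiable G x.
Hypothesis cJ : continuous (jacobian G).
Hypothesis rho0P : initial_density rho0.
Hypothesis h0 : 0 < h.

(** Grid points outside a large box are outside the support of rho0. Hence the
sum over the grid that defines the velocity is a finite sum over r. *)
Lemma grid_support_finite : exists r : seq 'rV[int]_d,
  uniq r /\ forall j, j \notin r -> rho0 (grid h j) = 0.
Proof.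
have [_ /compact_bounded[C [_ HC]] _] := rho0P.
have HC' x : rho0 x != 0 -> `|x| <= `|C| + 1.
  move=> x0; apply: HC; first by rewrite (le_lt_trans (ler_norm C))// ltrDl.
  exact: subset_closure.
pose N := Num.bound ((`|C| + 1) / h).
have NC : (`|C| + 1) / h < N%:R.
  by apply: archi_boundP; rewrite divr_ge0 ?addr_ge0// ltW.
pose f (M : 'rV['I_(N + N).+1]_d) : 'rV[int]_d :=
  map_mx (fun k : 'I_(N + N).+1 => (k%:Z - N%:Z)%R) M.
exists (undup (codom f)); split; first exact: undup_uniq.
move=> j; rewrite mem_undup => jN; apply/eqP; apply: contraNT jN => /HC' jC.
have jk k : (- N%:Z <= j ord0 k <= N%:Z)%R.
  rewrite -ler_norml -(ler_int R) intr_norm; apply: ltW; apply: le_lt_trans NC.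
  rewrite ler_pdivlMr// mulrC.
  apply: le_trans jC; apply: le_trans (ler_coord_norm _ k).
  by rewrite !mxE normrM (gtr0_norm h0).
(* the entries of j lie in [- N, N], so adding N makes them ordinals *)
have -> : j = f (\row_k inord (absz (j ord0 k + N%:Z)%R)).
  apply/rowP => k; have /andP[jk1 jk2] := jk k; rewrite !mxE.
  move: (j ord0 k : int) jk1 jk2 => z zN1 zN2.
  by rewrite inordK; lia.
exact: codom_f.
Qed.

Section Field.
Variables (T : R) (Xp : 'rV[int]_d -> R -> 'rV[R]_d).
Hypothesis T0 : 0 <= T.
Hypothesis cXp : forall j, {within `[0, T], continuous (Xp j)}.
Variable r : seq 'rV[int]_d.
Hypothesis ur : uniq r.
Hypothesis r0 : forall j, j \notin r -> rho0 (grid h j) = 0.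

Let w j : R := rho0 (grid h j) * h ^+ d.

Let Y j s := Xp j (clampI T s).

(** The particles are followed along the clamped time, so that the field is
continuous in time on the whole line. *)
Definition blob_field s x : 'rV[R]_d := blob_velocity G rho0 h Y x s.

Definition blob_field_derivative (i : 'I_d) s x : R :=
  - \sum_(j <- r) w j * jacobian G (x - Y j s) i i.

Lemma blob_fieldE s x : blob_field s x = - \sum_(j <- r) w j *: G (x - Y j s).
Proof.
rewrite /blob_field /blob_velocity; congr (- _).
rewrite (@fsbigE _ _ _ _ setT r _ ur)//; last by move=> j _ /r0 ->; rewrite mul0r scale0r.
by apply: eq_bigl => j; exact: mem_set.
Qed.

Lemma blob_field_id s x : s \in `[0, T] ->
  blob_field s x = blob_velocity G rho0 h Xp x s.
Proof.
by move=> sT; rewrite /blob_field /blob_velocity; congr (- _);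
  apply: eq_fsbigr => j _; rewrite /Y clampI_id.
Qed.

Let cY j : continuous (Y j).
Proof.
apply: (@continuous_within_comp R 'rV[R]_d `[0, T]%classic (Xp j) (clampI T)).
- exact: cXp.
- exact: clampI_continuous.
- by move=> s; exact: clampI_in.
Qed.

Let shift_continuous j : continuous (fun p : R * 'rV[R]_d => p.2 - Y j p.1).
Proof.
move=> p; apply: (@cvgB _ _ _ (nbhs p) _ snd (fun p => Y j p.1)); first exact: cvg_snd.
apply: (@continuous_comp _ _ _ fst (Y j)); [exact: cvg_fst|exact: cY].
Qed.

Let cG : continuous G.
Proof. by move=> x; exact: differentiable_continuous. Qed.

Lemma blob_velocity_field : velocity_field blob_field blob_field_derivative.
Proof.
split.
- have -> : (fun p : R * 'rV[R]_d => blob_field p.1 p.2) =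
      (fun p => - \sum_(j <- r) w j *: G (p.2 - Y j p.1)).
    by apply/funext => p; rewrite blob_fieldE.
  move=> p; apply: (@cvgN _ _ _ (nbhs p) _ (fun p => \sum_(j <- r) w j *: G (p.2 - Y j p.1))).
  apply: (@continuous_sumr R 'rV[R]_d (R * 'rV[R]_d)%type) => j q.
  apply: cvgZr.
  apply: (@continuous_comp _ _ _ (fun p : R * 'rV[R]_d => p.2 - Y j p.1) G).
    exact: shift_continuous.
  exact: cG.
- move=> i p.
  apply: (@cvgN _ R^o _ (nbhs p) _ (fun p => \sum_(j <- r) w j * jacobian G (p.2 - Y j p.1) i i)).
  apply: (@continuous_sumr R R^o (R * 'rV[R]_d)%type) => j q.
  apply: cvgMr.
  apply: (@continuous_comp _ _ _ (fun p : R * 'rV[R]_d => p.2 - Y j p.1)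
    (fun x => jacobian G x i i)); first exact: shift_continuous.
  apply: (@continuous_comp _ _ _ (jacobian G) (fun A : 'M[R]_d => A i i)).
    exact: cJ.
  exact: coord_continuous.
- move=> i s x.
  have -> : (fun y => blob_field s y ord0 i) =
      - (fun y => \sum_(j <- r) w j * G (y - Y j s) ord0 i).
    apply/funext => y; rewrite blob_fieldE !mxE; congr (- _).
    by rewrite summxE; apply: eq_bigr => j _; rewrite mxE.
  apply: is_deriveN; apply: is_derive_bigsum => j.
  have dGj : is_derive (x - Y j s) (delta_mx 0 i) (fun y => G y ord0 i)
    (jacobian G (x - Y j s) i i) by exact: derive_coord_jacobian.
  have := is_deriveZ (w j) (is_derive_translate dGj); exact.
- move=> M.
  have H j : exists C, 0 <= C /\ forall s x y, `|x| <= M -> `|y| <= M ->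
      `|w j *: G (x - Y j s) - w j *: G (y - Y j s)| <= C * `|x - y|.
    have [B0 [_ HB0]] := compact_bounded (continuous_compact (@cXp j)
      (@segment_compact R 0 T)).
    have HB s : `|Y j s| <= `|B0| + 1.
      apply: HB0; first by rewrite (le_lt_trans (ler_norm B0))// ltrDl.
      by exists (clampI T s) => //; exact: clampI_in.
    have [L L0 HL] := lipschitz_on_box (M + (`|B0| + 1)) dG cJ.
    exists (`|w j| * L); split; first by rewrite mulr_ge0.
    move=> s x y xM yM; rewrite -scalerBr normrZ -mulrA ler_wpM2l//.
    have -> : x - y = (x - Y j s) - (y - Y j s) by rewrite opprB addrA subrK.
    by apply: HL; apply: le_trans (ler_normB _ _) _; rewrite lerD.
  have /choice[C HC] := H.
  exists (\sum_(j <- r) C j); first by apply: sumr_ge0 => j _; have [] := HC j.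
  move=> s x y xM yM; rewrite !blob_fieldE -opprD normrN.
  rewrite -sumrB mulr_suml; apply: le_trans (ler_norm_sum _ _ _) _.
  by apply: ler_sum => j _; exact: (HC j).2.
Qed.

Lemma blob_flow X : blob_trajectories G rho0 h T Xp X -> flow T blob_field X.
Proof.
move=> HX; split.
- by move=> a; have [] := HX a.
- move=> a; have [_ dX] := HX a; exact: is_derive_within_continuous dX.
- move=> a i s sT; have [_ dX] := HX a.
  have sT' : s \in `[0, T] by move: sT; rewrite !in_itv/= => /andP[/ltW-> /ltW->].
  rewrite blob_field_id//; apply: is_derive_coord.
  exact: is_derive_within_interior sT (dX s sT').
Qed.

Lemma blob_divergence s x : s \in `[0, T] ->
  divergence (blob_velocity G rho0 h Xp ^~ s) x =
  \sum_i blob_field_derivative i s x.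
Proof.
move=> sT; apply: eq_bigr => i _; rewrite /partial.
have -> : (fun y => blob_velocity G rho0 h Xp y s 0 i) =
    (fun y => blob_field s y ord0 i).
  by apply/funext => y; rewrite blob_field_id.
by have [] := velocity_derive blob_velocity_field i s x.
Qed.

(** Along a trajectory rho * expR Lam has derivative
(- div v + div v) * rho * expR Lam = 0. *)
Lemma blob_density_jacobian X rho Lam t a : t \in `[0, T] ->
  blob_trajectories G rho0 h T Xp X ->
  blob_density G rho0 h T Xp X rho ->
  log_jacobian blob_field_derivative t X Lam ->
  rho (X a t) t * jacobian_at t Lam a = rho0 a.
Proof.
move=> tT HX Hrho LamP; have [X0 _] := HX a; have [rho00 drho] := Hrho a.
have := tT; rewrite in_itv/= => /andP[t0 tT'].
pose q s := rho (X a s) s * expR (Lam a s).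
have cr : {within `[0, T], continuous (fun s => rho (X a s) s)}.
  exact: is_derive_within_continuous drho.
have dq s : s \in `]0, t[ -> is_derive s 1 q 0.
  move=> st; have sT : s \in `]0, T[.
    by move: st; rewrite !in_itv/= => /andP[-> /lt_le_trans]; apply.
  have sT' : s \in `[0, T] by move: sT; rewrite !in_itv/= => /andP[/ltW-> /ltW->].
  have d1 := is_derive_within_interior sT (drho s sT').
  have d2 := is_derive1_comp (is_derive_expR (Lam a s)) (log_jacobian_derive LamP a st).
  have dq : is_derive s 1 q _ := is_deriveM d1 d2.
  apply: is_derive_eq dq _; rewrite blob_divergence// /GRing.scale/=; ring.
have cq : {within `[0, t], continuous q}.
  have cLam := log_jacobian_continuous LamP (a:=a).
  move=> s; apply: cvgM.
    apply: continuous_subspaceW cr s => s /=.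
    by rewrite !in_itv/= => /andP[-> /le_trans]; apply.
  apply: (@continuous_comp (subspace `[0, t]) _ _ (Lam a) expR); first exact: cLam.
  exact: continuous_expR.
have [c _] := MVT_segment t0 dq cq.
rewrite mul0r => /eqP; rewrite subr_eq0 => /eqP.
by rewrite /q (log_jacobian0 LamP) expR0 mulr1 X0 rho00.
Qed.

End Field.
End Blob.

Theorem mainTheorem4 (R : realType) (d : nat) (hd : (1 <= d)%N)
    (K psi : 'rV[R]_d -> R) (delta : R) (hdelta : 0 < delta)
    (hpsi : mollifier psi)
    (hconv : convolvable K (rescale psi delta))
    (hK : regular_kernel (convolution K (rescale psi delta)))
    (rho0 : 'rV[R]_d -> R) (hrho0 : initial_density rho0)
    (h : R) (hh : 0 < h) (T0 : R) (hT0 : 0 < T0)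
    (Xp : 'rV[int]_d -> R -> 'rV[R]_d)
    (X : 'rV[R]_d -> R -> 'rV[R]_d)
    (rho : 'rV[R]_d -> R -> R) :
  let gradKdelta := gradient (convolution K (rescale psi delta)) in
  blob_particles gradKdelta rho0 h T0 Xp ->
  blob_trajectories gradKdelta rho0 h T0 Xp X ->
  blob_density gradKdelta rho0 h T0 Xp X rho ->
  forall Omega : set 'rV[R]_d, lebesgue_measurable Omega ->
  {in `[0, T0], forall t,
    [/\ lebesgue_measurable (X ^~ t @` Omega),
        (lebesgue_rV d).-integrable (X ^~ t @` Omega) (EFin \o rho ^~ t)
      & is_derive_within `[0, T0]
          (fun s => \int[lebesgue_rV d]_(x in X ^~ s @` Omega) rho x s)
          t 0]}.
Proof.
move=> G HXp HX Hrho Omega mOmega.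
have [_ dG cJ _ _] := hK.
have [rho0_ge0 _ irho0] := hrho0.
have cXp j : {within `[0, T0], continuous (Xp j)}.
  by have [_] := HXp j; exact: is_derive_within_continuous.
have [r [ur r0]] := grid_support_finite hrho0 hh.
have vD := blob_velocity_field dG cJ (ltW hT0) cXp ur r0.
have vX := blob_flow HX.
have mass t : t \in `[0, T0] ->
    [/\ lebesgue_measurable (X ^~ t @` Omega),
      (lebesgue_rV d).-integrable (X ^~ t @` Omega) (EFin \o rho ^~ t) &
      (\int[lebesgue_rV d]_(x in X ^~ t @` Omega) (rho x t)%:E =
       \int[lebesgue_rV d]_(x in Omega) (rho0 x)%:E)%E].
  move=> tT; have := tT; rewrite in_itv/= => /andP[t0 tT0].
  have vXt := flowW tT0 vX.
  have [Lam LamP] := log_jacobian_exists vD t0 vXt.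
  apply: (flow_mass vD t0 vXt LamP rho0_ge0 irho0 _ mOmega) => a.
  exact: (blob_density_jacobian dG cJ (ltW hT0) cXp ur r0 a tT HX Hrho LamP).
move=> t tT; have [m1 m2 _] := mass t tT; split => //.
apply: (is_derive_within_constant
  (c := \int[lebesgue_rV d]_(x in Omega) rho0 x) tT) => s sT.
by have [_ _ E] := mass s sT; rewrite /Rintegral; congr fine; exact: E.
Qed.
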